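(* Let $K$ be a trivially valued field of characteristic $0$ and let $\mathrm M$ be a differential module of rank $r$ over $K((T))$ (with derivation $d/dT$). The following three decompositions of $\mathrm M$ coincide: Robba's decomposition of $\mathrm M$ viewed over $\mathscr H(x_{0,\rho})=K((T))$ (for any $\rho\in]0,1[$), the decomposition of $\mathrm M$ over $K((T))$ by the slopes of its formal Newton polygon, and the Christol–Mebkhout decomposition by slopes of $\mathrm M$ viewed over the Robba ring $\mathfrak R=K((T))$. More precisely, let $S$ be a weak triangulation of $D^-_K(0,1)-\{0\}$ and let $\mu_1\le\mu_2\le\cdots\le\mu_r$ be the slopes of the formal Newton polygon of $\mathrm M$. Then: (i) For all $i=1,\dots,r$ and all $\rho\in]0,1[$ one has $\mathcal R_{S,i}(x_{0,\rho},\mathrm M)=\rho^{\mu_{r-i+1}}$. In particular $\mathrm M$, viewed as a differential module over $\mathfrak R$, is solvable, i.e. $\lim_{\rho\to1^-}\mathcal R_{\emptyset,1}(x_{0,\rho},\mathrm M)=1$. (ii) One has $\Gamma_{S,i}(\mathrm M)=\Gamma_S=]0,x_{0,1}[=D^-_K(0,1)-\{0\}$ for all $i$. The radii of $\mathrm M$ are separated over $D^-_K(0,1)-\{0\}$ (for each $i\ge 2$, $\mathcal R_{S,i-1}(-,\mathrm M)$ and $\mathcal R_{S,i}(-,\mathrm M)$ are either equal everywhere or different everywhere), and there exists a global decomposition of $\mathrm M$ by the radii over $K((T))=\mathcal O(D^-_K(0,1)-\{0\})$. (iii) The formal slopes $\mu_1\le\dots\le\mu_r$ coincide with the Christol–Mebkhout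 slopes $\beta_1\le\dots\le\beta_r$. In particular, if $P$ is a differential operator attached to a cyclic basis of $\mathrm M$, $$\partial_b\mathcal R_{S,1}(x_{0,1},\mathrm M)=\mu_r=\beta_r=\mu_{\max}(P),\qquad \partial_bH_{S,r}(x_{0,1},\mathrm M)=\mathrm{Irr}_{\mathrm{Formal}}(P),$$ where $H_{S,r}=\prod_{i=1}^r\mathcal R_{S,i}$ and $b=]x_{0,1-\varepsilon},x_{0,1}[$ is the germ of segment oriented from $x_{0,1-\varepsilon}$ towards $x_{0,1}$.
   Context: $D^-_K(0,1)$ is the Berkovich open unit disk with coordinate $T$; for $K$ trivially valued, $D^-_K(0,1)-\{0\}$ is the open segment $]0,x_{0,1}[=\{x_{0,\rho}:0<\rho<1\}$, where $x_{0,\rho}$ is the norm $|f|_{0,\rho}=\rho^{v_T(f)}$. As rings, $K((T))=\mathscr H(x_{0,\rho})$ for $0<\rho<1$, $K((T))=\mathcal O(C)$ for every annulus $C\subseteq D^-_K(0,1)$ centered at $0$, and $K((T))=\mathfrak R:=\bigcup_{\varepsilon>0}\mathcal O(C_\varepsilon)$ with $C_\varepsilon=\{1-\varepsilon<|T|<1\}$ (Robba ring). A weak triangulation $S$ of $D^-_K(0,1)-\{0\}$ is a locally finite set of points of type 2 or 3 whose complement has only virtual open disks or annuli as components; its skeleton $\Gamma_S$ is the union of $S$ and the skeletons of the annuli, here automatically $]0,x_{0,1}[$. Radii. Let $\Omega/K$ be a large algebraically closed, spherically complete valued extension with $|\Omega|=\mathbb R_{\geq 0}$ containing all $\mathscr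 H(x_{0,\rho})$ isometrically. For $x=x_{0,\rho}$ let $t_x\in\Omega$ be an $\Omega$-rational point above $x$ and $D(x)$ the largest open disk containing $t_x$ in the fiber of $(D^-_K(0,1))_\Omega\to D^-_K(0,1)$ over $x$ (the generic disk, here of radius $\rho$). $\mathcal R_{S,i}(x,\mathrm M)$ is $1/\rho$ times the radius of the largest open disk centered at $t_x$ in $D(x)$ on which $\mathrm M$ has at least $r-i+1$ $\Omega$-linearly independent horizontal sections. $\mathcal R_{\emptyset,i}$ denotes the same with empty triangulation (of the punctured disk or of $C_\varepsilon$). $\Gamma_{S,i}(\mathrm M)$ is the set of points having no neighborhood which is a virtual open disk disjoint from $\Gamma_S$ and on which $\mathcal R_{S,i}(-,\mathrm M)$ is constant. For a positive function $F$ on $b$, $\partial_bF(x_{0,1})$ is the slope of $\log F$ as a function of $\log\rho$ near $x_{0,1}$ along $b$. Robba's decomposition at $x=x_{0,\rho}$: the unique $\mathrm M=\bigoplus_{0<\sigma\le1}\mathrm M^\sigma$ such that $\mathrm M^\sigma$ has a full basis of solutions on the disk $D(x,\sigma)\subseteq D(x)$ centered at $t_x$ of radius $\sigma$ times that of $D(x)$, and $\mathrm M^\sigma$ has no nonzero sub-module with a full basis of solutions on $D(x,\sigma')$, $\sigma'>\sigma$. Formal Newton polygon: write $\mathrm M\cong K((T))\langle\frac{d}{dT}\rangle/K((T))\langle\frac{d}{dT}\rangle P$, $P=\sum_{k=0}^rg_k(T)(\frac{d}{dT})^k$, $g_r=1$ (cyclic basis). The polygon is the convex hull in $\mathbb R^2$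 of the quadrants $\{(a,c):a\le k,\ c\ge v_T(g_k)+r-k\}$, $k=0,\dots,r$; it is independent of $P$. If it is the epigraph of $h:]-\infty,r]\to\mathbb R$, its slopes are $\mu_i=h(i)-h(i-1)$. Also $\mathrm{Irr}_{\mathrm{Formal}}(P)=\max_{0\le k\le r}\{k-v_T(g_k)\}-(r-v_T(g_r))$ and $\mu_{\max}(P)=\max(0,\max_{0\le k\le r-1}\frac{v_T(g_k)}{k-r}-1)$. $\mathrm M$ is a direct sum of sub-modules $\mathrm M(\mu)$ all of whose formal slopes equal $\mu$ (formal slope decomposition). Christol–Mebkhout slopes: for $\mathrm M$ solvable over $\mathfrak R$, there are $\beta_1\le\cdots\le\beta_r$ with $\mathcal R_{\emptyset,i}(x_{0,\rho},\mathrm M)=\rho^{\beta_{r-i+1}}$ for $\rho<1$ close to $1$, and $\mathrm M$ is a direct sum of sub-modules all of whose slopes equal $\beta$ (Christol–Mebkhout decomposition). *)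

(* Defs.v *)
From HB Require Import structures.
From mathcomp Require Import all_boot all_order all_algebra finmap.
From mathcomp Require Import zify ring.
From mathcomp Require Import boolp classical_sets functions cardinality fsbigop.
From mathcomp Require Import set_interval reals topology normedtype sequences.
From mathcomp Require Import exp convex.
Set Implicit Arguments.
Unset Strict Implicit.
Unset Printing Implicit Defensive.
Import Order.TTheory GRing.Theory Num.Theory numFieldNormedType.Exports.
Local Open Scope classical_set_scope.
Local Open Scope ring_scope.

(* K is a field of characteristic 0 with the trivial absolute value.  The
   differential algebra takes place over the field laurent K = K((T)), which is
   simultaneously the field H(x_{0,rho}) for 0 < rho < 1 (with the norm gauss
   rho below), the ring O(C) of every annulus C centered at 0 in the open unit
   disk, and the Robba ring. *)

(* K((T)): f k is the coefficient of T^k. *)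
Record laurent (K : fieldType) := Laurent {
  lcoef :> int -> K;
  lcoef_bounded : exists a : int, forall k : int, k < a -> lcoef k = 0 }.

HB.instance Definition _ (K : fieldType) := gen_eqMixin (laurent K).
HB.instance Definition _ (K : fieldType) := gen_choiceMixin (laurent K).

Section LaurentField.
Variable K : fieldType.
Implicit Types f g h : laurent K.

Lemma laurentP f g : (forall k, f k = g k) -> f = g.
Proof.
case: f g => [f Hf] [g Hg] /= /funext fg; case: _ / fg in Hg *.
by congr Laurent; exact: Prop_irrelevance.
Qed.

Fact lzero_bounded : exists a : int, forall k, k < a -> (fun=> 0 : K) k = 0.
Proof. by exists 0. Qed.
Definition lzero := Laurent lzero_bounded.

Fact lone_bounded :
  exists a : int, forall k, k < a -> (fun k : int => (k == 0)%:R : K) k = 0.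
Proof. by exists 0 => k; case: ltgtP. Qed.
Definition lone := Laurent lone_bounded.

Fact lopp_bounded f :
  exists a : int, forall k, k < a -> (fun k => - f k) k = 0.
Proof. by have [a fa] := lcoef_bounded f; exists a => k /fa ->; rewrite oppr0. Qed.
Definition lopp f := Laurent (lopp_bounded f).

Fact ladd_bounded f g :
  exists a : int, forall k, k < a -> (fun k => f k + g k) k = 0.
Proof.
have [a fa] := lcoef_bounded f; have [b gb] := lcoef_bounded g.
by exists (Num.min a b) => k; rewrite lt_min => /andP[/fa-> /gb->]; rewrite addr0.
Qed.
Definition ladd f g := Laurent (ladd_bounded f g).

(* Cauchy product; the sum has finite support. *)
Definition lmul_coef f g (n : int) : K :=
  \sum_(i \in [set: int]) f i * g (n - i).

Lemma lmul_coefE f g (a b : int) (n : nat) :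
  (forall k, k < a -> f k = 0) -> (forall k, k < b -> g k = 0) ->
  lmul_coef f g (a + b + n%:Z) =
    \sum_(i < n.+1) f (a + i%:Z) * g (b + (n - i)%N%:Z).
Proof.
move=> fa gb; rewrite -(big_mkord xpredT (fun i => f (a + i%:Z) * g (b + (n - i)%N%:Z))).
have [s [us sP sE]] : exists s : seq int, [/\ uniq s,
    forall i, a <= i <= a + n%:Z -> i \in s &
    \sum_(i <- s) f i * g (a + b + n%:Z - i) =
    \sum_(0 <= i < n.+1) f (a + i%:Z) * g (b + (n - i)%N%:Z)].
  exists [seq a + i%:Z | i <- iota 0 n.+1]; split.
  - by rewrite map_inj_uniq ?iota_uniq // => i j; lia.
  - move=> i ain; apply/mapP; exists `|i - a|%N; last lia.
    by rewrite mem_iota; lia.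
  - rewrite big_map !big_seq; apply: eq_bigr => i.
    by rewrite mem_iota => ?; congr (_ * g _); lia.
rewrite -sE /lmul_coef (fsbigTE [fset x in s]%fset); last first.
  move=> i; rewrite inE => /negP si.
  have [/fa->|ai] := ltP i a; first by rewrite mul0r.
  have [/gb->|bi] := ltP (a + b + n%:Z - i) b; first by rewrite mulr0.
  by case: si; apply: sP; lia.
by apply: perm_big; apply: uniq_perm => // x; rewrite inE.
Qed.

Lemma lmul_coef0 f g (a b : int) k :
  (forall k, k < a -> f k = 0) -> (forall k, k < b -> g k = 0) ->
  k < a + b -> lmul_coef f g k = 0.
Proof.
move=> fa gb kab; rewrite /lmul_coef fsbig1 // => i _.
have [/fa->|ai] := ltP i a; first by rewrite mul0r.
by rewrite gb ?mulr0 //; lia.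
Qed.

Fact lmul_bounded f g : exists a : int, forall k, k < a -> lmul_coef f g k = 0.
Proof.
have [a fa] := lcoef_bounded f; have [b gb] := lcoef_bounded g.
by exists (a + b) => k; exact: lmul_coef0.
Qed.
Definition lmul f g := Laurent (lmul_bounded f g).

Fact laddA : associative ladd.
Proof. by move=> f g h; apply: laurentP => k /=; rewrite addrA. Qed.
Fact laddC : commutative ladd.
Proof. by move=> f g; apply: laurentP => k /=; rewrite addrC. Qed.
Fact ladd0 : left_id lzero ladd.
Proof. by move=> f; apply: laurentP => k /=; rewrite add0r. Qed.
Fact laddN : left_inverse lzero lopp ladd.
Proof. by move=> f; apply: laurentP => k /=; rewrite addNr. Qed.

HB.instance Definition _ := GRing.isZmodule.Build (laurent K) laddA laddC ladd0 laddN.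

Lemma int_split (a k : int) : a <= k -> exists n : nat, k = a + n%:Z.
Proof. by move=> ak; exists `|k - a|%N; lia. Qed.

Fact lmulC : commutative lmul.
Proof.
move=> f g; have [a fa] := lcoef_bounded f; have [b gb] := lcoef_bounded g.
apply: laurentP => k /=; have [kab|/int_split[n ->]] := ltP k (a + b).
  by rewrite (lmul_coef0 fa gb) // (lmul_coef0 gb fa) // addrC.
rewrite (lmul_coefE _ fa gb) [a + b]addrC (lmul_coefE _ gb fa).
rewrite (reindex_inj rev_ord_inj) /=; apply: eq_bigr => i _.
have := ltn_ord i; rewrite mulrC => ?; congr (g _ * f _); lia.
Qed.

Definition ltrunc f (a : int) n : {poly K} := \poly_(i < n) f (a + i%:Z).

Lemma lmul_trunc f g (a b : int) (n m : nat) :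
  (forall k, k < a -> f k = 0) -> (forall k, k < b -> g k = 0) -> (n < m)%N ->
  lmul_coef f g (a + b + n%:Z) = (ltrunc f a m * ltrunc g b m)`_n.
Proof.
move=> fa gb nm; rewrite (lmul_coefE _ fa gb) coefM; apply: eq_bigr => i _.
by have := ltn_ord i; rewrite !coef_poly => ?; rewrite !ifT //; lia.
Qed.

Fact lmulA : associative lmul.
Proof.
move=> f g h.
have [a fa] := lcoef_bounded f; have [b gb] := lcoef_bounded g.
have [c hc] := lcoef_bounded h.
have fg0 := lmul_coef0 fa gb; have gh0 := lmul_coef0 gb hc.
have fg0' k : k < a + b -> lmul f g k = 0 by exact: fg0.
have gh0' k : k < b + c -> lmul g h k = 0 by exact: gh0.
apply: laurentP => k /=; have [kab|/int_split[n ->]] := ltP k (a + b + c).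
  by rewrite (lmul_coef0 fg0' hc) // (lmul_coef0 fa gh0') // addrA.
rewrite (lmul_coefE _ fg0' hc) -[a + b + c]addrA (lmul_coefE _ fa gh0').
pose F := ltrunc f a n.+1; pose G := ltrunc g b n.+1; pose H := ltrunc h c n.+1.
transitivity ((F * (G * H))`_n).
  rewrite coefM; apply: eq_bigr => i _; have := ltn_ord i => ? /=.
  rewrite (lmul_trunc (m := n.+1) gb hc) ?coef_poly ?ifT //; lia.
rewrite mulrA coefM; apply: eq_bigr => i _; have := ltn_ord i => ? /=.
by rewrite (lmul_trunc (m := n.+1) fa gb) ?[H`_ _]coef_poly ?ifT //; lia.
Qed.

Fact lmul1 : left_id lone lmul.
Proof.
move=> f; apply: laurentP => k /=; rewrite /lmul_coef.
rewrite (fsbigTE [fset 0 : int]%fset) => [|i]; last first.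
  by rewrite inE /= => /negPf->; rewrite mul0r.
by rewrite big_seq_fset1 /= mul1r subr0.
Qed.

Fact lmulDl : left_distributive lmul ladd.
Proof.
move=> f g h; have [a fa] := lcoef_bounded f; have [b gb] := lcoef_bounded g.
have [c hc] := lcoef_bounded h; pose m := Num.min a b.
have fm k : k < m -> f k = 0 by rewrite lt_min => /andP[/fa].
have gm k : k < m -> g k = 0 by rewrite lt_min => /andP[_ /gb].
have fgm k : k < m -> ladd f g k = 0 by move=> km /=; rewrite fm ?gm ?addr0.
apply: laurentP => k /=; have [kab|/int_split[n ->]] := ltP k (m + c).
  by rewrite (lmul_coef0 fgm hc) // (lmul_coef0 fm hc) // (lmul_coef0 gm hc) ?addr0.
rewrite (lmul_coefE _ fgm hc) (lmul_coefE _ fm hc) (lmul_coefE _ gm hc).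
by rewrite -big_split; apply: eq_bigr => i _ /=; rewrite mulrDl.
Qed.

Fact lone_neq0 : lone != lzero.
Proof. by apply/eqP => /(congr1 (fun f => f 0)) /= /eqP; rewrite oner_eq0. Qed.

HB.instance Definition _ :=
  GRing.Zmodule_isComNzRing.Build (laurent K) lmulA lmulC lmul1 lmulDl lone_neq0.

Fixpoint linv_seq (F : nat -> K) n : seq K :=
  if n is m.+1 then
    let s := linv_seq F m in
    rcons s ((F 0%N)^-1 * ((m == 0%N)%:R - \sum_(i < m) F (m - i)%N * s`_i))
  else [::].

Lemma size_linv_seq F n : size (linv_seq F n) = n.
Proof. by elim: n => //= n IH; rewrite size_rcons IH. Qed.

Lemma nth_linv_seq F n m : (n < m)%N -> (linv_seq F m)`_n = (linv_seq F n.+1)`_n.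
Proof.
elim: m => // m IH; rewrite ltnS leq_eqVlt => /orP[/eqP-> //|nm].
by rewrite -(IH nm) [linv_seq F m.+1]/= nth_rcons size_linv_seq nm.
Qed.

Lemma linv_series (F : nat -> K) : F 0%N != 0 ->
  exists G : nat -> K,
    forall n, \sum_(i < n.+1) F (n - i)%N * G i = (n == 0%N)%:R.
Proof.
move=> F0; exists (fun n => (linv_seq F n.+1)`_n) => n.
rewrite big_ord_recr /= subnn nth_rcons size_linv_seq ltnn eqxx mulVKf //.
rewrite addrC -[RHS](subrK (\sum_(i < n) F (n - i)%N * (linv_seq F n)`_i)).
congr (_ + _); apply: eq_bigr => i _; congr (_ * _).
by rewrite (@nth_linv_seq F i n) //= nth_rcons size_linv_seq ltnn eqxx.
Qed.

Lemma lvaluation_ex f : f <> 0 ->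
  exists a : int, f a != 0 /\ forall k, k < a -> f k = 0.
Proof.
move=> f0; have [b fb] := lcoef_bounded f.
have [n fn] : exists n : nat, f (b + n%:Z) != 0.
  apply: contrapT => nf; apply: f0; apply: laurentP => k /=.
  have [/fb //|/int_split[n ->]] := ltP k b.
  by apply: contrapT => /eqP ?; apply: nf; exists n.
have [m fm mmin] := ex_minnP (P := fun n : nat => f (b + n%:Z) != 0) (ex_intro _ n fn).
exists (b + m%:Z); split => // k; have [/fb //|/int_split[j ->]] := ltP k b.
move=> jm; apply/eqP; apply: contraLR jm => /mmin; lia.
Qed.

Lemma linv_ex f : f <> 0 -> exists g, f * g = 1.
Proof.
move=> /lvaluation_ex[a [fa0 fa]].
have [|G GE] := @linv_series (fun n => f (a + n%:Z)); first by rewrite addr0.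
pose g0 (k : int) : K := if k < - a then 0 else G (absz (k + a)).
have g0b : forall k, k < - a -> g0 k = 0 by move=> k; rewrite /g0 => ->.
exists (Laurent (ex_intro _ (- a) g0b)).
rewrite mulrC; apply: laurentP => k /=.
have [k0|/int_split[n ->]] := ltP k (- a + a).
  rewrite (lmul_coef0 (a := - a) (b := a)) //; case: eqP => //; lia.
rewrite (lmul_coefE (a := - a) (b := a)) //= addNr add0r.
transitivity (\sum_(i < n.+1) f (a + (n - i)%N%:Z) * G i).
  apply: eq_bigr => i _; rewrite mulrC /g0; congr (_ * _).
  by rewrite ifF; [congr G; lia|lia].
exact: GE.
Qed.

(* 0^-1 = 0, as for every MathComp field. *)
Definition linv f : laurent K := if f == 0 then 0 else xget 0 [set g | f * g = 1].

Fact lmulVf f : f != 0 -> linv f * f = 1.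
Proof.
move=> f0; rewrite /linv (negPf f0) mulrC.
by have /eqP/linv_ex[g fg] := f0; case: xgetP => [y _ //|/(_ g)].
Qed.

Fact linv0 : linv 0 = 0.
Proof. by rewrite /linv eqxx. Qed.

HB.instance Definition _ := GRing.ComNzRing_isField.Build (laurent K) lmulVf linv0.

End LaurentField.

Section LaurentOperations.
Variable K : fieldType.
Implicit Types f : laurent K.

Fact lderiv_bounded f :
  exists a : int, forall k, k < a -> (fun k => f (k + 1) *~ (k + 1)) k = 0.
Proof.
have [a fa] := lcoef_bounded f.
by exists (a - 1) => k ka; rewrite fa ?mul0rz //; lia.
Qed.
Definition lderiv f : laurent K := Laurent (lderiv_bounded f).

Fact laurent_of_poly_bounded (p : {poly K}) :
  exists a : int, forall k : int, k < a -> (if k is Posz n then p`_n else 0) = 0.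
Proof. by exists 0 => -[]. Qed.
Definition laurent_of_poly (p : {poly K}) : laurent K :=
  Laurent (laurent_of_poly_bounded p).

(* The T-adic valuation of a nonzero series; lval 0 is a junk value, so every
   use below excludes f = 0 (for which v_T is +oo). *)
Definition lval f : int :=
  xget 0 [set n : int | f n != 0 /\ forall k, k < n -> f k = 0].

Definition gauss (R : realType) (rho : R) f : R :=
  if f == 0 then 0 else rho ^ lval f.

End LaurentOperations.

Section BerkovichDisk.
Variables (R : realType) (K : fieldType).

(* Points of the Berkovich affine line are seminorms on K[T]; the topology is
   that of pointwise convergence. *)
Definition berkovich : Type := {ptws {poly K} -> R}.
HB.instance Definition _ := Topological.on berkovich.
Implicit Types x : berkovich.

(* Multiplicative seminorms on K[T] inducing the trivial absolute value on K. *)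
Definition affine_line : set berkovich := [set x |
  [/\ forall p, 0 <= x p,
      x 0 = 0,
      forall c : K, c != 0 -> x c%:P = 1,
      forall p q, x (p * q) = x p * x q &
      forall p q, x (p + q) <= Num.max (x p) (x q)]].

Definition unit_disk : set berkovich := [set x | affine_line x /\ x 'X < 1].

Definition origin : berkovich := fun p => (p.[0] != 0)%:R.

Definition punctured_disk : set berkovich := unit_disk `\ origin.

(* x_{0,rho} *)
Definition gauss_point (rho : R) : berkovich :=
  fun p => gauss rho (laurent_of_poly p).

(* ]0, x_{0,1}[ *)
Definition open_segment : set berkovich :=
  [set gauss_point rho | rho in `]0, 1[%classic].

(* Over an algebraic closure of K, the inequality |p| < s with p irreducible
   cuts out the union of the Galois conjugates of one open disk. *)
Definition virtual_open_disk (D : set berkovich) : Prop :=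
  exists (p : {poly K}) (s : R),
    [/\ irreducible_poly p, 0 < s & D = [set x | affine_line x /\ x p < s]].

(* Likewise for annuli.  As the conjugate roots of p are at distance 1 from
   each other, for p of degree > 1 the preimage of {s1 < |p| < s2} is a disjoint
   union of annuli centered at the roots exactly when s2 <= 1 (for s1 >= 1 it is
   an annulus centered at 0, hence already obtained with p = 'X).  The value
   s1 = 0 is allowed: a punctured disk is an annulus. *)
Definition virtual_open_annulus (A : set berkovich) : Prop :=
  exists (p : {poly K}) (s1 s2 : R),
    [/\ irreducible_poly p, 0 <= s1 < s2, size p = 2%N \/ s2 <= 1 &
        A = [set x | affine_line x /\ s1 < x p < s2]].

Definition skeleton (A : set berkovich) : set berkovich :=
  [set x | A x /\ ~ exists D, [/\ virtual_open_disk D, D x & D `<=` A]].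

(* The residue field of H(x) is transcendental over that of K, which is K:
   the reduction of f / g satisfies no polynomial equation Q = 0. *)
Definition type2 x : Prop :=
  exists f g : {poly K}, [/\ x f = x g, x g != 0 &
    forall Q : {poly K}, Q != 0 ->
      x (\sum_(i < size Q) Q`_i *: (f ^+ i * g ^+ ((size Q).-1 - i)))
      = x g ^+ (size Q).-1].

(* The value group of H(x) is not torsion modulo that of K, which is 1. *)
Definition type3 x : Prop :=
  exists f : {poly K}, x f != 0 /\ forall n, (0 < n)%N -> x f ^+ n != 1.

Definition component_of (A C : set berkovich) : Prop :=
  exists2 x, A x & C = connected_component A x.

Definition weak_triangulation (S : set berkovich) : Prop :=
  [/\ S `<=` punctured_disk,
      forall x, S x -> type2 x \/ type3 x,
      forall x, punctured_disk x ->
        exists2 U : set berkovich, nbhs x U & finite_set (U `&` S) &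
      forall C, component_of (punctured_disk `\` S) C ->
        virtual_open_disk C \/ virtual_open_annulus C].

Definition triangulation_skeleton (S : set berkovich) : set berkovich :=
  S `|` [set x | exists C, [/\ component_of (punctured_disk `\` S) C,
                               virtual_open_annulus C & skeleton C x]].

(* Points of the punctured disk without a neighborhood that is a virtual open
   disk, avoids Gamma, and on which F is constant. *)
Definition controlling_graph (Gamma : set berkovich) (F : berkovich -> R) :
    set berkovich :=
  [set x | punctured_disk x /\
    ~ exists D, [/\ virtual_open_disk D, D x, D `<=` punctured_disk,
                    D `&` Gamma = set0 & forall y, D y -> F y = F x]].

(* The slope of F at x_{0,1} along the germ b = ]x_{0,1-eps}, x_{0,1}[ is s:
   log F is, near x_{0,1}, an affine function of log rho with slope s. *)
Definition germ_slope (F : berkovich -> R) (s : R) : Prop :=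
  exists eps c : R, 0 < eps < 1 /\
    forall rho, 1 - eps < rho < 1 -> ln (F (gauss_point rho)) = s * ln rho + c.

End BerkovichDisk.

(* A spherically complete, algebraically closed valued extension Omega of K
   with value set [0, +oo[, containing isometrically every H(x_{0,rho}). *)
Record large_extension (R : realType) (K : fieldType) := LargeExtension {
  Omega : closedFieldType;
  emb : {rmorphism K -> Omega};
  vabs : Omega -> R;
  vabs_ge0 : forall z, 0 <= vabs z;
  vabs_eq0 : forall z, vabs z = 0 <-> z = 0;
  vabsM : forall y z, vabs (y * z) = vabs y * vabs z;
  vabsD : forall y z, vabs (y + z) <= Num.max (vabs y) (vabs z);
  vabs_emb : forall a : K, a != 0 -> vabs (emb a) = 1;
  vabs_onto : forall s : R, 0 <= s -> exists z, vabs z = s;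
  spherically_complete : forall (c : nat -> Omega) (s : nat -> R),
    (forall n, 0 <= s n) ->
    (forall n z, vabs (z - c n.+1) <= s n.+1 -> vabs (z - c n) <= s n) ->
    exists z, forall n, vabs (z - c n) <= s n;
  contains_gauss : forall rho : R, 0 < rho < 1 ->
    exists j : {rmorphism laurent K -> Omega},
      (forall a, j (laurent_of_poly a%:P) = emb a) /\
      (forall f, vabs (j f) = gauss rho f) }.

Section GenericDisk.
Variables (R : realType) (K : fieldType) (V : large_extension R K).
Local Notation W := (Omega V).
Implicit Types (t : W) (x : berkovich R K).

(* The image in the affine line over K of the Omega-rational point t. *)
Definition point_below t : berkovich R K :=
  fun p => vabs (map_poly (emb V) p).[t].

(* The radius of D(x), the largest open disk containing t in the fiber over x
   (Omega-rational points are dense in open disks, so they test inclusion). *)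
Definition generic_radius x t : R :=
  sup [set s | 0 < s /\ forall z, vabs (z - t) < s -> point_below z = x].

Definition vlim (u : nat -> W) : W :=
  xget 0 [set l | forall e : R, 0 < e ->
    exists N, forall n, (N <= n)%N -> vabs (u n - l) < e].

Definition leval t (f : laurent K) : W :=
  vlim (fun n => \sum_(i < n.*2)
                   emb V (f (i%:Z - n%:Z)) * t ^ (i%:Z - n%:Z)).

(* The image of f in the functions on the generic disk, as the sequence of
   coefficients of its expansion in powers of T - t. *)
Definition taylor t (f : laurent K) (n : nat) : W :=
  leval t (iter n (@lderiv K) f) / n`!%:R.

(* The series with coefficients a converges on the open disk of radius s. *)
Definition converges_on (s : R) (a : nat -> W) : Prop :=
  forall u : R, 0 < u < s -> (vabs (a n) * u ^+ n @[n --> \oo] --> (0 : R))%classic.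

End GenericDisk.

Section DifferentialModules.
Variables (R : realType) (K : fieldType) (V : large_extension R K).
Local Notation W := (Omega V).
Local Notation L := (laurent K).

Definition is_connection (M : vectType L) (nabla : M -> M) : Prop :=
  (forall u v, nabla (u + v) = nabla u + nabla v) /\
  (forall f u, nabla (f *: u) = lderiv f *: u + f *: nabla u).

Definition submodule (M : vectType L) (nabla : M -> M) (U : {vspace M}) : Prop :=
  forall u, u \in U -> nabla u \in U.

(* The connection of the sub-module U; it only makes sense for stable U. *)
Definition restrict_conn (M : vectType L) (nabla : M -> M) (U : {vspace M})
    (u : subvs_of U) : subvs_of U := vsproj U (nabla (vsval u)).
Arguments restrict_conn {M} nabla U u.

Definition connection_mx (M : vectType L) (nabla : M -> M)
    (i j : 'I_(\dim {:M})) : L :=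
  coord (vbasis {:M}) i (nabla (vbasis {:M})`_j).

(* The section sum_i y_i (x) e_i of M over the open disk of center t and radius
   s is horizontal; (e_i) is the basis vbasis {:M}, and y_i is given by its
   coefficients in powers of T - t. *)
Definition horizontal (M : vectType L) (nabla : M -> M) (t : W) (s : R)
    (y : 'I_(\dim {:M}) -> nat -> W) : Prop :=
  (forall i, converges_on s (y i)) /\
  (forall i n, y i n.+1 *+ n.+1 +
     \sum_j \sum_(k < n.+1) taylor t (connection_mx nabla i j) k * y j (n - k)%N
     = 0).

Definition has_sections (M : vectType L) (nabla : M -> M) (t : W) (s : R)
    (m : nat) : Prop :=
  exists Y : 'I_m -> 'I_(\dim {:M}) -> nat -> W,
    (forall l, horizontal nabla t s (Y l)) /\
    (forall c : 'I_m -> W,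
       (forall i n, \sum_l c l * Y l i n = 0) -> forall l, c l = 0).

(* tpt chooses a rational point tpt x of Omega above each point x. *)
Variable tpt : berkovich R K -> W.

(* R_{S,i}(x, M), for 1 <= i <= r.  Every Gamma_S is the whole punctured disk,
   so the reference disk is D(x) whatever the triangulation S, empty or not, of
   the punctured disk or of an annulus in it containing x. *)
Definition conv_radius (M : vectType L) (nabla : M -> M) (i : nat)
    (x : berkovich R K) : R :=
  sup [set s | 0 < s <= generic_radius x (tpt x) /\
               has_sections nabla (tpt x) s ((\dim {:M}).+1 - i)]
  / generic_radius x (tpt x).

(* Full basis of solutions on D(x, sigma). *)
Definition full_solutions (M : vectType L) (nabla : M -> M)
    (x : berkovich R K) (sigma : R) : Prop :=
  has_sections nabla (tpt x) (sigma * generic_radius x (tpt x)) (\dim {:M}).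

(* M is the direct sum of the sub-modules N a, for a in A, all but finitely
   many of which are 0. *)
Definition decomposition (M : vectType L) (nabla : M -> M) (A : set R)
    (N : R -> {vspace M}) : Prop :=
  (forall a, A a -> submodule nabla (N a)) /\
  exists s : seq R,
    [/\ uniq s, forall a, a \in s -> A a,
        forall a, A a -> a \notin s -> N a = 0%VS,
        directv (\sum_(a <- s) N a)%VS & (\sum_(a <- s) N a)%VS = fullv].

Definition robba_decomposition (M : vectType L) (nabla : M -> M)
    (x : berkovich R K) (N : R -> {vspace M}) : Prop :=
  decomposition nabla [set sigma | 0 < sigma <= 1] N /\
  forall sigma, 0 < sigma <= 1 ->
    full_solutions (restrict_conn nabla (N sigma)) x sigma /\
    forall (U : {vspace M}) sigma', sigma < sigma' <= 1 ->
      submodule nabla U -> (U <= N sigma)%VS ->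
      full_solutions (restrict_conn nabla U) x sigma' -> U = 0%VS.

(* A polynomial Q over K((T)) stands for the operator sum_k Q_k (d/dT)^k, with
   coefficients on the left.  Left multiplication by d/dT, then by any A: *)
Definition ddT_mul (Q : {poly L}) : {poly L} := map_poly (@lderiv K) Q + Q * 'X.

Definition op_mul (A Q : {poly L}) : {poly L} :=
  \sum_(k < size A) A`_k *: iter k ddT_mul Q.

(* P is monic of order r and M is isomorphic to K((T))<d/dT>/K((T))<d/dT>P:
   there is a surjective morphism K((T))<d/dT> -> M with kernel the left ideal
   generated by P. *)
Definition attached (M : vectType L) (nabla : M -> M) (P : {poly L}) : Prop :=
  [/\ P \is monic, size P = (\dim {:M}).+1 &
   exists phi : {linear {poly L} -> M},
     [/\ forall u, exists Q, phi Q = u,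
         forall Q, phi (ddT_mul Q) = nabla (phi Q) &
         forall Q, phi Q = 0 <-> exists A, Q = op_mul A P]].

Definition op_order (P : {poly L}) : nat := (size P).-1.

(* Zero coefficients have valuation +oo, hence an empty quadrant. *)
Definition newton_quadrants (P : {poly L}) : set (R^o * R^o)%type :=
  [set z | exists k : nat, [/\ (k <= op_order P)%N, P`_k != 0, z.1 <= k%:R &
      (lval P`_k)%:~R + (op_order P)%:R - k%:R <= z.2]].

Definition newton_polygon (P : {poly L}) : set (R^o * R^o)%type :=
  smallest (@convex_set R (R^o * R^o)%type) (newton_quadrants P).

(* The function h whose epigraph is the polygon. *)
Definition newton_height (P : {poly L}) (a : R) : R :=
  inf [set c | newton_polygon P (a, c)].

Definition newton_slope (P : {poly L}) (i : nat) : R :=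
  newton_height P i%:R - newton_height P (i%:R - 1).

(* mu_1, ..., mu_r are the slopes of the formal Newton polygon of M; it is
   independent of P. *)
Definition formal_slopes (M : vectType L) (nabla : M -> M) (mu : nat -> R) :
    Prop :=
  exists2 P : {poly L}, attached nabla P &
    forall i, (1 <= i <= \dim {:M})%N -> mu i = newton_slope P i.

(* Zero coefficients do not contribute to either maximum. *)
Definition irr_formal (P : {poly L}) : R :=
  let r := op_order P in
  let d k : R := k%:R - (lval P`_k)%:~R in
  \big[Num.max/d r]_(k < r.+1 | P`_k != 0) d k - d r.

Definition mu_max (P : {poly L}) : R :=
  let r := op_order P in
  \big[Num.max/0]_(k < r | P`_k != 0)
     ((lval P`_k)%:~R / (k%:R - r%:R) - 1).

Definition formal_decomposition (M : vectType L) (nabla : M -> M)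
    (N : R -> {vspace M}) : Prop :=
  decomposition nabla setT N /\
  forall mu, formal_slopes (restrict_conn nabla (N mu)) (fun=> mu).

(* M is solvable as a module over the Robba ring. *)
Definition solvable (M : vectType L) (nabla : M -> M) : Prop :=
  (conv_radius nabla 1 (gauss_point rho) @[rho --> (1 : R)^'-] --> (1 : R))%classic.

(* beta_1 <= ... <= beta_r are the Christol-Mebkhout slopes of M. *)
Definition cm_slopes (M : vectType L) (nabla : M -> M) (beta : nat -> R) : Prop :=
  let r := \dim {:M} in
  (forall i j, (1 <= i)%N -> (i <= j <= r)%N -> beta i <= beta j) /\
  exists2 eps : R, 0 < eps < 1 & forall rho i, 1 - eps < rho < 1 ->
    (1 <= i <= r)%N ->
    conv_radius nabla i (gauss_point rho) = rho `^ beta (r.+1 - i)%N.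

Definition cm_decomposition (M : vectType L) (nabla : M -> M)
    (N : R -> {vspace M}) : Prop :=
  decomposition nabla setT N /\
  forall beta, cm_slopes (restrict_conn nabla (N beta)) (fun=> beta).

Definition separated_radii (M : vectType L) (nabla : M -> M) : Prop :=
  forall i, (2 <= i <= \dim {:M})%N ->
    (forall x, punctured_disk x ->
       conv_radius nabla i.-1 x = conv_radius nabla i x) \/
    (forall x, punctured_disk x ->
       conv_radius nabla i.-1 x <> conv_radius nabla i x).

(* M is a direct sum, over O(D - {0}) = K((T)), of nonzero sub-modules N j such
   that, at every point x, the radii of N j are all equal to sigma j x, the
   sigma j x are distinct, and sigma j x occurs rank (N j) times among the radii
   of M. *)
Definition global_decomposition (M : vectType L) (nabla : M -> M) : Prop :=
  exists (n : nat) (N : 'I_n -> {vspace M}) (sigma : 'I_n -> berkovich R K -> R),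
    [/\ forall j, submodule nabla (N j) /\ N j <> 0%VS,
        directv (\sum_j N j)%VS,
        (\sum_j N j)%VS = fullv &
        forall x, punctured_disk x ->
          injective (sigma^~ x) /\
          forall j,
            (forall i, (1 <= i <= \dim (N j))%N ->
               conv_radius (restrict_conn nabla (N j)) i x = sigma j x) /\
            count (fun i => conv_radius nabla i x == sigma j x) (iota 1 (\dim {:M}))
            = \dim (N j)].

End DifferentialModules.

(* Main.v *)
(* At x_{0,rho} the operator d/dT has norm at most 1/rho on K((T)). Take a
   cyclic basis of M with operator P and weight it along the formal Newton
   polygon: its companion matrix becomes bounded by theta_i = rho^-(1 + mu_i)
   on the i-th vector, with invertible leading part on each edge of the
   polygon. A Riccati equation, solved by a contraction for the Gauss norm,
   then splits off one edge after the other, so that M acquires a basis in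
   which the connection is block diagonal and is theta_i times an isometry on
   each block of positive slope. On the generic disk, of radius rho, each
   block has a full set of horizontal sections of radius 1 / theta_i = rho^(1
   + mu_i), since K has residue characteristic 0, and no nonzero one of larger
   radius if its slope is positive; hence R_i = rho^(mu_{r-i+1}). The same
   contraction kills every morphism between modules of different slopes, so
   each of the three decompositions has to be the decomposition by blocks.
   Finally, K being trivially valued, a point of the punctured disk is
   determined by the value of |T|, and no virtual open disk is contained in
   the punctured disk. *)
Require Import Defs.
From HB Require Import structures.
From mathcomp Require Import all_boot all_order all_algebra.
From mathcomp Require Import zify ring lra.
From mathcomp Require Import boolp classical_sets functions reals topology.
From mathcomp Require Import normedtype sequences exp interval_inference convex.
Set Implicit Arguments.
Unset Strict Implicit.
Unset Printing Implicit Defensive.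
Import Order.TTheory GRing.Theory Num.Theory numFieldNormedType.Exports.
Local Open Scope classical_set_scope.
Local Open Scope ring_scope.

(** * The Gauss norm on K((T)) *)

(** The only source of contraction is a strict ratio of two slopes: inverting the block of the
    larger one, [t], gains a factor [t^-1], while the other block and d/dT cost at most [t'], since
    [rho^-1 <= t']. Hence the edges are split off from the steepest one down. The block of slope 0,
    where d/dT may be as large as the matrix, is left uninverted: its sections fill the whole
    generic disk, beyond which no radius is measured. Slopes are rational in general, so the weights
    are real numbers and not norms of elements of K((T)); they occur in estimates only, which avoids
    a ramified extension.

    Nothing obtained at one rho is specific to it. Radii are defined without any operator, so their
    values at a single rho already determine the formal slopes, which gives independence of the
    cyclic basis. The blocks are built once, at rho = 1/2; they are sub-modules with one formal
    slope each, and this gives their radii at every rho. Uniqueness of each decomposition then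
    reduces to inclusions into the blocks and a count of dimensions. *)

Section LaurentDerivation.
Variable K : fieldType.
Implicit Types f g : laurent K.

Lemma laddE f g k : (f + g) k = f k + g k. Proof. by []. Qed.
Lemma loppE f k : (- f) k = - f k. Proof. by []. Qed.
Lemma lzeroE k : (0 : laurent K) k = 0. Proof. by []. Qed.
Lemma loneE k : (1 : laurent K) k = (k == 0)%:R. Proof. by []. Qed.
Lemma lderivE f k : lderiv f k = f (k + 1) *~ (k + 1). Proof. by []. Qed.

Lemma lmulE f g (a b : int) (n : nat) :
  (forall k, k < a -> f k = 0) -> (forall k, k < b -> g k = 0) ->
  (f * g) (a + b + n%:Z) =
    \sum_(i < n.+1) f (a + i%:Z) * g (b + (n - i)%N%:Z).
Proof. exact: lmul_coefE. Qed.

Lemma lmul_lt f g (a b : int) k :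
  (forall k, k < a -> f k = 0) -> (forall k, k < b -> g k = 0) ->
  k < a + b -> (f * g) k = 0.
Proof. exact: lmul_coef0. Qed.

Lemma lderivD f g : lderiv (f + g) = lderiv f + lderiv g.
Proof. by apply: laurentP => k; rewrite laddE !lderivE laddE mulrzDl. Qed.

Lemma lderiv0 : lderiv (0 : laurent K) = 0.
Proof. by apply: laurentP => k; rewrite lderivE mul0rz. Qed.

Lemma lderivN f : lderiv (- f) = - lderiv f.
Proof. by apply/eqP; rewrite -addr_eq0 -lderivD addNr lderiv0. Qed.

(** The derivation multiplies a coefficient by its degree, and the degree of a term of the Cauchy
    product is the sum of the degrees of its factors. The index is written in two ways, one for each
    shifted lower bound. *)
Lemma lderivM f g : lderiv (f * g) = lderiv f * g + f * lderiv g.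
Proof.
have [a fa] := lcoef_bounded f; have [b gb] := lcoef_bounded g.
have f'a k : k < a - 1 -> lderiv f k = 0 by move=> ka; rewrite lderivE fa ?mul0rz //; lia.
have g'b k : k < b - 1 -> lderiv g k = 0 by move=> ka; rewrite lderivE gb ?mul0rz //; lia.
apply: laurentP => k; rewrite laddE lderivE.
have [kab|/int_split[n kE]] := ltP (k + 1) (a + b).
  rewrite (lmul_lt fa gb) // (lmul_lt f'a gb) ?(lmul_lt fa g'b) ?addr0 ?mul0rz //; lia.
rewrite kE (lmulE _ fa gb).
have -> : k = (a - 1) + b + n%:Z by lia.
rewrite (lmulE _ f'a gb).
have -> : (a - 1) + b + n%:Z = a + (b - 1) + n%:Z by lia.
rewrite (lmulE _ fa g'b) -big_split /= mulrz_suml; apply: eq_bigr => i _ /=.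
have := ltn_ord i => ?.
have -> : a - 1 + i%:Z + 1 = a + i%:Z by lia.
have -> : b - 1 + (n - i)%N%:Z + 1 = b + (n - i)%N%:Z by lia.
rewrite mulrzAl mulrzAr -mulrzDr; congr (_ *~ _); lia.
Qed.

Lemma lderiv1 : lderiv (1 : laurent K) = 0.
Proof.
apply: laurentP => k; rewrite lderivE loneE lzeroE.
by case: eqP => [->|_]; rewrite ?mulr0z ?mul0rz.
Qed.

Lemma lderiv_sum (I : Type) (s : seq I) (P : pred I) (F : I -> laurent K) :
  lderiv (\sum_(i <- s | P i) F i) = \sum_(i <- s | P i) lderiv (F i).
Proof. by apply: (big_morph _ lderivD lderiv0). Qed.

Lemma lval_spec f : f != 0 -> f (lval f) != 0 /\ forall k, k < lval f -> f k = 0.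
Proof.
move=> /eqP /lvaluation_ex [a af]; rewrite /lval.
by case: xgetP => [x _ //|/(_ a)]; case.
Qed.

Lemma lval_eq f a : f a != 0 -> (forall k, k < a -> f k = 0) -> lval f = a.
Proof.
move=> fa fl; have f0 : f != 0 by apply: contraNneq fa => ->.
have [h1 h2] := lval_spec f0.
case: (ltgtP (lval f) a) => [/fl h|/h2 h|//]; first by rewrite h eqxx in h1.
by rewrite h eqxx in fa.
Qed.

End LaurentDerivation.

Section GaussNorm.
Variables (R : realType) (K : fieldType) (rho : R).
Hypothesis rho01 : 0 < rho < 1.
Implicit Types f g : laurent K.
Local Notation N := (gauss rho).

Let rho_gt0 : 0 < rho. Proof. by case/andP: rho01. Qed.
Let rho_lt1 : rho < 1. Proof. by case/andP: rho01. Qed.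

Lemma expz_le (m n : int) : (rho ^ m <= rho ^ n) = (n <= m).
Proof.
have h : 1 < rho^-1 by rewrite invf_gt1.
by have := ler_eXz2l h (- m) (- n); rewrite !exprz_inv !opprK lerN2.
Qed.

Lemma expz_lt (m n : int) : (rho ^ m < rho ^ n) = (n < m).
Proof. by rewrite !ltNge expz_le. Qed.

Lemma expz_gt0 (m : int) : 0 < rho ^ m. Proof. exact: exprz_gt0. Qed.

Lemma gauss0 : N (0 : laurent K) = 0. Proof. by rewrite /gauss eqxx. Qed.

Lemma gauss_neq0 f : f != 0 -> N f = rho ^ lval f.
Proof. by rewrite /gauss => /negPf ->. Qed.

Lemma gauss_gt0 f : f != 0 -> 0 < N f.
Proof. by move=> f0; rewrite gauss_neq0 // expz_gt0. Qed.

Lemma gauss_ge0 f : 0 <= N f.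
Proof. by have [->|/gauss_gt0/ltW//] := eqVneq f 0; rewrite gauss0. Qed.

Lemma gauss_le f (n : int) : N f <= rho ^ n <-> (forall k, k < n -> f k = 0).
Proof.
have [->|f0] := eqVneq f 0.
  by rewrite gauss0; split => // _; exact/ltW/expz_gt0.
have [f1 f2] := lval_spec f0; rewrite gauss_neq0 // expz_le; split => h.
  by move=> k kn; apply: f2; exact: lt_le_trans h.
by rewrite leNgt; apply: contraNN f1 => /h ->.
Qed.

Lemma gauss_lt f (n : int) : N f < rho ^ n -> f n = 0.
Proof.
have [->//|f0] := eqVneq f 0.
have [f1 f2] := lval_spec f0; rewrite gauss_neq0 // expz_lt; exact: f2.
Qed.

Lemma gaussE f a : f a != 0 -> (forall k, k < a -> f k = 0) -> N f = rho ^ a.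
Proof.
move=> fa fl; rewrite gauss_neq0 ?(lval_eq fa fl) //.
by apply: contraNneq fa => ->.
Qed.

Lemma gauss1 : N (1 : laurent K) = 1.
Proof.
rewrite (@gaussE _ 0) ?expr0z // ?loneE ?eqxx ?oner_eq0 // => k k0.
by rewrite loneE; case: eqP => //; lia.
Qed.

Lemma gaussM f g : N (f * g) = N f * N g.
Proof.
have [->|f0] := eqVneq f 0; first by rewrite mul0r gauss0 mul0r.
have [->|g0] := eqVneq g 0; first by rewrite mulr0 gauss0 mulr0.
have [f1 f2] := lval_spec f0; have [g1 g2] := lval_spec g0.
rewrite (gauss_neq0 f0) (gauss_neq0 g0) -expfzDr ?gt_eqF //.
apply: gaussE => [|k kab]; last exact: lmul_lt kab.
have := lmulE 0 f2 g2; rewrite addr0 => ->.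
by rewrite big_ord1 /= !addr0 mulf_neq0.
Qed.

Lemma gaussN f : N (- f) = N f.
Proof.
have [->|f0] := eqVneq f 0; first by rewrite oppr0.
have [f1 f2] := lval_spec f0; rewrite (gauss_neq0 f0); apply: gaussE.
  by rewrite loppE oppr_eq0.
by move=> k kl; rewrite loppE f2 // oppr0.
Qed.

Lemma gaussD f g : N (f + g) <= Num.max (N f) (N g).
Proof.
have [->|f0] := eqVneq f 0; first by rewrite add0r le_max lexx orbT.
have [->|g0] := eqVneq g 0; first by rewrite addr0 le_max lexx.
wlog fg : f g f0 g0 / N g <= N f => [hw|].
  case/orP: (le_total (N g) (N f)) => [/(hw _ _ f0 g0)//|/(hw _ _ g0 f0)].
  by rewrite addrC maxC.
rewrite le_max; apply/orP; left; rewrite (gauss_neq0 f0); apply/gauss_le => k kf.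
rewrite laddE; move: fg; rewrite (gauss_neq0 f0) (gauss_neq0 g0) expz_le => fg.
rewrite (lval_spec f0).2 // (lval_spec g0).2 ?addr0 //; exact: lt_le_trans fg.
Qed.

Lemma gaussD_le f g k : N f <= k -> N g <= k -> N (f + g) <= k.
Proof. by move=> h1 h2; apply: (le_trans (gaussD f g)); rewrite ge_max h1. Qed.

Lemma gauss_sum (I : Type) (s : seq I) (P : pred I) (F : I -> laurent K) k :
  0 <= k -> (forall i, P i -> N (F i) <= k) -> N (\sum_(i <- s | P i) F i) <= k.
Proof.
move=> k0 Fk; elim/big_ind: _ => //; first by rewrite gauss0.
by move=> x y; exact: gaussD_le.
Qed.

Lemma gaussV f : N f^-1 = (N f)^-1.
Proof.
have [->|f0] := eqVneq f 0; first by rewrite invr0 gauss0 invr0.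
by apply: (mulfI (x := N f)); rewrite ?gt_eqF ?gauss_gt0 // -gaussM !divff ?gauss1 // gt_eqF ?gauss_gt0.
Qed.

Lemma gauss_lderiv f : N (lderiv f) <= rho^-1 * N f.
Proof.
have [->|f0] := eqVneq f 0; first by rewrite lderiv0 gauss0 mulr0.
have [f1 f2] := lval_spec f0; rewrite (gauss_neq0 f0).
rewrite -exprN1 -expfzDr ?gt_eqF //; apply/gauss_le => k kl.
by rewrite lderivE f2 ?mul0rz //; lia.
Qed.

Lemma expz_lt_ex (e : R) : 0 < e -> exists n : nat, rho ^ n < e.
Proof.
move=> e0; have /cvgrPdist_lt /(_ e e0) [n _ /(_ n (leqnn _))] :
    (rho ^+ n @[n --> \oo] --> (0 : R))%classic.
  by apply: cvg_expr; rewrite ger0_norm // ltW.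
move=> /=; rewrite sub0r normrN ger0_norm ?exprn_ge0 // ?ltW // => h.
by exists n; exact: h.
Qed.

Lemma expz_gt_ex (e : R) : exists n : int, e < rho ^ n.
Proof.
have [e0|e0] := leP e 0; first by exists 0; rewrite expr0z (le_lt_trans e0).
have e1 : 0 < e^-1 by rewrite invr_gt0.
have [n nE] := expz_lt_ex e1.
exists (- n%:Z); rewrite -invr_expz; rewrite -ltf_pV2 ?invrK ?posrE ?invr_gt0 ?expz_gt0//.
Qed.

(** Coefficients live in a discrete field: once [d n < rho ^ k], the k-th coefficient of [x n] no
    longer changes, and the limit collects these stable values. *)
Lemma gauss_complete (x : nat -> laurent K) (d : nat -> R) :
  (forall n m, (n <= m)%N -> d m <= d n) ->
  (forall e, 0 < e -> exists n, d n < e) ->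
  (forall n, N (x n.+1 - x n) <= d n) ->
  exists l, forall n, N (l - x n) <= d n.
Proof.
move=> dm d0 xd.
have d_ge0 n : 0 <= d n := le_trans (gauss_ge0 _) (xd n).
have xd' n m : (n <= m)%N -> N (x m - x n) <= d n.
  elim: m => [|m IH]; first by rewrite leqn0 => /eqP->; rewrite subrr gauss0.
  rewrite leq_eqVlt => /orP[/eqP->|nm]; first by rewrite subrr gauss0.
  rewrite -(subrK (x m) (x m.+1)) -addrA; apply: gaussD_le; last exact: IH.
  by apply: (le_trans (xd m)); exact: dm.
have /choice [N0 N0P] (k : int) : exists n, d n < rho ^ k by apply: d0; exact: expz_gt0.
have stab k n : d n < rho ^ k -> x n k = x (N0 k) k.
  move=> nk; apply/eqP; rewrite -subr_eq0.
  have [h|/ltnW h] := leqP n (N0 k).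
    have := le_lt_trans (xd' _ _ h) nk => /gauss_lt; rewrite laddE loppE => /eqP.
    by rewrite -oppr_eq0 opprB.
  by have := le_lt_trans (xd' _ _ h) (N0P k) => /gauss_lt; rewrite laddE loppE => ->.
have [a0 Ha0] := lcoef_bounded (x 0%N); have [a1 Ha1] := expz_gt_ex (d 0%N).
have lb : exists a : int, forall k, k < a -> (fun k => x (N0 k) k) k = 0.
  (* Below [a1] one has [d 0 < rho ^ k], so the coefficient is already the one of [x 0]; below [a0]
     that one vanishes. *)
  exists (Num.min a0 a1) => k; rewrite lt_min => /andP[k0 k1].
  rewrite -(stab k 0%N) ?Ha0 //; apply: (lt_trans Ha1); rewrite expz_lt //.
exists (Laurent lb) => n; rewrite leNgt; apply/negP => h.
have nz : Laurent lb - x n != 0.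
  by apply: contraTneq h => ->; rewrite gauss0 -leNgt.
have [h1 _] := lval_spec nz; rewrite (gauss_neq0 nz) in h.
move: h1; rewrite laddE loppE /= -(stab _ n) ?subrr ?eqxx //.
Qed.

End GaussNorm.

(** * Ultrametric estimates in Omega *)

Section ValuedExtension.
Variables (R : realType) (K : fieldType) (V : large_extension R K).
Local Notation W := (Omega V).
Implicit Types y z : W.

Lemma vabs0 : vabs (0 : W) = 0. Proof. exact/vabs_eq0. Qed.

Lemma vabs_gt0 z : z != 0 -> 0 < vabs z.
Proof.
by move=> /eqP z0; rewrite lt_neqAle vabs_ge0 andbT eq_sym; apply/eqP => /vabs_eq0.
Qed.

Lemma vabs1 : vabs (1 : W) = 1.
Proof.
have h : vabs (1 : W) != 0 by rewrite gt_eqF // vabs_gt0 // oner_eq0.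
by apply: (mulfI h); rewrite -vabsM !mulr1.
Qed.

Lemma vabsX z n : vabs (z ^+ n) = vabs z ^+ n.
Proof. by elim: n => [|n IH]; rewrite ?vabs1 // !exprS vabsM IH. Qed.

Lemma vabsN z : vabs (- z) = vabs z.
Proof.
have h : vabs (- 1 : W) = 1.
  apply/eqP; rewrite -(@pexpr_eq1 _ _ 2%N) ?vabs_ge0 //.
  by rewrite -vabsX sqrrN expr1n vabs1.
by rewrite -mulN1r vabsM h mul1r.
Qed.

Lemma vabsV z : vabs z^-1 = (vabs z)^-1.
Proof.
have [->|z0] := eqVneq z 0; first by rewrite invr0 vabs0 invr0.
have h : vabs z != 0 by rewrite gt_eqF // vabs_gt0.
by apply: (mulfI h); rewrite -vabsM !divff // vabs1.
Qed.

Lemma vabsXz z (n : int) : vabs (z ^ n) = vabs z ^ n.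
Proof. by case: n => n; [exact: vabsX | rewrite NegzE -!exprnN vabsV vabsX]. Qed.

Lemma vabsD_le y z e : vabs y <= e -> vabs z <= e -> vabs (y + z) <= e.
Proof. by move=> h1 h2; apply: (le_trans (vabsD _ _)); rewrite ge_max h1. Qed.

Lemma vabs_sum (I : Type) (s : seq I) (P : pred I) (F : I -> W) e :
  0 <= e -> (forall i, P i -> vabs (F i) <= e) -> vabs (\sum_(i <- s | P i) F i) <= e.
Proof.
move=> e0 Fe; elim/big_ind: _ => //; first by rewrite vabs0.
by move=> x y; exact: vabsD_le.
Qed.

Lemma vabsD_eq y z : vabs y < vabs z -> vabs (y + z) = vabs z.
Proof.
move=> yz; apply/eqP; rewrite eq_le; apply/andP; split.
  by apply: vabsD_le => //; exact: ltW.
rewrite leNgt; apply/negP => h.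
have := vabsD (- y) (y + z); rewrite addKr vabsN le_max.
by rewrite !leNgt yz h.
Qed.

Lemma vabs_emb_le (a : K) : vabs (emb V a) <= 1.
Proof.
by have [->|/(vabs_emb V)->//] := eqVneq a 0; rewrite rmorph0 vabs0 ler01.
Qed.

(** By the ultrametric inequality the closed balls of center [c n] and radius [s n] are nested, so
    spherical completeness supplies a common point. *)
Lemma vabs_complete (c : nat -> W) (s : nat -> R) :
  (forall n, s n.+1 <= s n) -> (forall n, vabs (c n.+1 - c n) <= s n) ->
  exists z, forall n, vabs (z - c n) <= s n.
Proof.
move=> sd cs; apply: (spherically_complete (l := V)).
  by move=> n; apply: le_trans (cs n); exact: vabs_ge0.
move=> n z h; rewrite -(subrK (c n.+1) z) -addrA; apply: vabsD_le => //.
exact: le_trans (sd n).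
Qed.

Lemma vlimE (u : nat -> W) l :
  (forall e : R, 0 < e -> exists N, forall n, (N <= n)%N -> vabs (u n - l) < e) ->
  vlim (V := V) u = l.
Proof.
move=> ul; rewrite /vlim; case: xgetP => [y _ /= uy|/(_ l)//].
apply/eqP; rewrite -subr_eq0; apply/negPn/negP => /vabs_gt0 h.
have [n1 h1] := uy _ h; have [n2 h2] := ul _ h.
have := h1 (maxn n1 n2) (leq_maxl _ _); have := h2 (maxn n1 n2) (leq_maxr _ _).
move: (u _) => w h3 h4; have : vabs (y - l) < vabs (y - l); last by rewrite ltxx.
rewrite -{1}(subrK w y) -addrA (le_lt_trans (vabsD _ _)) // gt_max h3 andbT.
by rewrite -opprB vabsN.
Qed.

Lemma vabs_small z (C rho : R) : 0 < rho < 1 ->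
  (forall n : nat, vabs z <= C * rho ^ n) -> z = 0.
Proof.
move=> rho01 zC; apply/eqP/negPn/negP => /vabs_gt0 z0.
have C0 : 0 < C by have := zC 0%N; rewrite expr0z mulr1; exact: lt_le_trans.
have [n] := expz_lt_ex rho01 (divr_gt0 z0 C0).
by rewrite ltr_pdivlMr // mulrC ltNge zC.
Qed.

End ValuedExtension.

(** * Evaluation of K((T)) at a generic point *)

Section GenericPoint.
Variables (R : realType) (K : fieldType) (V : large_extension R K).
Local Notation W := (Omega V).
Variables (rho : R) (t : W).
Hypotheses (rho01 : 0 < rho < 1) (t_rho : vabs t = rho).
Implicit Types f g : laurent K.

Let rho_gt0 : 0 < rho. Proof. by case/andP: rho01. Qed.
Let t_neq0 : t != 0.
Proof. by apply/eqP => /vabs_eq0; rewrite t_rho => /eqP; rewrite gt_eqF. Qed.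

Let evpoly (p : {poly K}) : W := (map_poly (emb V) p).[t].

Let evpoly_poly n (E : nat -> K) :
  evpoly (\poly_(i < n) E i) = \sum_(i < n) emb V (E i) * t ^+ i.
Proof.
rewrite /evpoly (horner_coef_wide (n := n)); last first.
  by rewrite size_map_poly size_poly.
by apply: eq_bigr => i _; rewrite coef_map coef_poly ltn_ord.
Qed.

Let evpolyM p q : evpoly (p * q) = evpoly p * evpoly q.
Proof. by rewrite /evpoly rmorphM hornerM. Qed.

Let evpoly_le1 p : vabs (evpoly p) <= 1.
Proof.
rewrite /evpoly horner_coef; apply: vabs_sum => // i _.
rewrite coef_map vabsM vabsX t_rho.
rewrite mulr_ile1 ?vabs_ge0 ?vabs_emb_le ?exprn_ge0 ?(ltW rho_gt0) //.
by rewrite exprn_ile1 ?(ltW rho_gt0) //; case/andP: rho01 => _ /ltW.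
Qed.

Let evpoly_take p n : vabs (evpoly p - evpoly (take_poly n p)) <= rho ^ n.
Proof.
rewrite -{1}(poly_take_drop n p) /evpoly rmorphD hornerD addrC addKr.
rewrite rmorphM hornerM /= map_polyXn hornerXn vabsM vabsX t_rho.
by rewrite ler_piMl ?exprn_ge0 ?(ltW rho_gt0) // evpoly_le1.
Qed.

(** Factoring out [t ^ a] leaves the value of a polynomial, and evaluation of polynomials is already
    a ring morphism: this is where the multiplicativity of [leval] comes from. *)
Definition lpsum f (a : int) n : W := t ^ a * (map_poly (emb V) (ltrunc f a n)).[t].

Lemma lpsumE f a n :
  lpsum f a n = \sum_(i < n) emb V (f (a + i%:Z)) * t ^ (a + i%:Z).
Proof.
rewrite /lpsum /ltrunc -/(evpoly _) evpoly_poly big_distrr /=; apply: eq_bigr => i _.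
by rewrite expfzDr // mulrCA.
Qed.

Let vabs_tz (a : int) : vabs (t ^ a) = rho ^ a.
Proof. by rewrite vabsXz t_rho. Qed.

Lemma leval_approx f (a : int) : (forall k, k < a -> f k = 0) ->
  forall n, vabs (leval t f - lpsum f a n) <= rho ^ (a + n%:Z).
Proof.
move=> fa.
have [z zP] : exists z, forall n, vabs (z - lpsum f a n) <= rho ^ (a + n%:Z).
  apply: vabs_complete => n; first by rewrite (expz_le rho01); lia.
  rewrite !lpsumE big_ord_recr /= addrAC subrr add0r vabsM vabs_tz.
  by rewrite ler_piMl ?vabs_emb_le // ltW // expz_gt0.
suff -> : leval t f = z by [].
apply: vlimE => e e0; have [n0 n0e] := expz_lt_ex rho01 e0.
exists (maxn n0 `|a|%N) => m; rewrite geq_max => /andP[mn0 ma].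
(* The window from -m to m in [leval] is cut at [a]: its first [d] = a + m terms lie below the
   support of f, and the other [n] = m - a terms form [lpsum f a n]. *)
have [d dE] : exists d : nat, a + m%:Z = d%:Z by exists (absz (a + m%:Z)); lia.
have [n nE] : exists n : nat, m%:Z - a = n%:Z by exists (absz (m%:Z - a)); lia.
suff -> : \sum_(i < m.*2) emb V (f (i%:Z - m%:Z)) * t ^ (i%:Z - m%:Z) = lpsum f a n.
  rewrite -opprB vabsN (le_lt_trans (zP n)) // (le_lt_trans _ n0e) //.
  by rewrite (expz_le rho01); lia.
have -> : m.*2 = (d + n)%N by lia.
rewrite big_split_ord /= big1 ?add0r => [|i _]; last first.
  by have := ltn_ord i => ?; rewrite fa ?rmorph0 ?mul0r //; lia.
rewrite lpsumE; apply: eq_bigr => i _.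
by have -> : (d + i)%N%:Z - m%:Z = a + i%:Z by lia.
Qed.

Lemma leval_unique f (a : int) z (C : R) : (forall k, k < a -> f k = 0) ->
  (forall n : nat, vabs (z - lpsum f a n) <= C * rho ^ n) -> leval t f = z.
Proof.
move=> fa zf; apply/eqP; rewrite -subr_eq0; apply/eqP.
apply: (vabs_small (C := Num.max C (rho ^ a)) rho01) => n.
rewrite -(subrK (lpsum f a n) (leval t f)) -addrA.
have rn : 0 <= rho ^ n by rewrite ltW // expz_gt0.
apply: vabsD_le.
  apply: (le_trans (leval_approx fa n)); rewrite expfzDr ?gt_eqF //.
  by rewrite ler_wpM2r // le_max lexx orbT.
by rewrite -opprB vabsN (le_trans (zf n)) // ler_wpM2r // le_max lexx.
Qed.

Lemma leval_bounds f g : exists a : int,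
  (forall k, k < a -> f k = 0) /\ (forall k, k < a -> g k = 0).
Proof.
have [a fa] := lcoef_bounded f; have [b gb] := lcoef_bounded g.
by exists (Num.min a b); split=> k; rewrite lt_min => /andP[h1 h2]; [apply: fa|apply: gb].
Qed.

Lemma levalD f g : leval t (f + g) = leval t f + leval t g.
Proof.
have [a [fa ga]] := leval_bounds f g.
apply: (leval_unique (a := a) (C := rho ^ a)) => [k ka|n]; first by rewrite laddE fa ?ga ?addr0.
have -> : lpsum (f + g) a n = lpsum f a n + lpsum g a n.
  rewrite !lpsumE -big_split /=; apply: eq_bigr => i _.
  by rewrite -mulrDl -rmorphD.
rewrite opprD addrACA -expfzDr ?gt_eqF //; apply: vabsD_le; exact: leval_approx.
Qed.

Lemma leval1 : leval t 1 = 1.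
Proof.
apply: (leval_unique (a := 0) (C := 1)) => [k ka|n]; first by rewrite loneE; case: eqP => //; lia.
rewrite mul1r; case: n => [|n].
  by rewrite lpsumE big_ord0 subr0 vabs1 expr0z.
rewrite lpsumE big_ord_recl big1 ?addr0 => [|i _].
  rewrite expr0z loneE eqxx rmorph1 mulr1 subrr vabs0.
  by rewrite ltW // expz_gt0.
by rewrite loneE /= add0r rmorph0 mul0r.
Qed.

Lemma levalM f g : leval t (f * g) = leval t f * leval t g.
Proof.
have [a [fa ga]] := leval_bounds f g.
apply: (leval_unique (a := a + a) (C := rho ^ (a + a))) => [k ka|n]; first exact: lmul_lt ka.
rewrite -expfzDr ?gt_eqF //.
set x := leval t f; set y := leval t g.
have xn := leval_approx fa n; have yn := leval_approx ga n.
have x0 : vabs x <= rho ^ a.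
  by have := leval_approx fa 0; rewrite lpsumE big_ord0 subr0 [_ + _]addr0.
have pn : vabs (lpsum g a n) <= rho ^ a.
  by rewrite vabsM vabs_tz ler_piMr ?evpoly_le1 // ltW // expz_gt0.
have E : lpsum (f * g) (a + a) n =
    t ^ (a + a) * evpoly (take_poly n (ltrunc f a n * ltrunc g a n)).
  rewrite /lpsum -/(evpoly _); congr (_ * evpoly _).
  apply/polyP => i; rewrite coef_take_poly coef_poly; case: ltnP => // i_n.
  exact: lmul_trunc.
(* The two factors are replaced one after the other by their partial sums; the last term is the part
   of degree at least n of the product of the truncated polynomials. *)
have -> : x * y - lpsum (f * g) (a + a) n =
   x * (y - lpsum g a n) + (x - lpsum f a n) * lpsum g a n +
   t ^ (a + a) * (evpoly (ltrunc f a n * ltrunc g a n) -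
       evpoly (take_poly n (ltrunc f a n * ltrunc g a n))).
  rewrite E evpolyM /lpsum -!/(evpoly _) expfzDr //; ring.
have rE k : rho ^ (a + k) = rho ^ a * rho ^ k by rewrite expfzDr ?gt_eqF.
rewrite -[a + a + n%:Z]addrA !rE in xn yn *; rewrite -[in leLHS]addrA.
apply: vabsD_le; last apply: vabsD_le.
- by rewrite vabsM ler_pM ?vabs_ge0.
- by rewrite vabsM mulrCA mulrC ler_pM ?vabs_ge0 // mulrC.
- by rewrite vabsM vabs_tz rE -mulrA !ler_wpM2l ?evpoly_take // ltW // expz_gt0.
Qed.

Lemma levalN f : leval t (- f) = - leval t f.
Proof.
have l0 : leval t 0 = 0.
  by apply: (addIr (leval t 0)); rewrite -levalD !add0r.
by apply/eqP; rewrite -addr_eq0 -levalD addNr l0.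
Qed.

Definition levalr : {rmorphism laurent K -> W} :=
  HB.pack (leval (V := V) t)
    (GRing.isZmodMorphism.Build _ _ (leval (V := V) t)
      (fun f g => etrans (levalD f (- g)) (congr1 _ (levalN g))))
    (GRing.isMonoidMorphism.Build _ _ (leval (V := V) t) (leval1, levalM)).

Lemma levalrE f : levalr f = leval t f. Proof. by []. Qed.

(** The lowest term has norm [rho ^ a] and, by [leval_approx], the rest is at most [rho ^ (a + 1)].
    Evaluation at t is thus an isometric embedding of H(x_{0,rho}) into Omega. *)
Lemma vabs_leval f : vabs (leval t f) = gauss rho f.
Proof.
have [->|f0] := eqVneq f 0; first by rewrite -levalrE rmorph0 vabs0 gauss0.
have [f1 f2] := lval_spec f0; rewrite gauss_neq0 //; set a := lval f in f1 f2 *.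
have := leval_approx f2 1; rewrite lpsumE big_ord1 addr0 => h.
have fE : vabs (emb V (f a) * t ^ a) = rho ^ a by rewrite vabsM vabs_tz vabs_emb // mul1r.
rewrite -fE -[leval t f](subrK (emb V (f a) * t ^ a)) vabsD_eq // fE.
by apply: (le_lt_trans h); rewrite (expz_lt rho01); lia.
Qed.

End GenericPoint.

Section PowerSeries.
Variable F : fieldType.

Fact pseries_bounded (a : nat -> F) : exists b : int, forall k : int, k < b ->
  (if k is Posz n then a n else 0) = 0.
Proof. by exists 0 => -[]. Qed.
(** Expansions in powers of T - t are placed in the field [laurent W], so that the Cauchy product,
    the derivation and matrix inversion available there apply to them. *)
Definition pseries (a : nat -> F) : laurent F := Laurent (pseries_bounded a).

End PowerSeries.

(** * Taylor expansion at the generic point *)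

Section GenericTaylor.
Variables (R : realType) (K : fieldType) (V : large_extension R K).
Local Notation W := (Omega V).
Variables (rho : R) (t : W).
Hypotheses (charK : [pchar K] =i pred0) (rho01 : 0 < rho < 1) (t_rho : vabs t = rho).
Implicit Types f g : laurent K.

Lemma natrK_neq0 n : (0 < n)%N -> n%:R != 0 :> K.
Proof. by move/pcharf0P: charK => ->; case: n. Qed.

Lemma embn n : emb V n%:R = n%:R. Proof. exact: rmorph_nat. Qed.

Lemma vabsn n : (0 < n)%N -> vabs (n%:R : W) = 1.
Proof. by move=> n0; rewrite -embn vabs_emb // natrK_neq0. Qed.

Lemma natrW_neq0 n : (0 < n)%N -> n%:R != 0 :> W.
Proof. by move=> n0; rewrite -embn fmorph_eq0 natrK_neq0. Qed.

Lemma lnatE n k : (n%:R : laurent K) k = if k == 0 then n%:R else 0.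
Proof.
elim: n => [|n IH]; first by rewrite lzeroE; case: eqP.
by rewrite -addn1 natrD laddE IH loneE; case: eqP => _; rewrite ?addr0 // natrD.
Qed.

Lemma natrL_neq0 n : (0 < n)%N -> n%:R != 0 :> laurent K.
Proof.
move=> n0; apply/eqP => /(congr1 (fun f : laurent K => f 0)).
by rewrite lnatE eqxx => /eqP; apply/negP; exact: natrK_neq0.
Qed.

Definition ddiv n f : laurent K := iter n (@lderiv K) f / n`!%:R.

Lemma lderivn n : lderiv (n%:R : laurent K) = 0.
Proof.
by elim: n => [|n IH]; rewrite ?lderiv0 // -addn1 natrD lderivD IH lderiv1 addr0.
Qed.

Lemma lderivMn f n : lderiv (f * n%:R) = lderiv f * n%:R.
Proof. by rewrite lderivM lderivn mulr0 addr0. Qed.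

Lemma lderiv_ddiv n f : lderiv (ddiv n f) = ddiv n.+1 f * n.+1%:R.
Proof.
have n0 : n`!%:R != 0 :> laurent K by rewrite natrL_neq0 // fact_gt0.
apply: (mulIf n0); rewrite -lderivMn /ddiv -!mulrA -natrM -factS !mulVf ?mulr1 //.
by rewrite natrL_neq0 // fact_gt0.
Qed.

(** Divided derivatives obey a Leibniz rule without binomial coefficients, which is the
    multiplicativity of the Taylor expansion. In the induction both sides are multiplied by n + 1,
    written as k + (n + 1 - k) in the k-th term. *)
Lemma ddivM n f g : ddiv n (f * g) = \sum_(k < n.+1) ddiv k f * ddiv (n - k) g.
Proof.
elim: n => [|n IH]; first by rewrite big_ord1 /ddiv /= fact0 !divr1.
have n1 : n.+1%:R != 0 :> laurent K by rewrite natrL_neq0.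
apply: (mulIf n1); rewrite -lderiv_ddiv IH lderiv_sum.
have E k : (k <= n.+1)%N -> n.+1%:R = k%:R + (n.+1 - k)%N%:R :> laurent K.
  by move=> h; rewrite -natrD subnKC.
transitivity (\sum_(k < n.+2) (ddiv k f * k%:R) * ddiv (n.+1 - k) g +
              \sum_(k < n.+2) ddiv k f * (ddiv (n.+1 - k) g * (n.+1 - k)%N%:R)).
  rewrite [X in X + _]big_ord_recl [X in _ = _ + X]big_ord_recr /= subnn !mulr0 mul0r add0r addr0.
  rewrite -big_split; apply: eq_bigr => k _ /=.
  rewrite lderivM !lderiv_ddiv /bump /= add1n subSS [(n.+1 - k)%N]subSn //.
  by rewrite -ltnS.
rewrite -big_split mulr_suml; apply: eq_bigr => k _ /=.
by rewrite (E k) ?leq_ord // mulrDr mulrA; congr (_ + _); rewrite mulrAC.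
Qed.

(** Residue characteristic 0 enters here: n! has norm 1, so dividing by it costs nothing and Taylor
    series converge on the whole generic disk. *)
Lemma gauss_ddiv n f : gauss rho (ddiv n f) <= (rho^-1) ^+ n * gauss rho f.
Proof.
rewrite /ddiv gaussM // gaussV //.
have -> : gauss rho (n`!%:R : laurent K) = 1.
  by rewrite -(vabs_leval rho01 t_rho) -(levalrE rho01 t_rho) rmorph_nat vabsn // fact_gt0.
rewrite invr1 mulr1; elim: n => [|n IH] /=; first by rewrite mul1r.
apply: (le_trans (gauss_lderiv rho01 _)); rewrite exprS -mulrA ler_wpM2l //.
by rewrite invr_ge0 ltW //; case/andP: rho01.
Qed.

Lemma taylorE f n : taylor t f n = leval t (ddiv n f).
Proof. by rewrite /taylor -!(levalrE rho01 t_rho) rmorphM fmorphV rmorph_nat. Qed.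

Lemma vabs_taylor f n : vabs (taylor t f n) <= (rho^-1) ^+ n * gauss rho f.
Proof. by rewrite taylorE (vabs_leval rho01) // gauss_ddiv. Qed.

Definition taylor_series f : laurent W := pseries (taylor t f).

Lemma taylor_seriesD f g : taylor_series (f + g) = taylor_series f + taylor_series g.
Proof.
apply: laurentP => -[n|n]; rewrite laddE /= ?addr0 // !taylorE -!(levalrE rho01 t_rho) -rmorphD.
congr (levalr _ _ _); rewrite /ddiv -mulrDl; congr (_ / _).
by elim: n => //= n ->; rewrite lderivD.
Qed.

Lemma pseries_lt (F : fieldType) (a : nat -> F) (k : int) : k < 0 -> pseries a k = 0.
Proof. by case: k. Qed.

Lemma taylor_series1 : taylor_series 1 = 1.
Proof.
apply: laurentP => -[[|n]|n]; rewrite loneE //= taylorE -!(levalrE rho01 t_rho) /ddiv.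
  by rewrite fact0 invr1 mulr1 rmorph1.
suff -> : iter n.+1 (@lderiv K) 1 = 0 by rewrite mul0r rmorph0.
by elim: n => [|n]; rewrite ?iterS ?lderiv1 // => ->; rewrite lderiv0.
Qed.

Lemma taylor_seriesM f g : taylor_series (f * g) = taylor_series f * taylor_series g.
Proof.
apply: laurentP => -[n|n]; last by rewrite (lmul_lt (a := 0) (b := 0)) // => k; exact: pseries_lt.
have nE : Posz n = 0 + 0 + n%:Z by rewrite !add0r.
rewrite [in RHS]nE (lmulE (a := 0) (b := 0)); try by move=> k; exact: pseries_lt.
rewrite /= taylorE ddivM -(levalrE rho01 t_rho) rmorph_sum; apply: eq_bigr => i _.
by rewrite rmorphM /= !taylorE.
Qed.

Lemma taylor_seriesN f : taylor_series (- f) = - taylor_series f.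
Proof.
have l0 : taylor_series 0 = 0.
  by apply: (addIr (taylor_series 0)); rewrite -taylor_seriesD !add0r.
by apply/eqP; rewrite -addr_eq0 -taylor_seriesD addNr l0.
Qed.

Fact taylorr_subproof :
  {f : {rmorphism laurent K -> laurent W} | (f : _ -> _) = taylor_series}.
Proof.
have Z : zmod_morphism taylor_series.
  by move=> f g; rewrite taylor_seriesD taylor_seriesN.
have M : monoid_morphism taylor_series by split; [exact: taylor_series1 | exact: taylor_seriesM].
pose F : {rmorphism laurent K -> laurent W} := HB.pack taylor_series
  (GRing.isZmodMorphism.Build _ _ taylor_series Z)
  (GRing.isMonoidMorphism.Build _ _ taylor_series M).
by exists F.
Qed.

(* Sealed, so that the morphism structure survives simplification. *)
Definition taylorr := sval taylorr_subproof.

Lemma taylorrE f n : taylorr f (Posz n) = taylor t f n.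
Proof. by rewrite /taylorr (svalP taylorr_subproof). Qed.

Lemma taylorr_lt f k : k < 0 -> taylorr f k = 0.
Proof. by rewrite /taylorr (svalP taylorr_subproof); exact: pseries_lt. Qed.

Lemma taylorr_lderiv f : taylorr (lderiv f) = lderiv (taylorr f).
Proof.
apply: laurentP => -[n|n]; rewrite lderivE; last first.
  rewrite [LHS]taylorr_lt //; case: n => [|n]; first by rewrite mulr0z.
  by rewrite taylorr_lt ?mul0rz //; lia.
have -> : Posz n + 1 = n.+1%:Z by lia.
rewrite -pmulrn !taylorrE /taylor -iterSr.
have n1 : n.+1%:R != 0 :> W by rewrite natrW_neq0.
rewrite -[RHS]mulr_natr -[RHS]mulrA; congr (_ * _).
by rewrite factS natrM invfM mulrAC mulVf ?mul1r.
Qed.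

End GenericTaylor.

(** * Normal forms for the connection matrix *)

Section WeightedMatrices.
Variables (R : realType) (K : fieldType) (rho : R).
Hypothesis rho01 : 0 < rho < 1.
Local Notation L := (laurent K).
Local Notation N := (gauss rho).
Local Notation "B ^`" := (map_mx (@lderiv K) B) (at level 2, format "B ^`").

Lemma geometric_small (C e z : R) : 0 <= e < 1 -> 0 < z -> exists n : nat, C * e ^+ n < z.
Proof.
move=> /andP[e0 e1] z0.
have : (C * e ^+ n @[n --> \oo] --> C * (0 : R))%classic.
  by apply: cvgMl_tmp; apply: cvg_expr; rewrite ger0_norm.
rewrite mulr0 => /cvgrPdist_lt /(_ z z0) [n _ /(_ n (leqnn _))] /=.
rewrite sub0r normrN => h; exists n; exact: le_lt_trans (ler_norm _) h.
Qed.

(** An operator norm bound for weighted sup norms: k bounds the entries of B rescaled by [c] on the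
    rows and [d] on the columns. The rescaling is only virtual, as the weights need not be values of
    the Gauss norm. *)
Definition mxle m n (c : 'I_m -> R) (d : 'I_n -> R) (k : R) (B : 'M[L]_(m, n)) :=
  forall i j, N (B i j) * d j <= k * c i.

Definition wpos n (c : 'I_n -> R) := forall i, 0 < c i.

Lemma mx_lderivD m n (A B : 'M[L]_(m, n)) : (A + B)^` = A^` + B^`.
Proof. by apply/matrixP => i j; rewrite !mxE lderivD. Qed.

Lemma mx_lderivN m n (A : 'M[L]_(m, n)) : (- A)^` = - A^`.
Proof. by apply/matrixP => i j; rewrite !mxE lderivN. Qed.

Lemma mx_lderivM m n p (A : 'M[L]_(m, n)) (B : 'M[L]_(n, p)) :
  (A *m B)^` = A^` *m B + A *m B^`.
Proof.
apply/matrixP => i j; rewrite !mxE lderiv_sum -big_split; apply: eq_bigr => k _.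
by rewrite !mxE lderivM.
Qed.

Lemma mx_lderiv0 m n : (0 : 'M[L]_(m, n))^` = 0.
Proof. by apply/matrixP => i j; rewrite !mxE lderiv0. Qed.

Lemma mx_lderiv1 n : (1%:M : 'M[L]_n)^` = 0.
Proof.
by apply/matrixP => i j; rewrite !mxE; case: eqP; rewrite ?lderiv1 ?lderiv0.
Qed.

Section Bounds.
Variables (m n : nat) (c : 'I_m -> R) (d : 'I_n -> R).
Hypotheses (c0 : wpos c) (d0 : wpos d).
Implicit Types A B : 'M[L]_(m, n).

Lemma mxle0 k : 0 <= k -> mxle c d k 0.
Proof. by move=> k0 i j; rewrite mxE gauss0 mul0r mulr_ge0 // ltW. Qed.

Lemma mxleD k A B : mxle c d k A -> mxle c d k B -> mxle c d k (A + B).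
Proof.
move=> hA hB i j; rewrite mxE -ler_pdivlMr //.
by apply: gaussD_le; rewrite // ler_pdivlMr.
Qed.

Lemma mxleN k A : mxle c d k A -> mxle c d k (- A).
Proof. by move=> hA i j; rewrite mxE gaussN. Qed.

Lemma mxleB k A B : mxle c d k A -> mxle c d k B -> mxle c d k (A - B).
Proof. by move=> hA /mxleN; exact: mxleD. Qed.

Lemma mxle_weak k k' A : k <= k' -> mxle c d k A -> mxle c d k' A.
Proof. by move=> kk hA i j; apply: (le_trans (hA i j)); rewrite ler_pM2r. Qed.

Lemma mxle_deriv k A : mxle c d k A -> mxle c d (rho^-1 * k) A^`.
Proof.
move=> hA i j; rewrite mxE.
apply: (@le_trans _ _ (rho^-1 * N (A i j) * d j)).
  by rewrite ler_pM2r // gauss_lderiv.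
rewrite -!mulrA ler_wpM2l // invr_ge0 ltW //; by case/andP: rho01.
Qed.

Lemma mxle_ex A : exists2 k, 0 <= k & mxle c d k A.
Proof.
have h i j : 0 <= N (A i j) * d j / c i.
  by rewrite !mulr_ge0 ?invr_ge0 ?gauss_ge0 // ltW.
exists (\sum_i \sum_j N (A i j) * d j / c i).
  by apply: sumr_ge0 => i _; apply: sumr_ge0.
move=> i j; rewrite -ler_pdivrMr // (bigD1 i) //= (bigD1 j) //= -addrA lerDl.
by rewrite addr_ge0 // sumr_ge0 // => k _; rewrite sumr_ge0.
Qed.

Lemma mxle_zero C e A : 0 <= e < 1 -> (forall s : nat, mxle c d (C * e ^+ s) A) -> A = 0.
Proof.
move=> e01 hA; apply/matrixP => i j; rewrite mxE; apply/eqP/negPn/negP => /(gauss_gt0 rho01) h.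
have [s] := geometric_small C e01 (divr_gt0 (mulr_gt0 h (d0 j)) (c0 i)).
by rewrite ltr_pdivlMr // ltNge hA.
Qed.

(** Every matrix has some finite bound, and this one can be improved by the factor e indefinitely.
    In this form contraction excludes morphisms between different slopes. *)
Lemma mxle_contract_zero e A : 0 <= e < 1 ->
  (forall k, 0 <= k -> mxle c d k A -> mxle c d (e * k) A) -> A = 0.
Proof.
move=> e01 hA; have [k k0 hk] := mxle_ex A; apply: (mxle_zero (C := k) e01) => s.
elim: s => [|s IH]; first by rewrite mulr1.
rewrite exprS mulrCA; apply: hA => //.
by rewrite mulr_ge0 // exprn_ge0 //; case/andP: e01.
Qed.

(** Banach's fixed point theorem, with limits taken entrywise. Invariance and contraction are asked
    only on the ball of radius [k0], because the Riccati map is quadratic. *)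
Lemma mx_fixpoint (k0 e : R) (F : 'M[L]_(m, n) -> 'M[L]_(m, n)) :
  0 <= k0 -> 0 <= e < 1 ->
  (forall X, mxle c d k0 X -> mxle c d k0 (F X)) ->
  (forall X Y k, 0 <= k -> mxle c d k0 X -> mxle c d k0 Y -> mxle c d k (X - Y) ->
     mxle c d (e * k) (F X - F Y)) ->
  exists2 X, mxle c d k0 X & F X = X.
Proof.
move=> k00 e01 Fk Fe; have /andP[e0 e1] := e01.
pose X s := iter s F 0.
have X1 s : mxle c d k0 (X s) by elim: s => [|s]; [exact: mxle0 | exact: Fk].
have ks s : 0 <= k0 * e ^+ s by rewrite mulr_ge0 ?exprn_ge0.
have X2 s : mxle c d (k0 * e ^+ s) (X s.+1 - X s).
  elim: s => [|s IH]; first by rewrite mulr1 subr0; exact: X1.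
  by rewrite exprS mulrCA; exact: (Fe (X s.+1) (X s) _ (ks s) (X1 _) (X1 _) IH).
have lim ij : exists l, forall s, N (l - X s ij.1 ij.2) <= k0 * e ^+ s * (c ij.1 / d ij.2).
  have h : 0 < c ij.1 / d ij.2 by rewrite divr_gt0.
  apply: (gauss_complete rho01) => [s s' ss|z z0|s].
  - by rewrite ler_pM2r // ler_wpM2l // ler_wiXn2l // ltW.
  - have [s sz] := geometric_small k0 e01 (divr_gt0 z0 h).
    by exists s; rewrite -ltr_pdivlMr.
  - by have := X2 s ij.1 ij.2; rewrite !mxE mulrA ler_pdivlMr.
have [l lP] := choice lim.
pose Y := \matrix_(i, j) l (i, j) : 'M[L]_(m, n).
have YX s : mxle c d (k0 * e ^+ s) (Y - X s).
  by move=> i j; have := lP (i, j) s; rewrite !mxE /= mulrA ler_pdivlMr.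
have Y1 : mxle c d k0 Y by have := YX 0%N; rewrite mulr1 subr0.
exists Y => //; apply/eqP; rewrite -subr_eq0; apply/eqP.
apply: (mxle_zero (C := k0) e01) => s.
rewrite -(subrK (X s.+1) (F Y)) -addrA; apply: mxleD.
  apply: mxle_weak (Fe Y (X s) _ (ks s) Y1 (X1 s) (YX s)).
  by rewrite ler_piMl // ltW.
rewrite -opprB; apply: mxleN; apply: mxle_weak (YX s.+1).
by rewrite exprS mulrCA ler_piMl // ltW.
Qed.

End Bounds.

Lemma mxleM m n p (c : 'I_m -> R) (d : 'I_n -> R) (e : 'I_p -> R) k k'
    (A : 'M[L]_(m, n)) (B : 'M[L]_(n, p)) :
  wpos c -> wpos d -> wpos e -> 0 <= k -> 0 <= k' ->
  mxle c d k A -> mxle d e k' B -> mxle c e (k * k') (A *m B).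
Proof.
move=> c0 d0 e0 k0 k'0 hA hB i j; rewrite mxE -ler_pdivlMr //.
apply: (gauss_sum rho01) => [|l _].
  by rewrite divr_ge0 ?mulr_ge0 ?(ltW (c0 i)) ?(ltW (e0 j)).
rewrite ler_pdivlMr // gaussM // -mulrA.
apply: (@le_trans _ _ (N (A i l) * (k' * d l))).
  by rewrite ler_wpM2l ?gauss_ge0.
by rewrite mulrCA [k * k']mulrC -mulrA ler_wpM2l.
Qed.

(* A is block diagonal for the partition by the values of th, and on a block of
   positive slope (th i > rho^-1) A is th i times an isometry for the weights c,
   with inverse B. *)
Definition nf n (A B : 'M[L]_n) (th c : 'I_n -> R) :=
  [/\ wpos c,
      forall i j, A i j != 0 \/ B i j != 0 -> th i = th j,
      forall i j, N (A i j) * c j <= th i * c i,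
      forall i j, N (B i j) * c j <= (th i)^-1 * c i &
      forall i j, rho^-1 < th i ->
        (A *m B) i j = (i == j)%:R /\ (B *m A) i j = (i == j)%:R].

End WeightedMatrices.

(** * Block diagonalization of companion matrices *)

Section GaugeNormalForm.
Variables (R : realType) (K : fieldType) (rho : R).
Hypothesis rho01 : 0 < rho < 1.
Local Notation L := (laurent K).
Local Notation N := (gauss rho).
Local Notation "B ^`" := (map_mx (@lderiv K) B) (at level 2, format "B ^`").
Local Notation mxle := (mxle rho).

Let rhoV_gt0 : 0 < rho^-1. Proof. by rewrite invr_gt0; case/andP: rho01. Qed.

(** Row i holds the coordinates of the derivative of the i-th vector of a cyclic basis; [g] lists
    the lower coefficients of the monic operator. *)
Definition companion_mx n (g : nat -> L) : 'M[L]_n :=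
  \matrix_(i, j) (if i.+1 == n then - g j else (j == i.+1 :> nat)%:R).

Definition weight (th : nat -> R) k : R := \prod_(i < k) th i.+1.

Lemma weightS th k : weight th k.+1 = weight th k * th k.+1.
Proof. by rewrite /weight big_ord_recr. Qed.

(* The Newton polygon in multiplicative form: th i stands for
   rho^-(1 + mu_i) and weight th r / weight th k for rho^(h(k) - (r - k)). *)
Definition mpolygon n (g : nat -> L) (th : nat -> R) :=
  [/\ th 0%N = rho^-1,
      forall i, (i < n)%N -> th i <= th i.+1,
      forall k, (k < n)%N -> N (g k) * weight th k <= weight th n &
      forall k, (k < n)%N -> th k < th k.+1 -> N (g k) * weight th k = weight th n].

(** The inverse is written out, rather than obtained from the determinant, because its entries are
    estimated one by one in [B_le]. *)
Definition companion_inv q' (g : nat -> L) : 'M[L]_q'.+1 := \matrix_(i, j)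
  (if i == 0 then - (g 0)^-1 * (if j == q' :> nat then 1 else g j.+1)
   else (j.+1 == i :> nat)%:R).

Lemma companion_invP q' g : g 0%N != 0 ->
  companion_mx q'.+1 g *m companion_inv q' g = 1%:M.
Proof.
move=> g0; set B := companion_inv q' g.
have BS (i j : 'I_q'.+1) : i != 0 -> B i j = (j.+1 == i :> nat)%:R.
  by move=> i0; rewrite mxE (negPf i0).
apply/matrixP => i j; rewrite mxE [RHS]mxE.
have [iq|iq] := eqVneq (i : nat) q'; last first.
  have iq' : (i.+1 < q'.+1)%N by move: iq (ltn_ord i); clear; lia.
  rewrite (bigD1 (Ordinal iq')) //= big1 ?addr0 => [|k ki].
    by rewrite BS // mxE /= eqSS (negPf iq) eqxx mul1r eqSS eq_sym.
  by rewrite mxE eqSS (negPf iq) -(inj_eq val_inj) /= in ki *; rewrite (negPf ki) mul0r.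
have A22i k : companion_mx q'.+1 g i k = - g k.
  by rewrite mxE iq eqxx.
rewrite (bigD1 0) //= A22i mxE eqxx mulrA mulrNN divff // mul1r.
have [jq|jq] := eqVneq (j : nat) q'.
  rewrite big1 => [|k k0']; first by rewrite addr0 -(inj_eq val_inj) /= iq jq eqxx.
  rewrite BS // jq; case: eqP => [kE|_]; last by rewrite mulr0.
  by have := ltn_ord k; rewrite -kE ltnn.
have jq' : (j.+1 < q'.+1)%N by move: jq (ltn_ord j); clear; lia.
rewrite (bigD1 (Ordinal jq')) //= big1 ?addr0 => [|k /andP[k1 k2]]; last first.
  rewrite BS //; case: eqP => [kE|_]; last by rewrite mulr0.
  by move/eqP: k2; case; apply/val_inj.
rewrite BS // eqxx mulr1 A22i /= subrr -(inj_eq val_inj) /= iq eq_sym.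
by rewrite (negPf jq).
Qed.

Section Step.
Variables (n : nat) (g : nat -> L) (th : nat -> R).
Hypothesis gth : mpolygon n g th.

Lemma mpolygon_mono i j : (i <= j <= n)%N -> th i <= th j.
Proof.
have [_ h _ _] := gth; case/andP; elim: j => [|j IH]; first by rewrite leqn0 => /eqP->.
rewrite leq_eqVlt => /orP[/eqP->//|ij jn]; apply: (le_trans (IH ij (ltnW jn))).
exact: h.
Qed.

Lemma mpolygon_ge i : (i <= n)%N -> rho^-1 <= th i.
Proof. by have [<- _ _ _] := gth => h; apply: mpolygon_mono. Qed.

Lemma mpolygon_gt0 i : (i <= n)%N -> 0 < th i.
Proof. by move=> /mpolygon_ge; exact: lt_le_trans. Qed.

Lemma weight_gt0 k : (k <= n)%N -> 0 < weight th k.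
Proof.
move=> kn; apply: prodr_gt0 => i _; apply: mpolygon_gt0.
exact: leq_trans (ltn_ord i) kn.
Qed.

(** This is the purpose of [weight]: the entry 1 from index i to i + 1 gets the weighted norm
    [th i.+1] exactly, and the last row is controlled by the Newton polygon inequalities. *)
Lemma companion_bound (i j : 'I_n) :
  N (companion_mx n g i j) * weight th j <= th i.+1 * weight th i.
Proof.
rewrite mxE mulrC [leRHS]mulrC -weightS; case: eqP => [ein|_].
  rewrite gaussN // mulrC ein; have [_ _ gw _] := gth; exact: gw.
case: eqP => [->|_]; first by rewrite gauss1 // mulr1.
by rewrite gauss0 mulr0 ltW // weight_gt0.
Qed.

End Step.

Section Split.
Variables (k0 q' : nat) (g : nat -> L) (th : nat -> R).
Local Notation q := q'.+1.
Hypothesis gth : mpolygon (k0 + q) g th.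
Hypothesis flat : forall i, (k0 < i <= k0 + q)%N -> th i = th (k0 + q)%N.
Hypothesis jump : th k0 < th (k0 + q)%N.

Let C := companion_mx (k0 + q) g.
Let A11 : 'M_k0 := ulsubmx C.
Let A12 : 'M_(k0, q) := ursubmx C.
Let A21 : 'M_(q, k0) := dlsubmx C.
Let A22 : 'M_q := drsubmx C.
Let t := th (k0 + q)%N.
Let t' := th k0.
Let cU (i : 'I_k0) := weight th i.
Let cV (i : 'I_q) := weight th (k0 + i).

Let t_gt0 : 0 < t. Proof. exact: (mpolygon_gt0 gth). Qed.
Let t'_gt0 : 0 < t'. Proof. exact: (mpolygon_gt0 gth (leq_addr _ _)). Qed.
Let rho_t' : rho^-1 <= t'. Proof. exact: (mpolygon_ge gth (leq_addr _ _)). Qed.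
Let cU_gt0 : wpos cU.
Proof. by move=> i; apply: (weight_gt0 gth); move: (ltn_ord i); clear; lia. Qed.
Let cV_gt0 : wpos cV.
Proof. by move=> i; apply: (weight_gt0 gth); move: (ltn_ord i); clear; lia. Qed.

(** The contraction factor: inverting the block of the last edge contributes [t^-1], while [A11],
    [A12] and, since [rho^-1 <= t'], the derivation contribute at most [t']. *)
Let e := t^-1 * t'.
Let e01 : 0 <= e < 1.
Proof.
rewrite /e mulr_ge0 ?invr_ge0 ?ltW //=.
by rewrite mulrC ltr_pdivrMr // mul1r.
Qed.
Let e_ge0 : 0 <= e. Proof. by case/andP: e01. Qed.

Let A11_le : mxle cU cU t' A11.
Proof.
move=> i j; have -> : A11 i j = C (lshift q i) (lshift q j) by rewrite !mxE.
apply: (le_trans (companion_bound gth _ _)); rewrite ler_pM2r ?cU_gt0 //.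
by apply: (mpolygon_mono gth); move: (ltn_ord i); rewrite /=; clear; lia.
Qed.

Let A12_le : mxle cU cV t' A12.
Proof.
move=> i j; have -> : A12 i j = C (lshift q i) (rshift k0 j) by rewrite !mxE.
apply: (le_trans (companion_bound gth _ _)); rewrite ler_pM2r ?cU_gt0 //.
by apply: (mpolygon_mono gth); move: (ltn_ord i); rewrite /=; clear; lia.
Qed.

Let A21_le : mxle cV cU t A21.
Proof.
move=> i j; have -> : A21 i j = C (rshift k0 i) (lshift q j) by rewrite !mxE.
apply: (le_trans (companion_bound gth _ _)); rewrite ler_pM2r ?cV_gt0 //.
by apply: (mpolygon_mono gth); move: (ltn_ord i); rewrite /=; clear; lia.
Qed.

Let A22_le : mxle cV cV t A22.
Proof.
move=> i j; have -> : A22 i j = C (rshift k0 i) (rshift k0 j) by rewrite !mxE.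
apply: (le_trans (companion_bound gth _ _)); rewrite ler_pM2r ?cV_gt0 //.
by apply: (mpolygon_mono gth); move: (ltn_ord i); rewrite /=; clear; lia.
Qed.

(** The slope jumps at [k0], so [k0] is a vertex and the polygon inequality is an equality there.
    Hence [g k0] is nonzero, and the lower right block, itself a companion matrix with constant term
    [g k0], is invertible. *)
Let gk0 : N (g k0) * weight th k0 = weight th (k0 + q).
Proof.
have [_ _ _ gw] := gth; apply: gw; first by rewrite -addSnnS leq_addr.
by rewrite (@flat k0.+1) // ltnS leqnn -addSnnS leq_addr.
Qed.

Let wk0 : 0 < weight th k0. Proof. by apply: (weight_gt0 gth); exact: leq_addr. Qed.
Let wr : 0 < weight th (k0 + q). Proof. by apply: (weight_gt0 gth). Qed.

Let gk0_neq0 : g k0 != 0.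
Proof.
by apply: contraTneq wr => g0; rewrite -gk0 g0 gauss0 mul0r ltxx.
Qed.

Let B := companion_inv q' (fun j => g (k0 + j)%N).

Let A22B : A22 *m B = 1%:M.
Proof.
have g0 : g (k0 + 0)%N != 0 by rewrite addn0.
rewrite -(@companion_invP _ (fun j => g (k0 + j)%N) g0); congr (_ *m _).
apply/matrixP => i j; rewrite !mxE /= addnS eqSS -addnS eqn_add2l.
by rewrite addnS eqSS; case: eqP => // _; rewrite -addnS eqn_add2l.
Qed.

Let BA22 : B *m A22 = 1%:M. Proof. exact: mulmx1C. Qed.

Let weight_flat i : (k0 <= i < k0 + q)%N -> weight th i = t^-1 * weight th i.+1.
Proof. by move=> iq; rewrite weightS (@flat i.+1) // mulrCA mulVf ?mulr1 ?gt_eqF. Qed.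

(** Along the last edge consecutive weights differ by the constant factor [t]. The shift rows then
    attain the bound, and the first row is the polygon inequality at k0 + j + 1 divided by the
    equality at [k0]. *)
Let B_le : mxle cV cV t^-1 B.
Proof.
move=> i j; rewrite /cV (@weight_flat (k0 + j)) ?leq_addr ?ltn_add2l /= ?ltn_ord //.
rewrite mulrCA ler_pM2l ?invr_gt0 // mxE; case: eqP => [->|/eqP i0].
  rewrite !addn0 gaussM // gaussN // gaussV // -mulrA mulrC ler_pdivrMr ?gauss_gt0 //.
  rewrite [leRHS]mulrC gk0; case: eqP => [->|/eqP jq'].
    by rewrite gauss1 // mul1r addnS.
  rewrite addnS; have [_ _ gw _] := gth; apply: gw.
  by rewrite addnS ltnS ltn_add2l ltn_neqAle jq' -ltnS /=.
case: eqP => [<-|_]; first by rewrite gauss1 // mul1r addnS.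
by rewrite gauss0 mul0r ltW //; apply: cV_gt0.
Qed.

Let Fric (X : 'M[L]_(q, k0)) := B *m (X^` + X *m A11 + A21 - X *m A12 *m X).

Let step_le (X : 'M[L]_(q, k0)) k : 0 <= k -> mxle cV cU 1 X -> mxle cV cU k X ->
  mxle cV cU (t' * k) (X^` + X *m A11).
Proof.
move=> k_ge0 X1 Xk; apply: (mxleD rho01 cU_gt0); last first.
  by rewrite mulrC; apply: (mxleM rho01 _ _ _ _ _ Xk A11_le) => //; exact: ltW.
apply: (mxle_weak cV_gt0 _ (mxle_deriv rho01 cU_gt0 Xk)).
by rewrite ler_wpM2r.
Qed.

(* A fixed point X of Fric solves the Riccati equation which says that the gauge
   transformation by the block matrix (1 0; X 1) kills the lower left block of C. *)
Let riccati : exists X, [/\ mxle cV cU 1 X, Fric X = X & mxle cV cU e (X - B *m A21)].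
Proof.
have t'0 := ltW t'_gt0; have t0 := ltW t_gt0; have tV : 0 <= t^-1 by rewrite invr_ge0.
have XAX X Y k : 0 <= k -> mxle cV cU 1 Y -> mxle cV cU k X ->
    mxle cV cU (t' * k) (X *m A12 *m Y).
  move=> k_ge0 Y1 Xk; rewrite mulrC -[k * t']mulr1.
  have XA := mxleM rho01 cV_gt0 cU_gt0 cV_gt0 k_ge0 t'0 Xk A12_le.
  apply: (mxleM rho01 cV_gt0 cV_gt0 cU_gt0 _ ler01 XA Y1).
  by rewrite mulr_ge0.
have YAX X Y k : 0 <= k -> mxle cV cU 1 Y -> mxle cV cU k X ->
    mxle cV cU (t' * k) (Y *m A12 *m X).
  move=> k_ge0 Y1 Xk; rewrite -[t' * k]mul1r mulrA.
  have XA := mxleM rho01 cV_gt0 cU_gt0 cV_gt0 ler01 t'0 Y1 A12_le.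
  apply: (mxleM rho01 cV_gt0 cV_gt0 cU_gt0 _ k_ge0 XA Xk).
  by rewrite mulr_ge0.
(* Apart from [B *m A21], every term of [Fric] carries the factor e. This proves invariance of the
   unit ball and also that the fixed point is close to [B *m A21], from which the polygon of the
   remaining block is read off. *)
have part X : mxle cV cU 1 X -> mxle cV cU e (Fric X - B *m A21).
  move=> X1; rewrite /Fric -mulmxBr addrAC addrK.
  have h : mxle cV cU t' (X^` + X *m A11 - X *m A12 *m X).
    by rewrite -[t']mulr1; apply: (mxleB rho01 cU_gt0); [exact: step_le | exact: XAX].
  exact: (mxleM rho01 cV_gt0 cV_gt0 cU_gt0 tV t'0 B_le h).
have BA : mxle cV cU 1 (B *m A21).
  rewrite -(@mulVf _ t) ?gt_eqF //.
  exact: (mxleM rho01 cV_gt0 cV_gt0 cU_gt0 tV t0 B_le A21_le).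
have ball X : mxle cV cU 1 X -> mxle cV cU 1 (Fric X).
  move=> X1; rewrite -(subrK (B *m A21) (Fric X)); apply: (mxleD rho01 cU_gt0) => //.
  by apply: (mxle_weak cV_gt0 _ (part _ X1)); apply: ltW; case/andP: e01.
have [|X X1 FX] := mx_fixpoint rho01 cV_gt0 cU_gt0 ler01 e01 ball.
  move=> X Y k k_ge0 X1 Y1 XYk; rewrite /Fric -mulmxBr.
  have -> : X^` + X *m A11 + A21 - X *m A12 *m X - (Y^` + Y *m A11 + A21 - Y *m A12 *m Y)
     = ((X - Y)^` + (X - Y) *m A11) - ((X - Y) *m A12 *m X + Y *m A12 *m (X - Y)).
    rewrite mx_lderivD mx_lderivN !mulmxBl !mulmxBr.
    move: (X^`) (Y^`) (X *m A11) (Y *m A11) (X *m A12 *m X) (Y *m A12 *m X) (Y *m A12 *m Y) => a b a1 b1 a2 b2 c2.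
    apply/matrixP => i j; rewrite !mxE; ring.
  rewrite /e -mulrA; apply: (mxleM rho01 cV_gt0 cV_gt0 cU_gt0 tV _ B_le).
    by rewrite mulr_ge0.
  apply: (mxleB rho01 cU_gt0); last apply: (mxleD rho01 cU_gt0).
  - apply: (mxleD rho01 cU_gt0); last first.
      by rewrite mulrC; apply: (mxleM rho01 _ _ _ _ _ XYk A11_le).
    apply: (mxle_weak cV_gt0 _ (mxle_deriv rho01 cU_gt0 XYk)).
    by rewrite ler_wpM2r.
  - exact: XAX.
  - exact: YAX.
by exists X; split => //; rewrite -{1}FX; apply: part.
Qed.

(** Two gauge transformations: X from the Riccati equation clears the lower left block, then Y, from
    a linear equation, clears the upper right one. The upper left block that remains is again a
    companion matrix, with the same polygon up to [k0], so that the splitting can be iterated. *)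
Lemma companion_split : exists (G : 'M[L]_(k0 + q)) (gB : nat -> L) (Z V : 'M[L]_q),
  [/\ G \in unitmx,
      G^` + G *m companion_mx (k0 + q) g
        = block_mx (companion_mx k0 gB) 0 0 Z *m G,
      mpolygon k0 gB th,
      Z *m V = 1%:M &
      mxle (fun i : 'I_q => weight th (k0 + i)) (fun i : 'I_q => weight th (k0 + i)) (th (k0 + q)%N) Z /\
      mxle (fun i : 'I_q => weight th (k0 + i)) (fun i : 'I_q => weight th (k0 + i)) (th (k0 + q)%N)^-1 V].
Proof.
have t'0 := ltW t'_gt0; have t0 := ltW t_gt0; have tV : 0 <= t^-1 by rewrite invr_ge0.
have [X [X1 FX XB]] := riccati.
pose Z := A22 + X *m A12.
have XA_le : mxle cV cV t' (X *m A12).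
  by rewrite -[t']mul1r; apply: (mxleM rho01 _ _ _ _ _ X1 A12_le).
have Z_le : mxle cV cV t Z.
  by apply: (mxleD rho01 cV_gt0) => //; apply: (mxle_weak cV_gt0 _ XA_le); apply: ltW.
(* The inverse of Z = A22 (1 + B X A12), obtained as a fixed point instead of a Neumann series; the
   perturbation [B *m (X *m A12)] has norm at most e. *)
have [V V_le VE] : exists2 V : 'M[L]_q, mxle cV cV t^-1 V & B - B *m (X *m A12) *m V = V.
  have BXA_le : mxle cV cV e (B *m (X *m A12)).
    exact: (mxleM rho01 cV_gt0 cV_gt0 cV_gt0 tV t'0 B_le XA_le).
  apply: (mx_fixpoint rho01 cV_gt0 cV_gt0 tV e01) => [Y Y1|Y Y' k k_ge0 _ _ YY].
    apply: (mxleB rho01 cV_gt0 B_le).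
    apply: (mxle_weak cV_gt0 _ (mxleM rho01 cV_gt0 cV_gt0 cV_gt0 e_ge0 tV BXA_le Y1)).
    by rewrite ler_piMl //; apply: ltW; case/andP: e01.
  have -> : B - B *m (X *m A12) *m Y - (B - B *m (X *m A12) *m Y') =
      - (B *m (X *m A12) *m (Y - Y')).
    by rewrite mulmxBr opprB addrC opprB addrA subrK.
  apply: mxleN.
  exact: (mxleM rho01 cV_gt0 cV_gt0 cV_gt0 e_ge0 k_ge0 BXA_le YY).
have ZV : Z *m V = 1%:M.
  have : V + B *m (X *m A12) *m V = B by rewrite -{1}VE subrK.
  rewrite -{1}[V]mul1mx -mulmxDl -BA22 -mulmxDr -/Z => h.
  have := congr1 (mulmx A22) h; by rewrite A22B BA22 -(mulmxA B) mulmxA A22B mul1mx.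
pose B11 := A11 - A12 *m X.
have B11_le : mxle cU cU t' B11.
  apply: (mxleB rho01 cU_gt0) => //; rewrite -[t']mulr1.
  exact: (mxleM rho01 cU_gt0 cV_gt0 cU_gt0 t'0 ler01 A12_le X1).
(* The upper right block vanishes when Y' + A12 + Y Z = B11 Y. Multiplying by [V] on the right gains
   [t^-1] against the bound [t'] of the other operations. *)
have [Y Y_le YE] : exists2 Y : 'M[L]_(k0, q), mxle cU cV e Y & (B11 *m Y - Y^` - A12) *m V = Y.
  have lin Y k : 0 <= k -> mxle cU cV k Y -> mxle cU cV (t' * k) (B11 *m Y - Y^`).
    move=> k_ge0 Yk; apply: (mxleB rho01 cV_gt0).
      exact: (mxleM rho01 cU_gt0 cU_gt0 cV_gt0 t'0 k_ge0 B11_le Yk).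
    apply: (mxle_weak cU_gt0 _ (mxle_deriv rho01 cV_gt0 Yk)).
    by rewrite ler_wpM2r.
  apply: (mx_fixpoint rho01 cU_gt0 cV_gt0 e_ge0 e01) => [Y Ye|Y Y' k k_ge0 _ _ YY].
    rewrite /e mulrC; apply: (mxleM rho01 cU_gt0 cV_gt0 cV_gt0 t'0 tV _ V_le).
    apply: (mxleB rho01 cV_gt0) => //.
    apply: (mxle_weak cU_gt0 _ (lin _ _ e_ge0 Ye)).
    by rewrite ler_piMr //; apply: ltW; case/andP: e01.
  rewrite -mulmxBl.
  have -> : B11 *m Y - Y^` - A12 - (B11 *m Y' - Y'^` - A12) = B11 *m (Y - Y') - (Y - Y')^`.
    rewrite mx_lderivD mx_lderivN mulmxBr.
    by apply/matrixP => i j; rewrite !mxE; ring.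
  have -> : e * k = t' * k * t^-1 by rewrite /e -mulrA mulrC.
  apply: (mxleM rho01 cU_gt0 cV_gt0 cV_gt0 _ tV (lin _ _ k_ge0 YY) V_le).
  by rewrite mulr_ge0.
pose T1 : 'M[L]_(k0 + q) := block_mx 1%:M 0 X 1%:M.
pose T2 : 'M[L]_(k0 + q) := block_mx 1%:M Y 0 1%:M.
(* The only nonzero entry of [A12] is a 1 in its last row and first column, so subtracting
   [A12 *m X] alters only the last row of [A11], which becomes minus the first row of X. *)
pose gB j := if insub j is Some i then X 0 i else 0.
have gBE (j : 'I_k0) : gB j = X 0 j by rewrite /gB valK.
have XE : X^` + X *m A11 + A21 = Z *m X.
  have := congr1 (mulmx A22) FX; rewrite /Fric mulmxA A22B mul1mx.
  by move/(canRL (subrK _)) => ->; rewrite mulmxDl.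
have YZ : Y^` + A12 + Y *m Z = B11 *m Y.
  have VZ : V *m Z = 1%:M by apply: mulmx1C.
  have := congr1 (mulmxr Z) YE; rewrite /= -mulmxA VZ mulmx1 => <-.
  by rewrite -[_ - _ - _]addrA -opprD [LHS]addrC subrK.
have B11E : B11 = companion_mx k0 gB.
  apply/matrixP => i j; rewrite !mxE.
  rewrite ifF; last by apply/negP => /eqP; move: (ltn_ord i); rewrite /=; clear; lia.
  have [ik|ik] := eqVneq i.+1 k0.
    rewrite gBE (bigD1 0) //= big1 ?addr0 => [|l l0].
      rewrite !mxE ifF; last by apply/negP => /eqP; rewrite /=; move: ik; clear; lia.
      by rewrite /= addn0 ik eqxx mul1r ltn_eqF ?ltn_ord // sub0r.
    rewrite !mxE ifF; last by apply/negP => /eqP; rewrite /=; move: ik; clear; lia.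
    by rewrite /= ik -[X in _ == X]addn0 eqn_add2l -[0%N]/(val (0 : 'I_q)) (inj_eq val_inj) (negPf l0) mul0r.
  rewrite big1 ?subr0 // => l _; rewrite !mxE.
  rewrite ifF; last by apply/negP => /eqP; rewrite /=; move: (ltn_ord i); clear; lia.
  rewrite /= gtn_eqF ?mul0r //; move: ik (ltn_ord i); clear; lia.
have T1E : T1^` + T1 *m C = block_mx B11 A12 0 Z *m T1.
  rewrite /T1 map_block_mx !mx_lderiv1 mx_lderiv0 -[C]submxK !mulmx_block.
  rewrite !mul1mx !mul0mx !mulmx1 !mulmx0 !addr0 !add0r.
  by rewrite add_block_mx !add0r addrA XE subrK addrC.
have T2E : T2^` + T2 *m block_mx B11 A12 0 Z = block_mx B11 0 0 Z *m T2.
  rewrite /T2 map_block_mx !mx_lderiv1 mx_lderiv0 !mulmx_block.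
  rewrite !mul1mx !mul0mx !mulmx1 !mulmx0 !addr0 !add0r.
  by rewrite add_block_mx !add0r addrA YZ.
exists (T2 *m T1), gB, Z, V; split => //.
- by rewrite unitmxE det_mulmx !det_ublock ?det_lblock !det1 !mul1r unitr1.
- rewrite mx_lderivM -addrA -mulmxA -[companion_mx (k0 + q) g]/C -mulmxDr T1E.
  by rewrite mulmxA -mulmxDl T2E -B11E mulmxA.
have [th0 thS _ _] := gth; split => //.
- by move=> i ik; apply: thS; rewrite ltn_addr.
- move=> k kk; rewrite (gBE (Ordinal kk)); have := X1 0 (Ordinal kk).
  by rewrite /cV /cU /= addn0 mul1r.
(* Vertices persist: the entry of [B *m A21] in question is g k / g k0, whose norm is exactly the
   required one at a vertex, and X differs from it by a factor e < 1 less, so it has the same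
   norm. *)
move=> k kk kj; rewrite (gBE (Ordinal kk)).
have wk : 0 < weight th k by apply: (weight_gt0 gth); rewrite ltnW // ltn_addr.
have := XB 0 (Ordinal kk); rewrite /cV /cU /= addn0.
have gk : N ((B *m A21) 0 (Ordinal kk)) * weight th k = weight th k0.
  rewrite mxE (bigD1 ord_max) //= big1 ?addr0 => [|l l0].
    rewrite [B _ _]mxE /= eqxx mulr1 addn0 !mxE ifT; last by rewrite /= addnS eqxx.
    rewrite /= mulrNN gaussM // gaussV // -mulrA.
    have [_ _ _ ->] := gth; [|by rewrite ltn_addr|by []].
    by rewrite -gk0 mulKf // gt_eqF // gauss_gt0.
  rewrite [A21 _ _](_ : _ = 0) ?mulr0 // !mxE ifF; last first.
    apply/negP => /eqP lq; move/eqP: l0; case; apply/val_inj.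
    by move: lq; rewrite /=; clear; lia.
  by rewrite ltn_eqF //=; move: kk; clear; lia.
rewrite mxE [X in N (_ + X)]mxE.
move: gk; set b := (B *m A21) _ _; set x := X _ _ => gk h.
apply/eqP; rewrite eq_le; apply/andP; split.
  by have := X1 0 (Ordinal kk); rewrite /cV /cU /= addn0 mul1r.
have := gaussD rho01 x (- (x - b)).
rewrite gaussN // opprB addrC subrK le_max => /orP[|] bx.
  by rewrite -gk ler_pM2r.
have ltE : e * weight th k0 < weight th k0.
  by rewrite gtr_pMl //; case/andP: e01.
move: ltE; rewrite ltNge -{1}gk => /negP; case.
by apply: le_trans h; rewrite ler_pM2r.
Qed.

End Split.

Theorem companion_nf n g th : mpolygon n g th ->
  exists (G A B : 'M[L]_n),
    [/\ G \in unitmx, G^` + G *m companion_mx n g = A *m G &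
        nf rho A B (fun i : 'I_n => th i.+1) (fun i : 'I_n => weight th i)].
Proof.
elim/ltn_ind: n g => n IH g gth.
have wn : wpos (fun i : 'I_n => weight th i).
  by move=> i; apply: (weight_gt0 gth); exact: ltnW.
have thn (i : 'I_n) : 0 < th i.+1 by apply: (mpolygon_gt0 gth).
have [tn|tn] := boolP (th n == rho^-1).
  (* All slopes are 0 here: no index satisfies [rho^-1 < th i], so no inverse is demanded and 0
     serves as B. *)
  exists 1%:M, (companion_mx n g), 0; split.
  - by rewrite unitmx1.
  - by rewrite mx_lderiv1 add0r mul1mx mulmx1.
  have tE (i : 'I_n) : th i.+1 = rho^-1.
    apply/eqP; rewrite eq_le (mpolygon_ge gth) // -(eqP tn) (mpolygon_mono gth) //.
    by rewrite ltn_ord leqnn.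
  split => // [i j _|i j|i j|i j].
  - by rewrite !tE.
  - exact: companion_bound.
  - by rewrite mxE gauss0 mul0r mulr_ge0 ?invr_ge0 // ltW.
  - by rewrite tE ltxx.
have thm := mpolygon_mono gth.
have ex : exists k, (k <= n)%N && (th k == th n) by exists n; rewrite leqnn eqxx.
(* The least index with the last slope; its predecessor [k0] is the left end of the last edge. *)
have [[|k0] /andP[kn /eqP tk] kmin] := ex_minnP ex.
  by case/eqP: tn; rewrite -tk; case: gth.
have jump : th k0 < th n.
  rewrite lt_neqAle thm ?leqnn ?andbT; last by rewrite ltnW.
  apply/negP => /eqP h; have := kmin k0; rewrite (ltnW kn) h eqxx => /(_ isT).
  by rewrite ltnn.
have flat i : (k0 < i <= n)%N -> th i = th n.
  move=> /andP[ki i_n]; apply/eqP; rewrite eq_le thm ?i_n ?leqnn // -{1}tk thm //.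
  by rewrite ki i_n.
have [q' nE] : exists q', n = (k0 + q'.+1)%N.
  by exists (n - k0.+1)%N; rewrite addnS -addSn subnKC.
subst n.
have [G [gB [Z [V [Gu GE gBth ZV [Z_le V_le]]]]]] := companion_split gth flat jump.
have k0n : (k0 < k0 + q'.+1)%N by [].
have [G2 [A2 [B2 [G2u G2E [_ blk2 A2_le B2_le AB2]]]]] := IH k0 k0n gB gBth.
exists (block_mx G2 0 0 1%:M *m G), (block_mx A2 0 0 Z), (block_mx B2 0 0 V); split.
- rewrite unitmx_mul Gu andbT unitmxE det_ublock det1 mulr1 -unitmxE //.
- rewrite mx_lderivM -addrA -mulmxA -mulmxDr GE map_block_mx !mx_lderiv0 mx_lderiv1.
  rewrite mulmxA -mulmxDl mulmx_block !mulmx0 !mul0mx !mul1mx !addr0 !add0r.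
  rewrite add_block_mx ?add0r ?addr0 G2E mulmxA; congr (_ *m _).
  by rewrite mulmx_block !mulmx0 !mul0mx !mulmx1 !addr0 !add0r.
have thr (i : 'I_q'.+1) : th (rshift k0 i).+1 = th (k0 + q'.+1)%N.
  by apply: flat; rewrite /= ltnS leq_addr /= -addnS leq_add2l.
split=> //.
- move=> i j; rewrite -(fintype.splitK i) -(fintype.splitK j); case: (fintype.split i) => i'; case: (fintype.split j) => j' /=.
  + by rewrite !block_mxEul => /blk2.
  + by rewrite !block_mxEur !mxE eqxx => -[].
  + by rewrite !block_mxEdl !mxE eqxx => -[].
  + by rewrite !thr.
- move=> i j; rewrite -(fintype.splitK i) -(fintype.splitK j); case: (fintype.split i) => i'; case: (fintype.split j) => j' /=.
  + by rewrite block_mxEul.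
  + by rewrite block_mxEur mxE gauss0 mul0r mulr_ge0 // ltW // (thn (lshift _ i'), wn (lshift _ i')).
  + by rewrite block_mxEdl mxE gauss0 mul0r mulr_ge0 // ltW // (thn (rshift _ i'), wn (rshift _ i')).
  + by rewrite block_mxEdr thr.
- move=> i j; rewrite -(fintype.splitK i) -(fintype.splitK j); case: (fintype.split i) => i'; case: (fintype.split j) => j' /=.
  + by rewrite block_mxEul.
  + by rewrite block_mxEur mxE gauss0 mul0r mulr_ge0 ?invr_ge0 // ltW // (thn (lshift _ i'), wn (lshift _ i')).
  + by rewrite block_mxEdl mxE gauss0 mul0r mulr_ge0 ?invr_ge0 // ltW // (thn (rshift _ i'), wn (rshift _ i')).
  + by rewrite block_mxEdr thr.
- move=> i j; rewrite !mulmx_block !mulmx0 !mul0mx !addr0 !add0r ZV (mulmx1C ZV).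
  rewrite -(fintype.splitK i) -(fintype.splitK j); case: (fintype.split i) => i'; case: (fintype.split j) => j' /= ti.
  + by rewrite !block_mxEul -(inj_eq val_inj); apply: AB2.
  + rewrite !block_mxEur mxE [_ == _](_ : _ = false) //.
    by apply/negP => /eqP /(congr1 val) /=; move: (ltn_ord i'); clear; lia.
  + rewrite !block_mxEdl mxE [_ == _](_ : _ = false) //.
    by apply/negP => /eqP /(congr1 val) /=; move: (ltn_ord j'); clear; lia.
  + by rewrite !block_mxEdr mxE (inj_eq (@rshift_inj _ _)).
Qed.
End GaugeNormalForm.

(** * Horizontal sections on a generic disk *)

Lemma strong_rec (T : Type) (F : seq T -> T) :
  exists y : nat -> T, forall n, y n = F (mkseq y n).
Proof.
pose s := fix s n := if n is n'.+1 then rcons (s n') (F (s n')) else [::].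
exists (fun n => F (s n)) => n; congr F.
by elim: n => // n /= {1}->; rewrite mkseqS.
Qed.

Section HorizontalSections.
Variables (R : realType) (K : fieldType) (V : large_extension R K).
Local Notation W := (Omega V).
Local Notation L := (laurent K).
Local Notation LW := (laurent W).
Variables (rho : R) (t : W).
Hypotheses (charK : [pchar K] =i pred0) (rho01 : 0 < rho < 1) (t_rho : vabs t = rho).
Local Notation N := (gauss rho).
Local Notation tau := (taylorr charK rho01 t_rho).
Local Notation "B ^`" := (map_mx (@lderiv _) B) (at level 2, format "B ^`").

Let rho_gt0 : 0 < rho. Proof. by case/andP: rho01. Qed.

Definition power_series (a : LW) := forall k : int, k < 0 -> a k = 0.

Definition converges (s : R) (a : LW) := converges_on s (fun n => a n%:Z).

Lemma power_seriesM_coef (a b : LW) (n : nat) : power_series a -> power_series b ->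
  (a * b) n%:Z = \sum_(i < n.+1) a i%:Z * b (n - i)%N%:Z.
Proof.
move=> a0 b0; have -> : n%:Z = 0 + 0 + n%:Z by rewrite !add0r.
by rewrite (lmulE _ a0 b0); apply: eq_bigr => i _; rewrite !add0r.
Qed.

Lemma power_seriesM (a b : LW) : power_series a -> power_series b -> power_series (a * b).
Proof. by move=> a0 b0 k k0; apply: (lmul_lt a0 b0). Qed.

Lemma power_series_eq0 (a : LW) : power_series a -> (forall n : nat, a n%:Z = 0) -> a = 0.
Proof. by move=> a0 an; apply: laurentP => -[n|n]; rewrite ?an ?a0. Qed.

Lemma power_series_sum (I : Type) (r : seq I) (P : pred I) (F : I -> LW) :
  (forall i, P i -> power_series (F i)) -> power_series (\sum_(i <- r | P i) F i).
Proof.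
move=> h; elim/big_ind: _ => // a b a0 b0 k k0.
by rewrite laddE a0 // b0 // addr0.
Qed.

Lemma lsumE (F : fieldType) (I : Type) (r : seq I) (P : pred I) (f : I -> laurent F) k :
  (\sum_(i <- r | P i) f i) k = \sum_(i <- r | P i) f i k.
Proof. exact: (big_morph (fun f : laurent F => f k)). Qed.

(** Boundedness at a radius v between u and s gives decay like (u / v)^n at u. Estimates can
    therefore be made with bounds alone. *)
Lemma convergesP s (a : LW) : converges s a <->
  forall u, 0 < u < s -> exists k, forall n : nat, vabs (a n%:Z) * u ^+ n <= k.
Proof.
split=> [h u us|h u /andP[u0 us]].
  have [k [_ kP]] := cvg_seq_bounded (cvgP _ (h u us)).
  exists (k + 1) => n; apply: le_trans (ler_norm _) _.
  by apply: kP; rewrite ?ltrDl.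
pose v := (u + s) / 2.
have [uv vs] : (u < v) * (v < s) by exact: midf_lt us.
have v0 : 0 < v := lt_trans u0 uv.
have [k kP] := h v (introT andP (conj v0 vs)).
apply: (@squeeze_cvgr _ _ _ _ (fun=> 0) (fun n => k * (u / v) ^+ n)).
- apply: nearW => n; rewrite mulr_ge0 ?vabs_ge0 ?exprn_ge0 ?(ltW u0) //=.
  rewrite expr_div_n mulrA ler_pdivlMr ?exprn_gt0 // mulrAC.
  by rewrite ler_wpM2r ?exprn_ge0 ?(ltW u0).
- exact: cvg_cst.
have -> : (0 : R) = k * 0 by rewrite mulr0.
apply: cvgMl_tmp; apply: cvg_expr.
have uv0 : 0 <= u / v by rewrite divr_ge0 // ltW.
by rewrite ger0_norm //; rewrite ltr_pdivrMr // mul1r.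
Qed.

Lemma tau_bound f u (n : nat) : 0 < u <= rho -> vabs (tau f n%:Z) * u ^+ n <= N f.
Proof.
move=> /andP[u0 ur].
have := vabs_taylor charK rho01 t_rho f n; rewrite -(taylorrE charK rho01 t_rho) => h.
apply: (@le_trans _ _ (rho^-1 ^+ n * N f * u ^+ n)).
  by rewrite ler_wpM2r // exprn_ge0 // ltW.
rewrite mulrAC -exprMn ler_piMl ?gauss_ge0 // exprn_ile1 //.
  by rewrite mulr_ge0 ?invr_ge0 ?ltW.
by rewrite mulrC ler_pdivrMr // mul1r.
Qed.

Lemma bound_mul (a b : LW) u k1 k2 : 0 < u -> power_series a -> power_series b ->
  (forall n : nat, vabs (a n%:Z) * u ^+ n <= k1) ->
  (forall n : nat, vabs (b n%:Z) * u ^+ n <= k2) ->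
  forall n : nat, vabs ((a * b) n%:Z) * u ^+ n <= k1 * k2.
Proof.
move=> u0 a0 b0 ha hb n.
have k1_ge0 : 0 <= k1 by apply: le_trans (ha 0%N); rewrite mulr1 vabs_ge0.
have k2_ge0 : 0 <= k2 by apply: le_trans (hb 0%N); rewrite mulr1 vabs_ge0.
rewrite power_seriesM_coef // -ler_pdivlMr ?exprn_gt0 //.
apply: vabs_sum => [|i _]; first by rewrite divr_ge0 ?mulr_ge0 ?exprn_ge0 // ltW.
have -> : u ^+ n = u ^+ i * u ^+ (n - i) by rewrite -exprD subnKC // leq_ord.
rewrite ler_pdivlMr ?mulr_gt0 ?exprn_gt0 // vabsM mulrACA.
by rewrite ler_pM ?mulr_ge0 ?vabs_ge0 ?exprn_ge0 ?(ltW u0).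
Qed.

Lemma bound_sum (I : Type) (r : seq I) (P : pred I) (f : I -> LW) u k : 0 < u -> 0 <= k ->
  (forall i, P i -> forall n : nat, vabs (f i n%:Z) * u ^+ n <= k) ->
  forall n : nat, vabs ((\sum_(i <- r | P i) f i) n%:Z) * u ^+ n <= k.
Proof.
move=> u0 k0 h n; rewrite lsumE -ler_pdivlMr ?exprn_gt0 //.
apply: vabs_sum => [|i Pi]; first by rewrite divr_ge0 ?exprn_ge0 // ltW.
by rewrite ler_pdivlMr ?exprn_gt0 // h.
Qed.

Lemma tau_power_series f : power_series (tau f).
Proof. by move=> k; exact: taylorr_lt. Qed.

Lemma converges_sum s (I : finType) (f : I -> LW) :
  (forall i, converges s (f i)) -> converges s (\sum_i f i).
Proof.
move=> h; apply/convergesP => u us; have u0 : 0 < u by case/andP: us.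
have /choice[k kP] i : exists k, forall n : nat, vabs (f i n%:Z) * u ^+ n <= k.
  by have /convergesP := h i; apply.
have k0 i : 0 <= k i by apply: le_trans (kP i 0%N); rewrite mulr1 vabs_ge0.
exists (\sum_i k i); apply: bound_sum => // [|i _ n]; first exact: sumr_ge0.
by apply: (le_trans (kP i n)); rewrite (bigD1 i) //= lerDl sumr_ge0.
Qed.

Lemma converges_mul_tau s a f : s <= rho -> power_series a -> converges s a ->
  converges s (a * tau f).
Proof.
move=> s_rho a0 /convergesP h; apply/convergesP => u us.
have [k kP] := h u us; have /andP[u0 us'] := us.
exists (k * N f); apply: bound_mul => //; first exact: tau_power_series.
by move=> n; apply: tau_bound; rewrite u0 (le_trans _ s_rho) // ltW.
Qed.

(** Constants of Omega as series, so that linear relations over Omega between sections become matrix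
    products over [laurent W]. *)
Definition lconst (c : W) : LW := pseries (fun n => if n is 0 then c else 0).

Lemma lconst_ps c : power_series (lconst c).
Proof. by move=> k; exact: pseries_lt. Qed.

Lemma lconstM c (a : LW) k : power_series a -> (lconst c * a) k = c * a k.
Proof.
move=> a0; case: k => n; last first.
  by rewrite (power_seriesM (lconst_ps c) a0) // a0 // mulr0.
rewrite power_seriesM_coef //; last exact: lconst_ps.
rewrite big_ord_recl subn0 /= big1 ?addr0 // => i _.
by rewrite /= mul0r.
Qed.

Lemma lderiv_lconst c : lderiv (lconst c) = 0.
Proof.
apply: laurentP => k; rewrite lderivE lzeroE.
case: k => [n|[|n]]; last by rewrite pseries_lt ?mul0rz //; clear; lia.
  have -> : Posz n + 1 = n.+1%:Z by clear; lia.
  by rewrite /= mul0rz.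
by rewrite mulr0z.
Qed.

(* Sections are row vectors: row j of A holds the coordinates of the derivative of
   the j-th basis vector. *)
Definition solutions n (A : 'M[L]_n) (s : R) (m : nat) :=
  exists Y : 'M[LW]_(m, n),
    [/\ forall i j, power_series (Y i j), forall i j, converges s (Y i j),
        Y^` + Y *m map_mx tau A = 0 &
        forall c : 'rV[W]_m, map_mx lconst c *m Y = 0 -> c = 0].

(** Sections are multiplied on the right by the expansion of G, which converges on the disk because
    [s <= rho]; it is invertible, so linear independence is kept. *)
Lemma solutions_gauge n (A A0 G : 'M[L]_n) s m : s <= rho -> G \in unitmx ->
  G^` + G *m A0 = A *m G -> solutions A s m -> solutions A0 s m.
Proof.
move=> s_rho Gu GE [Y [Yps Ycv YE Yfree]].
exists (Y *m map_mx tau G); split.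
- move=> i j; rewrite mxE; apply: power_series_sum => k _; rewrite mxE.
  by apply: power_seriesM => //; exact: tau_power_series.
- move=> i j; rewrite mxE; apply: converges_sum => k; rewrite mxE.
  exact: converges_mul_tau.
- have tG : (map_mx tau G)^` = map_mx tau G^`.
    by apply/matrixP => i j; rewrite !mxE taylorr_lderiv.
  rewrite mx_lderivM tG -addrA -!mulmxA -map_mxM -mulmxDr -map_mxD GE map_mxM.
  by rewrite mulmxA -mulmxDl YE mul0mx.
move=> c; rewrite mulmxA => h; apply: Yfree.
have tGu : map_mx tau G \in unitmx by rewrite map_unitmx.
by rewrite -[LHS](mulmxK tGu) h mul0mx.
Qed.

Lemma gauge_inv n (A A0 G : 'M[L]_n) : G \in unitmx -> G^` + G *m A0 = A *m G ->
  (invmx G)^` + invmx G *m A = A0 *m invmx G.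
Proof.
move=> Gu GE; have h := congr1 (map_mx (@lderiv K)) (mulVmx Gu).
rewrite mx_lderivM mx_lderiv1 in h.
apply: (can_inj (mulmxK Gu)); rewrite mulmxDl -!mulmxA mulVmx // mulmx1 -GE.
by rewrite mulmxDr addrA h add0r mulmxA mulVmx // mul1mx.
Qed.

Lemma solutions_gaugeE n (A A0 G : 'M[L]_n) s m : s <= rho -> G \in unitmx ->
  G^` + G *m A0 = A *m G -> solutions A s m <-> solutions A0 s m.
Proof.
move=> s_rho Gu GE; split; first exact: solutions_gauge GE.
apply: (solutions_gauge s_rho _ (gauge_inv Gu GE)); first by rewrite unitmx_inv.
Qed.

(** A horizontal section is determined by its value at t: the equation gives (k + 1) times the next
    coefficient from the previous ones, and characteristic 0 allows the division. *)
Lemma solution_init n (A : 'M[L]_n) (z : 'rV[LW]_n) :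
  (forall j, power_series (z 0 j)) -> z^` + z *m map_mx tau A = 0 ->
  (forall j, z 0 j 0 = 0) -> z = 0.
Proof.
move=> zps zE z0.
have zn (k : nat) j : z 0 j k%:Z = 0.
  elim/ltn_ind: k j => -[|k] IH j; first exact: z0.
  have := congr1 (fun M : 'rV[LW]_n => M 0 j k%:Z) zE.
  rewrite !mxE laddE lsumE big1 ?addr0 => [|i _].
    rewrite lderivE; have -> : k%:Z + 1 = k.+1%:Z by clear; lia.
    move/eqP; rewrite -pmulrn -mulr_natr mulf_eq0 orbC.
    by rewrite (negPf (natrW_neq0 V charK _)) // => /eqP.
  rewrite !mxE power_seriesM_coef //; last exact: tau_power_series.
  by rewrite big1 // => l _; rewrite IH ?mul0r.
apply/matrixP => i j; rewrite (ord1 i) [RHS]mxE.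
exact: power_series_eq0.
Qed.

Section Count.
Variables (n : nat) (A B : 'M[L]_n) (th c : 'I_n -> R) (s : R).
Hypotheses (nfA : nf rho A B th c) (s_gt0 : 0 < s) (s_rho : s <= rho).

Let rho_s : rho^-1 <= s^-1. Proof. by rewrite lef_pV2. Qed.

(** [nf] gives the inverse relation on rows of positive slope. It extends to columns of positive
    slope, since an entry between two different blocks is 0. *)
Lemma nf_inv_col i j : rho^-1 < th j -> (A *m B) i j = (i == j)%:R.
Proof.
move=> tj; have [c0 blk hA hB hAB] := nfA.
have [ti|ti] := ltP (rho^-1) (th i); first exact: (hAB i j ti).1.
have tij : th i != th j by rewrite lt_eqF // (le_lt_trans ti).
rewrite mxE [i == j](_ : _ = false); last by apply: contraNF tij => /eqP->.
apply: big1 => k _; have [->|Ak] := eqVneq (A i k) 0; first by rewrite mul0r.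
have [->|Bk] := eqVneq (B k j) 0; first by rewrite mulr0.
by move: tij; rewrite (blk i k) ?Ak; [rewrite (blk k j) ?eqxx //; right | left].
Qed.

(* On the block of j0 one has y = - y' B, and there f |-> f' B has norm
   < 1 on a disk of radius u with th j0 > u^-1. *)
Lemma solution_vanish (y : 'rV[LW]_n) j0 :
  (forall j, power_series (y 0 j)) -> (forall j, converges s (y 0 j)) ->
  y^` + y *m map_mx tau A = 0 -> s^-1 < th j0 -> y 0 j0 = 0.
Proof.
move=> yps ycv yE sj0; have [c0 blk hA hB hAB] := nfA.
set T := th j0 in sj0.
have T0 : 0 < T by apply: lt_trans sj0; rewrite invr_gt0.
have Ts : T^-1 < s by rewrite -[s]invrK ltf_pV2 ?posrE ?invr_gt0.
(* The section is controlled only below s, while contraction requires u T > 1; the hypothesis leaves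
   room for such a u. *)
pose u := (T^-1 + s) / 2.
have [Tu us] : (T^-1 < u) * (u < s) by exact: midf_lt Ts.
have u0 : 0 < u by apply: lt_trans Tu; rewrite invr_gt0.
have uT : (u * T)^-1 < 1.
  have uT0 : 0 < u * T by exact: mulr_gt0.
  by rewrite invf_lt1 // -ltr_pdivrMr // mul1r.
have e01 : 0 <= (u * T)^-1 < 1 by rewrite uT andbT invr_ge0 ltW // mulr_gt0.
have yB j : th j = T -> y 0 j = - \sum_(l | th l == T) y^` 0 l * tau (B l j).
  move=> tj; have : y^` *m map_mx tau B = - (y *m map_mx tau (A *m B)).
    move/eqP: yE; rewrite addr_eq0 => /eqP ->.
    by rewrite map_mxM mulNmx mulmxA.
  move/(congr1 (fun M : 'rV[LW]_n => M 0 j)); rewrite !mxE.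
  rewrite [in RHS](bigD1 j) //= [X in _ = - (_ + X)]big1 => [|i ij]; last first.
    rewrite mxE nf_inv_col ?tj ?(le_lt_trans rho_s) // (negPf ij).
    by rewrite rmorph0 mulr0.
  rewrite [X in _ = - (_ * X + _)]mxE nf_inv_col ?tj ?(le_lt_trans rho_s) // eqxx rmorph1 mulr1 addr0.
  move=> h; rewrite -[LHS]opprK -h; congr (- _).
  rewrite (bigID (fun l => th l == T)) /= [X in _ + X]big1 ?addr0.
    by apply: eq_bigr => l _; rewrite !mxE.
  move=> l lT; rewrite [X in _ * X]mxE [B l j](_ : _ = 0) ?rmorph0 ?mulr0 //.
  by apply/eqP; apply: contraNT lT => Bl; rewrite -tj (blk l j) //; right.
pose bd k := forall j, th j = T -> forall m : nat, vabs (y 0 j m%:Z) * u ^+ m <= k / c j.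
(* The derivative costs [u^-1], as integers m + 1 have norm 1, and the entries of B cost [T^-1]. *)
have contr k : bd k -> bd ((u * T)^-1 * k).
  move=> hk j tj; rewrite yB //.
  have k_ge0 : 0 <= k / c j by apply: le_trans (hk j tj 0%N); rewrite mulr1 vabs_ge0.
  have goal_ge0 : 0 <= (u * T)^-1 * k / c j.
    by rewrite -mulrA mulr_ge0 //; case/andP: e01.
  move=> m; rewrite loppE vabsN; move: m; apply: bound_sum => // l /eqP tl.
  have der (m : nat) : vabs (y^` 0 l m%:Z) * u ^+ m <= u^-1 * (k / c l).
    rewrite mxE lderivE; have -> : m%:Z + 1 = m.+1%:Z by clear; lia.
    rewrite -pmulrn -mulr_natr vabsM vabsn // mulr1 ler_pdivlMl //.
    by rewrite mulrC -mulrA -exprSr hk.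
  have Bb (m : nat) : vabs (tau (B l j) m%:Z) * u ^+ m <= T^-1 * c l / c j.
    apply: (@le_trans _ _ (N (B l j))).
      by apply: tau_bound; rewrite u0 ltW // (lt_le_trans us).
    by rewrite ler_pdivlMr // -tl.
  have -> : (u * T)^-1 * k / c j = (u^-1 * (k / c l)) * (T^-1 * c l / c j).
        by field; rewrite !gt_eqF.
  apply: bound_mul => //; last exact: tau_power_series.
  move=> k' k'0; rewrite mxE lderivE.
  have [k1|k1] := ltP (k' + 1) 0; first by rewrite yps ?mul0rz.
  have -> : k' + 1 = 0 by move: k1 k'0; clear; lia.
  by rewrite mulr0z.
have [k0 hk0] : exists k, bd k.
  have /choice[k kP] j : exists k, forall m : nat, vabs (y 0 j m%:Z) * u ^+ m <= k.
    have /convergesP := ycv j; apply; by rewrite u0.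
  have k_ge0 j : 0 <= k j by apply: le_trans (kP j 0%N); rewrite mulr1 vabs_ge0.
  exists (\sum_j k j * c j) => j _ m; rewrite ler_pdivlMr //.
  apply: (@le_trans _ _ (k j * c j)); first by rewrite ler_wpM2r // ltW.
  by rewrite (bigD1 j) //= lerDl sumr_ge0 // => i _; rewrite mulr_ge0 // ltW.
have iterk e : bd (k0 * (u * T)^-1 ^+ e).
  by elim: e => [|e /contr]; rewrite ?mulr1 // exprS mulrCA.
apply: power_series_eq0 => // m; apply/eqP/negPn/negP => /vabs_gt0 h.
have hpos : 0 < vabs (y 0 j0 m%:Z) * u ^+ m * c j0 by rewrite !mulr_gt0 ?exprn_gt0.
have [e] := geometric_small k0 e01 hpos.
by rewrite ltNge -ler_pdivlMr // iterk.
Qed.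

(** The coefficients follow from the recursion starting at the vector [j0]. They stay in the block
    of [j0] and keep the bound [|y_k,j| s^k c_j <= c_j0]: one step costs [th j0 * s <= 1], and the
    division by k + 1 is isometric. *)
Lemma solution_exists j0 : th j0 <= s^-1 -> exists z : 'rV[LW]_n,
  [/\ forall j, power_series (z 0 j), forall j, converges s (z 0 j),
      z^` + z *m map_mx tau A = 0 & forall j, z 0 j 0 = (j == j0)%:R].
Proof.
move=> tj0; have [c0 blk hA hB hAB] := nfA.
pose T (i : nat) := \matrix_(a, b) tau (A a b) i%:Z : 'M[W]_n.
(* [sq] lists all previous coefficients, so its size is the order of the one being computed; the
   formula is the part of degree k of y' + y A = 0. *)
pose F (sq : seq 'rV[W]_n) : 'rV[W]_n := if size sq is k.+1 then
   - (k.+1%:R^-1 *: \sum_(i < k.+1) sq`_(k - i) *m T i) else delta_mx 0 j0.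
have [y yE] := strong_rec F.
have y0 : y 0%N = delta_mx 0 j0 by rewrite yE.
have yS k : y k.+1 = - (k.+1%:R^-1 *: \sum_(i < k.+1) y (k - i)%N *m T i).
  rewrite yE /F size_mkseq; congr (- (_ *: _)); apply: eq_bigr => i _.
  by rewrite nth_mkseq // ltnS leq_subr.
have yb k j : (y k 0 j != 0 -> th j = th j0) /\ vabs (y k 0 j) * s ^+ k * c j <= c j0.
  elim/ltn_ind: k j => -[|k] IH j.
    rewrite y0 mxE eqxx /=; have [->|_] := eqVneq j j0.
      by rewrite vabs1 !mul1r.
    by rewrite vabs0 !mul0r eqxx; split => //; rewrite ltW.
  have termE (i : 'I_k.+1) l : (y (k - i)%N 0 l * T i l j != 0 -> th j = th j0) /\
      vabs (y (k - i)%N 0 l * T i l j) * s ^+ k.+1 * c j <= c j0.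
    have [yz|yn] := eqVneq (y (k - i)%N 0 l) 0.
      by rewrite yz mul0r eqxx vabs0 !mul0r; split => //; exact/ltW.
    have [] := IH (k - i)%N _ l; first by rewrite ltnS leq_subr.
    move=> /(_ yn) tl yl; rewrite mxE.
    have [Az|An] := eqVneq (A l j) 0.
      rewrite Az rmorph0 lzeroE mulr0 eqxx vabs0 !mul0r.
      by split => //; exact/ltW.
    split => [_|]; first by rewrite -(blk l j) //; left.
    have tb := tau_bound (A l j) i (introT andP (conj s_gt0 s_rho)).
    have sE : s ^+ k = s ^+ (k - i) * s ^+ i by rewrite -exprD subnK // leq_ord.
    rewrite vabsM exprS sE.
    have -> : vabs (y (k - i)%N 0 l) * vabs (tau (A l j) i%:Z) * (s * (s ^+ (k - i) * s ^+ i)) * c j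
       = (vabs (y (k - i)%N 0 l) * s ^+ (k - i)) * (vabs (tau (A l j) i%:Z) * s ^+ i * c j) * s.
      by ring.
    apply: (@le_trans _ _ (vabs (y (k - i)%N 0 l) * s ^+ (k - i) * (th l * c l) * s)).
      rewrite ler_wpM2r ?(ltW s_gt0) // ler_wpM2l ?mulr_ge0 ?vabs_ge0 ?exprn_ge0 ?(ltW s_gt0) //.
      by apply: le_trans (hA l j); rewrite ler_pM2r.
    rewrite tl [_ * c l]mulrC mulrA -mulrA -[leRHS]mulr1.
    apply: ler_pM => //.
    - by rewrite !mulr_ge0 ?vabs_ge0 ?exprn_ge0 // ltW.
    - rewrite mulr_ge0 ?(ltW s_gt0) // -tl -(pmulr_lge0 _ (c0 l)).
      by apply: le_trans (hA l l); rewrite mulr_ge0 ?gauss_ge0 // ltW.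
    - by rewrite -ler_pdivlMr // mul1r.
  have yE' : y k.+1 0 j = - (k.+1%:R^-1 * \sum_(i < k.+1) \sum_l y (k - i)%N 0 l * T i l j).
    rewrite yS !mxE summxE; congr (- (_ * _)); apply: eq_bigr => i _.
    by rewrite mxE.
  split.
    apply: contraNeq => tj; rewrite yE' big1 ?mulr0 ?oppr0 // => i _.
    apply: big1 => l _; apply/eqP; apply: contraNT tj => /(termE i l).1 ->.
    by [].
  rewrite yE' vabsN vabsM vabsV vabsn // invr1 mul1r -mulrA -ler_pdivlMr; last first.
    by rewrite mulr_gt0 ?exprn_gt0.
  have cpos : 0 <= c j0 / (s ^+ k.+1 * c j).
    by rewrite divr_ge0 ?mulr_ge0 ?exprn_ge0 ?(ltW s_gt0) ?(ltW (c0 _)).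
  apply: vabs_sum => // i _; apply: vabs_sum => // l _.
  rewrite ler_pdivlMr ?mulr_gt0 ?exprn_gt0 // mulrA.
  exact: (termE i l).2.
pose z : 'rV[LW]_n := \row_j pseries (fun k => y k 0 j).
have zps j : power_series (z 0 j) by move=> k; rewrite mxE; exact: pseries_lt.
exists z; split => //.
- move=> j; apply/convergesP => u /andP[u0 us]; exists (c j0 / c j) => k.
  rewrite mxE /= ler_pdivlMr //; apply: le_trans (yb k j).2.
  rewrite ler_pM2r // ler_wpM2l ?vabs_ge0 // lerXn2r ?nnegrE ?(ltW u0) ?(ltW s_gt0) //.
  exact: ltW.
- apply/matrixP => i j; rewrite (ord1 i) {i} [RHS]mxE; apply: laurentP => -[k|k].
    rewrite mxE laddE [z^` _ _]mxE lderivE; have -> : k%:Z + 1 = k.+1%:Z by clear; lia.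
    rewrite -pmulrn -mulr_natr mxE /= yS !mxE mulNr mulrAC mulVf ?mul1r; last first.
      exact: (natrW_neq0 V charK).
    rewrite lsumE; apply/eqP; rewrite addrC subr_eq0; apply/eqP.
    rewrite summxE; under [RHS]eq_bigr do rewrite mxE.
    rewrite exchange_big; apply: eq_bigr => l _.
    rewrite [map_mx _ _ _ _]mxE mulrC power_seriesM_coef //; last exact: tau_power_series.
    by apply: eq_bigr => i _; rewrite !mxE /= mulrC.
  rewrite mxE laddE lzeroE [z^` _ _]mxE lderivE.
  have ps : power_series (\sum_l z 0 l * map_mx tau A l j).
    apply: power_series_sum => l _; apply: power_seriesM => //.
    by rewrite mxE; exact: tau_power_series.
  rewrite [(z *m _) _ _]mxE ps //.
  rewrite addr0; case: k => [|k]; first by rewrite mulr0z.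
  by rewrite zps ?mul0rz.
by move=> j; rewrite mxE /= y0 mxE.
Qed.

(** Upper bound: the values at t of independent sections are independent by [solution_init], and
    their coordinates outside J vanish by [solution_vanish], so their matrix factors through a space
    of dimension #|J|. Lower bound: [solution_exists] prescribes as values at t the basis vectors
    indexed by J. *)
Theorem nf_solutions m :
  solutions A s m <-> (m <= #|[pred i | (th i <= s^-1)%R]|)%N.
Proof.
set J := [pred i | _]; split=> [[Y [Yps Ycv YE Yfree]]|mJ].
  pose v := \matrix_(i, j) Y i j 0 : 'M[W]_(m, n).
  have rowY (c' : 'rV[W]_m) : let z := map_mx lconst c' *m Y in
      (forall j, power_series (z 0 j)) /\ z^` + z *m map_mx tau A = 0.
    split=> [j|].
      rewrite mxE; apply: power_series_sum => k _; apply: power_seriesM => //.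
      rewrite mxE; exact: lconst_ps.
    rewrite mx_lderivM (_ : (map_mx lconst c')^` = 0); last first.
      by apply/matrixP => i j; rewrite !mxE lderiv_lconst.
    by rewrite mul0mx add0r -mulmxA -mulmxDr YE mulmx0.
  have vfree : row_free v.
    rewrite -kermx_eq0; apply/eqP/row_matrixP => i; rewrite row0.
    apply: Yfree; have [zps zE] := rowY (row i (kermx v)).
    apply: solution_init zps zE _ => j; rewrite mxE lsumE.
    transitivity ((kermx v *m v) i j); last by rewrite mulmx_ker mxE.
    rewrite [RHS]mxE; apply: eq_bigr => k _.
    by rewrite [map_mx _ _ _ _]mxE lconstM // !mxE.
  have v0 i j : j \notin J -> v i j = 0.
    rewrite inE -ltNge => tj.
    have : row i Y 0 j = 0.
      apply: solution_vanish tj => [k|k|]; rewrite ?mxE //.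
      by rewrite -row_mul map_row -linearD YE linear0.
    by rewrite !mxE => ->.
  have vE : v = (\matrix_(i < m, k < #|J|) v i (enum_val k)) *m
                \matrix_(k < #|J|, j < n) (enum_val k == j)%:R.
    apply/matrixP => i j; rewrite [RHS]mxE.
    have [jJ|jJ] := boolP (j \in J); last first.
      rewrite v0 // big1 // => k _; rewrite !mxE.
      case: eqP => [kj|_]; last by rewrite mulr0.
      by move: (enum_valP k); rewrite kj (negPf jJ).
    rewrite (bigD1 (enum_rank_in jJ j)) //= big1 ?addr0 => [|k kj].
      by rewrite !mxE enum_rankK_in // eqxx mulr1.
    rewrite !mxE; case: eqP => [kE|_]; last by rewrite mulr0.
    by case/eqP: kj; apply: enum_val_inj; rewrite enum_rankK_in.
  rewrite -[m](eqP vfree) vE; apply: leq_trans (mxrankM_maxr _ _) _.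
  exact: rank_leq_row.
pose jj (l : 'I_m) := enum_val (widen_ord mJ l).
have jjJ l : th (jj l) <= s^-1 by move: (enum_valP (widen_ord mJ l)).
have /choice[z zP] l := solution_exists (jjJ l).
exists (\matrix_l z l); split.
- by move=> i j; rewrite mxE; case: (zP i).
- by move=> i j; rewrite mxE; case: (zP i).
- apply/row_matrixP => i; rewrite row0 linearD /= row_mul -map_row rowK.
  by case: (zP i).
move=> c' cz; apply/matrixP => i l; rewrite (ord1 i) mxE.
have := congr1 (fun M : 'rV[LW]_n => M 0 (jj l) 0) cz; rewrite !mxE lsumE (bigD1 l) //.
have psz l' j : power_series ((\matrix_l z l) l' j) by rewrite mxE; case: (zP l').
rewrite big1 ?addr0 => [|l' ll'].
  rewrite [map_mx _ _ _ _]mxE lconstM // mxE; case: (zP l) => _ _ _ ->.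
  by rewrite /= addr0 eqxx mulr1.
rewrite [map_mx _ _ _ _]mxE lconstM // mxE; case: (zP l') => _ _ _ ->.
rewrite (inj_eq enum_val_inj) -(inj_eq val_inj) /= eq_sym.
by rewrite -(inj_eq val_inj) in ll'; rewrite (negPf ll') mulr0.
Qed.

End Count.
End HorizontalSections.

(** * The Newton polygon *)

Section Polygon.
Variable R : realType.
Implicit Types (nz : pred nat) (c mu : nat -> R).

(** Minus the height of the polygon at k, normalized to be 0 at the right end n. *)
Definition slope_sum n mu k : R := \sum_(k <= i < n) mu i.+1.

(* mu 1 <= ... <= mu n are the slopes of the convex hull of the quadrants with
   corners (k, c k), for k <= n such that nz k; mu 0 = 0 stands for the slope
   at -oo. *)
Definition polygon n nz c mu :=
  [/\ mu 0%N = 0,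
      forall i, (i < n)%N -> mu i <= mu i.+1,
      forall k, (k <= n)%N -> nz k -> - slope_sum n mu k <= c k &
      forall k, (k < n)%N -> mu k < mu k.+1 -> nz k /\ c k = - slope_sum n mu k].

Lemma slope_sumS n mu k : (k < n)%N -> slope_sum n mu k = mu k.+1 + slope_sum n mu k.+1.
Proof. by move=> kn; rewrite /slope_sum big_ltn. Qed.

Lemma slope_sumn n mu : slope_sum n mu n = 0.
Proof. by rewrite /slope_sum big_geq. Qed.

Lemma slope_sum_cat n mu j k : (j <= k <= n)%N ->
  slope_sum n mu j = \sum_(j <= i < k) mu i.+1 + slope_sum n mu k.
Proof. by move=> /andP[jk kn]; rewrite /slope_sum (big_cat_nat jk kn). Qed.

Lemma sum_nat_le (F : nat -> R) (a : R) j k :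
  (forall i, (j <= i < k)%N -> F i <= a) -> \sum_(j <= i < k) F i <= (k - j)%N%:R * a.
Proof.
move=> Fa; have -> : (k - j)%N%:R * a = \sum_(j <= i < k) a.
  by rewrite sumr_const_nat mulr_natl.
by rewrite !big_nat; apply: ler_sum.
Qed.

Lemma sum_nat_ge (F : nat -> R) (a : R) j k :
  (forall i, (j <= i < k)%N -> a <= F i) -> (k - j)%N%:R * a <= \sum_(j <= i < k) F i.
Proof.
move=> Fa; have -> : (k - j)%N%:R * a = \sum_(j <= i < k) a.
  by rewrite sumr_const_nat mulr_natl.
by rewrite !big_nat; apply: ler_sum.
Qed.

Section Facts.
Variables (n : nat) (nz : pred nat) (c mu : nat -> R).
Hypothesis P : polygon n nz c mu.

Lemma polygon_mono i j : (i <= j <= n)%N -> mu i <= mu j.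
Proof.
have [_ h _ _] := P; case/andP; elim: j => [|j IH]; first by rewrite leqn0 => /eqP->.
rewrite leq_eqVlt => /orP[/eqP->//|ij jn]; apply: (le_trans (IH ij (ltnW jn))).
exact: h.
Qed.

Lemma polygon_ge0 i : (i <= n)%N -> 0 <= mu i.
Proof. by have [<- _ _ _] := P => h; apply: polygon_mono. Qed.

Lemma slope_sum_le k : (k <= n)%N -> slope_sum n mu k <= (n - k)%N%:R * mu n.
Proof.
move=> kn; apply: sum_nat_le => i /andP[ki i_n]; apply: polygon_mono.
by rewrite i_n leqnn.
Qed.

(** The corner is the left end of the last edge; it exists because the slope starts at [mu 0 = 0]
    and has to jump to [mu n]. *)
Lemma polygon_top_vertex : 0 < mu n ->
  exists k, [/\ (k < n)%N, nz k & c k = - ((n - k)%N%:R * mu n)].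
Proof.
move=> mun; have [mu0 _ _ veq] := P.
have ex : exists k, (k <= n)%N && (mu k == mu n) by exists n; rewrite leqnn eqxx.
have [[|k] /andP[kn /eqP mk] kmin] := ex_minnP ex.
  by move: mun; rewrite -mk mu0 ltxx.
have jump : mu k < mu k.+1.
  rewrite lt_neqAle polygon_mono ?leqnSn //= andbT; apply/negP => /eqP h.
  by have := kmin k; rewrite (ltnW kn) h mk eqxx => /(_ isT); rewrite ltnn.
have [nzk ck] := veq k kn jump; exists k; split => //; rewrite ck; congr (- _).
apply/eqP; rewrite eq_le slope_sum_le ?(ltnW kn) //=.
apply: sum_nat_ge => i /andP[ki i_n]; rewrite -mk; apply: polygon_mono.
by rewrite ltnS ki.
Qed.

(** The nearest vertex at or after k: a change of slope before it would itself be a vertex. *)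
Lemma polygon_vertex_right k : (k <= n)%N -> nz n -> c n = 0 ->
  exists j, [/\ (k <= j <= n)%N, nz j, c j = - slope_sum n mu j &
    forall i, (k <= i < j)%N -> mu i = mu i.+1].
Proof.
move=> kn nzn cn; have [mu0 mumono _ veq] := P.
pose vert j := [&& (k <= j)%N, nz j & c j == - slope_sum n mu j].
have ex : exists j, vert j by exists n; rewrite /vert kn nzn cn slope_sumn oppr0 eqxx.
have [j /and3P[kj nzj /eqP cj] jmin] := ex_minnP ex.
have jn : (j <= n)%N by apply: jmin; rewrite /vert kn nzn cn slope_sumn oppr0 eqxx.
exists j; split; rewrite ?kj ?jn // => i /andP[ki ij]; apply/eqP; rewrite eq_le.
have i_n : (i < n)%N := leq_trans ij jn.
rewrite mumono //= leNgt; apply/negP => /(veq i i_n) [nzi ci].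
by have := jmin i; rewrite /vert ki nzi ci eqxx leqNgt ij => /(_ isT).
Qed.

Lemma polygon_vertex_left k : (k <= n)%N ->
  (forall i, (i < k)%N -> mu i = mu i.+1) \/
  exists j, [/\ (j < k)%N, nz j, c j = - slope_sum n mu j &
    forall i, (j < i < k)%N -> mu i = mu i.+1].
Proof.
move=> kn; have [mu0 mumono _ veq] := P.
elim: k kn => [|k IH] kn; first by left.
have [jump|] := ltP (mu k) (mu k.+1).
  have [nzk ck] := veq k kn jump; right; exists k; split => // i.
  by rewrite ltnS => /andP[h1 h2]; move: h1; rewrite ltnNge h2.
move=> le; have {le} mk : mu k = mu k.+1 by apply/eqP; rewrite eq_le le mumono.
case: (IH (ltnW kn)) => [h|[j [jk nzj cj h]]].
  by left => i; rewrite ltnS leq_eqVlt => /orP[/eqP->//|]; exact: h.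
right; exists j; split => //; first by rewrite ltnS ltnW.
move=> i /andP[ji]; rewrite ltnS leq_eqVlt => /orP[/eqP->//|ik].
by apply: h; rewrite ji.
Qed.

Lemma slope_sum_vertex0 : nz n -> c n = 0 -> exists j,
  [/\ (j <= n)%N, nz j & c j = - slope_sum n mu 0].
Proof.
move=> nzn cn; have [j [/andP[_ jn] nzj cj flat]] := polygon_vertex_right (leq0n n) nzn cn.
exists j; split => //; rewrite cj; congr (- _).
rewrite (@slope_sum_cat n mu 0 j) //= big_nat big1 ?add0r // => i /andP[_ ij].
have mu0 k : (k <= j)%N -> mu k = 0.
  elim: k => [|k IHk] kj; first by case: P.
  by rewrite -flat // IHk // ltnW.
exact: mu0.
Qed.

End Facts.

(** Built from the right: among the corners below level [c n], the steepest chord to n gives the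
    last edge, and induction gives the polygon up to its left end [k0]. If no corner is lower than
    the last one, all slopes are 0. *)
Lemma polygon_exists n nz c : nz n -> exists mu, polygon n nz (fun k => c k - c n) mu.
Proof.
elim/ltn_ind: n => n IH nzn.
have [flat|] := pselect (forall k, (k < n)%N -> nz k -> c n <= c k).
  have S0 k : slope_sum n (fun=> 0 : R) k = 0 by rewrite /slope_sum big1.
  exists (fun=> 0); split => // [k|k _]; last by rewrite ltxx.
  rewrite S0 oppr0 subr_ge0 leq_eqVlt => /orP[/eqP->//|kn nzk]; exact: flat.
move=> /existsNP[k1 /not_implyP[k1n /not_implyP[nzk1 /negP]]]; rewrite -ltNge => ck1.
pose f (k : nat) : R := (c n - c k) / (n - k)%N%:R.
have nkpos k : (k < n)%N -> 0 < (n - k)%N%:R :> R by rewrite ltr0n subn_gt0.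
have fk1 : 0 < f k1 by rewrite divr_gt0 ?subr_gt0 ?nkpos.
have [m nzm fmax] : exists2 m : 'I_n, nz m & forall k : 'I_n, nz k -> f k <= f m.
  have := @arg_maxP _ _ _ (Ordinal k1n) (fun k : 'I_n => nz k) (fun k : 'I_n => f k) nzk1.
  by case=> m nzm fm; exists m.
set a := f m in fmax.
have a0 : 0 < a by apply: (lt_le_trans fk1); exact: (fmax (Ordinal k1n)).
have ex : exists k, [&& (k < n)%N, nz k & f k == a] by exists m; rewrite ltn_ord nzm eqxx.
have [k0 /and3P[k0n nzk0 /eqP fk0] k0min] := ex_minnP ex.
have ck k : (k < n)%N -> nz k -> c n - c k <= (n - k)%N%:R * a.
  move=> kn nzk; rewrite mulrC -ler_pdivrMr ?nkpos //; exact: (fmax (Ordinal kn)).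
have ck0 : c n - c k0 = (n - k0)%N%:R * a.
  by rewrite -fk0 /f mulrC divfK // gt_eqF // nkpos.
have [mu' P'] := IH k0 k0n nzk0.
have [mu'0 mono' low' eq'] := P'.
pose mu i := if (i <= k0)%N then mu' i else a.
have Sge k : (k0 <= k <= n)%N -> slope_sum n mu k = (n - k)%N%:R * a.
  move=> /andP[kk kn]; rewrite /slope_sum big_nat (eq_bigr (fun=> a)) => [|i /andP[ki _]].
    by rewrite -big_nat sumr_const_nat mulr_natl.
  by rewrite /mu ltnNge (leq_trans kk).
have Sle k : (k <= k0)%N -> slope_sum n mu k = slope_sum k0 mu' k + (n - k0)%N%:R * a.
  move=> kk; rewrite (@slope_sum_cat n mu k k0) ?kk ?(ltnW k0n) // Sge ?leqnn ?(ltnW k0n) //.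
  by congr (_ + _); rewrite /slope_sum !big_nat; apply: eq_bigr => i /andP[_ ik]; rewrite /mu ik.
(* Were the last edge on the left steeper than a, the corner where it starts would have a chord to n
   steeper than a. *)
have mu'a : mu' k0 <= a.
  rewrite leNgt; apply/negP => h.
  have [k [kk nzk cke]] := polygon_top_vertex P' (lt_trans a0 h).
  have := ck k (ltn_trans kk k0n) nzk; rewrite leNgt => /negP; apply.
  have -> : (n - k)%N%:R = (n - k0)%N%:R + (k0 - k)%N%:R :> R.
    by rewrite -natrD; congr _%:R; move: kk k0n; clear; lia.
  have : (k0 - k)%N%:R * a < (k0 - k)%N%:R * mu' k0 by rewrite ltr_pM2l // ltr0n subn_gt0.
  by rewrite mulrDl -ck0; move: cke; move: (_ * mu' k0) (_ * a) => x y; lra.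
exists mu; split.
- by rewrite /mu leq0n.
- move=> i i_n; rewrite /mu; case: ltngtP => [ik|ik|->].
  + by apply: mono'.
  + by [].
  + by [].
- move=> k kn nzk; have [kk|kk] := leqP k k0.
    have := low' k kk nzk; rewrite Sle // -ck0.
    move: (slope_sum _ _ _) => S; lra.
  rewrite Sge ?(ltnW kk) //; move: kn; rewrite leq_eqVlt => /orP[/eqP->|kn].
    by rewrite subnn mul0r oppr0 subrr.
  by have := ck k kn nzk; move: (_ * a) => S; lra.
move=> k kn; rewrite {1 2}/mu; case: ltngtP => [kk jump|kk|->].
- have [nzk cke] := eq' k kk jump; split => //; rewrite Sle 1?ltnW // -ck0.
  by move: cke; move: (slope_sum _ _ _) => S; lra.
- by rewrite ltxx.
by move=> _; split => //; rewrite Sge ?leqnn ?(ltnW k0n) // -ck0 opprB.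
Qed.

End Polygon.

(** * The Newton polygon of an operator *)

Section NewtonPolygon.
Variables (R : realType) (K : fieldType).
Local Notation L := (laurent K).
Variables (P : {poly L}) (r : nat) (mu : nat -> R).
Hypotheses (Pmonic : P \is monic) (sizeP : size P = r.+1).

Definition corner (k : nat) : R := (lval P`_k)%:~R + r%:R - k%:R.

Let orderP : op_order P = r. Proof. by rewrite /op_order sizeP. Qed.

Lemma lval1 : lval (1 : L) = 0.
Proof.
apply: lval_eq => [|k k0]; rewrite loneE ?eqxx ?oner_eq0 //.
by case: eqP k0 => // ->.
Qed.

Lemma lead_coefr : P`_r = 1.
Proof. by move/monicP: Pmonic; rewrite lead_coefE sizeP. Qed.

Lemma corner_r : corner r = 0.
Proof. by rewrite /corner lead_coefr lval1 add0r subrr. Qed.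

Lemma nz_r : P`_r != 0. Proof. by rewrite lead_coefr oner_eq0. Qed.

Hypothesis mu_poly : polygon r (fun k => P`_k != 0) corner mu.

Let S := slope_sum r mu.

(** The half-plane above the line of slope [mu k] through the point of abscissa k is convex. It
    contains every quadrant, since the corners lie above the line by monotonicity of the slopes and
    quadrants extend to the left, where a line of slope [mu k >= 0] descends. *)
Lemma hull_ge (z : R^o * R^o) k : (k <= r)%N -> newton_polygon P z ->
  mu k * (z.1 - k%:R) - S k <= z.2.
Proof.
move=> kr; rewrite /newton_polygon.
apply: (@smallest_sub _ _ _ [set z : (R * R)%type | mu k * (z.1 - k%:R) - S k <= z.2]).
  move=> x y l; rewrite !inE /= => hx hy.
  change (mu k * (l%:inum * x.1 + (1 - l%:inum) * y.1 - k%:R) - S k <=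
      l%:inum * x.2 + (1 - l%:inum) * y.2).
  have l0 : 0 <= l%:inum by [].
  have l1 : 0 <= 1 - l%:inum by rewrite subr_ge0.
  move: l0 l1 hx hy => /=; case: x y => [x1 x2] [y1 y2] /=; move: (l%:inum) => p p0 p1 hx hy.
  have := ler_wpM2l p0 hx; have := ler_wpM2l p1 hy; lra.
move=> w [j [jr nzj wj cj]] /=; rewrite orderP in jr cj.
have [_ _ low _] := mu_poly.
apply: le_trans cj; have := low j jr nzj; rewrite /corner -/S => cj.
have muk := polygon_ge0 mu_poly kr.
apply: (@le_trans _ _ (mu k * (j%:R - k%:R) - S k)).
  by rewrite lerD2r ler_wpM2l // lerD2r.
apply: le_trans cj.
have [jk|kj] := leqP j k.
  rewrite -[S j]/(slope_sum r mu j) (@slope_sum_cat _ r mu j k) ?jk // -/S.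
  have : \sum_(j <= i < k) mu i.+1 <= (k - j)%N%:R * mu k.
    apply: sum_nat_le => i /andP[ji ik]; apply: (polygon_mono mu_poly).
    by rewrite ik.
  rewrite natrB //; move: (S k) (\sum_(_ <= _ < _) _) => a b; lra.
have kj' := ltnW kj.
rewrite -[S k]/(slope_sum r mu k) (@slope_sum_cat _ r mu k j) ?kj' // -/S.
have : (j - k)%N%:R * mu k <= \sum_(k <= i < j) mu i.+1.
  apply: sum_nat_ge => i /andP[ki ij]; apply: (polygon_mono mu_poly).
  by rewrite (leq_trans ij) // ltnW // ltnS ki.
rewrite natrB //; move: (S j) (\sum_(_ <= _ < _) _) => a b; lra.
Qed.

(** The point is a convex combination of the nearest vertices on both sides. Without a vertex on the
    left all slopes up to the next vertex are 0, and the point lies in the quadrant of that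
    vertex. *)
Lemma hull_mem k : (k <= r)%N -> newton_polygon P (k%:R : R^o, - S k : R^o).
Proof.
move=> kr A [Aconv AP].
have corners j a : (j <= r)%N -> P`_j != 0 -> corner j = - S j -> a <= j%:R -> A (a, - S j).
  move=> jr nzj cj aj; apply: AP; exists j; rewrite orderP; split => //=.
  by rewrite -cj.
have [j2 [/andP[kj2 j2r] nz2 c2 flat2]] := polygon_vertex_right mu_poly kr nz_r corner_r.
have slopes i j m : (i <= j <= r)%N -> (forall l, (i < l <= j)%N -> mu l = m) ->
    S i = (j - i)%N%:R * m + S j.
  move=> /andP[ij jr] h; rewrite -[S i]/(slope_sum r mu i) (@slope_sum_cat _ r mu i j) ?ij //.
  congr (_ + _); rewrite big_nat (eq_bigr (fun=> m)) => [|l /andP[il lj]].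
    by rewrite -big_nat sumr_const_nat mulr_natl.
  by apply: h; rewrite ltnS il.
have mu2 l : (k <= l <= j2)%N -> mu l = mu k.
  case/andP; elim: l => [|l IH]; first by rewrite leqn0 => /eqP->.
  rewrite leq_eqVlt => /orP[/eqP->//|]; rewrite ltnS => kl lj.
  by rewrite -flat2 ?kl // IH // ltnW.
case: (polygon_vertex_left mu_poly kr) => [flat1|[j1 [j1k nz1 c1 flat1]]].
  have muk0 : mu k = 0.
    have [<- _ _ _] := mu_poly.
    have mu0 i : (i <= k)%N -> mu i = mu 0%N.
      by elim: i => [//|i IH ik]; rewrite -flat1 // IH // ltnW.
    exact: mu0.
  rewrite (slopes k j2 0) ?kj2 // => [|l /andP[kl lj]]; last by rewrite mu2 // ltnW.
  by rewrite mulr0 add0r; apply: corners; rewrite // ler_nat.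
have [<-|k2] := eqVneq j2 k; first by apply: corners.
have kj : (k < j2)%N by rewrite ltn_neqAle eq_sym k2.
have mu1 l : (j1 < l <= k)%N -> mu l = mu k.
  have down d : (d < k - j1)%N -> mu (k - d)%N = mu k.
    elim: d => [|d IH] dk; first by rewrite subn0.
    rewrite flat1 -?subSn ?subSS ?IH ?(ltnW dk) //; try by move: dk; clear; lia.
  move=> /andP[jl lk]; rewrite -(subKn lk) down //.
  by rewrite ltn_sub2l // (leq_trans jl).
have S1 : S j1 = (j2 - j1)%N%:R * mu k + S j2.
  apply: slopes => [|l /andP[jl lj2]]; first by rewrite j2r (leq_trans (ltnW j1k)).
  have [lk|kl] := leqP l k; first by rewrite mu1 ?jl.
  by rewrite mu2 // ltnW.
have Sk : S k = (j2 - k)%N%:R * mu k + S j2.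
  by apply: slopes => [|l /andP[jl lj2]]; rewrite ?kj2 // mu2 // ltnW.
(* The barycentric coordinate of k between the vertices [j1] and [j2]. *)
pose p : R := (j2 - k)%N%:R / (j2 - j1)%N%:R.
have d0 : 0 < (j2 - j1)%N%:R :> R by rewrite ltr0n subn_gt0 (ltn_trans j1k).
have p0 : 0 <= p by rewrite divr_ge0.
have p1 : p <= 1 by rewrite ler_pdivrMr // mul1r ler_nat leq_sub2l // ltnW.
have A1 := corners j1 _ (leq_trans (ltnW j1k) kr) nz1 c1 (lexx _).
have A2 := corners j2 _ j2r nz2 c2 (lexx _).
have pE : p * (j2%:R - j1%:R) = j2%:R - k%:R.
  by rewrite /p -!natrB ?divfK ?gt_eqF // ltnW // (ltn_trans j1k).
have pt : (k%:R, - S k) =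
    (p * j1%:R + (1 - p) * j2%:R, p * - S j1 + (1 - p) * - S j2) :> R * R.
  rewrite S1 Sk !natrB ?(ltnW kj) ?(ltnW (ltn_trans j1k kj)) //; congr pair.
    by move: pE; move: (j2%:R) => a; lra.
  have -> : p * - ((j2%:R - j1%:R) * mu k + S j2) + (1 - p) * - S j2 =
     - (p * (j2%:R - j1%:R) * mu k + S j2) by ring.
  by rewrite pE.
rewrite pt; have := Aconv _ _ (Itv01 p0 p1) (mem_set A1) (mem_set A2).
by rewrite inE.
Qed.

Lemma newton_heightE k : (k <= r)%N -> newton_height P k%:R = - S k.
Proof.
move=> kr; have mem := hull_mem kr.
have lb : lbound [set c | newton_polygon P (k%:R : R^o, c : R^o)] (- S k).
  by move=> c /= /(hull_ge kr) /=; rewrite subrr mulr0 add0r.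
apply/eqP; rewrite eq_le; apply/andP; split.
  by apply: ge_inf => //; exists (- S k).
by apply: lb_le_inf => //; exists (- S k).
Qed.

Lemma newton_slopeE i : (1 <= i <= r)%N -> newton_slope R P i = mu i.
Proof.
case: i => // i /andP[_ ir]; rewrite /newton_slope.
have -> : i.+1%:R - 1 = i%:R :> R by rewrite -addn1 natrD addrK.
rewrite !newton_heightE //; last exact: ltnW.
by rewrite opprK addrC /S [slope_sum r mu i]slope_sumS // addrK.
Qed.

(** As [k - v(g_k)] equals [r - corner k], the irregularity is minus the lowest corner. The minimum
    is attained at the first vertex, where the slope 0 ends. *)
Lemma irr_formalE : irr_formal R P = \sum_(1 <= i < r.+1) mu i.
Proof.
have -> : \sum_(1 <= i < r.+1) mu i = S 0 by rewrite big_add1 /=.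
rewrite /irr_formal orderP lead_coefr lval1 subr0.
have dE k : k%:R - (lval P`_k)%:~R = r%:R - corner k :> R.
  by rewrite /corner; move: ((lval P`_k)%:~R) => a; lra.
have S_ge0 k : (k <= r)%N -> 0 <= S 0 - S k.
  move=> kr; rewrite /S (@slope_sum_cat _ r mu 0 k) // addrK big_nat sumr_ge0 //.
  by move=> i /andP[_ ik]; apply: (polygon_ge0 mu_poly); exact: leq_trans kr.
apply/eqP; rewrite subr_eq; apply/eqP/le_anti/andP; split.
  apply: bigmax_le => [|k nzk].
    by rewrite lerDr; have := S_ge0 r (leqnn r); rewrite /S slope_sumn subr0.
  rewrite dE; have kr : (k <= r)%N by rewrite -ltnS.
  have [_ _ low _] := mu_poly; have := low k kr nzk; have := S_ge0 k kr.
  by rewrite -/S; move: (corner k) (S k) (S 0) => a b c; lra.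
have [j [jr nzj cj]] := slope_sum_vertex0 mu_poly nz_r corner_r.
have := @le_bigmax_cond _ _ _ (r%:R : R) (Ordinal (jr : (j < r.+1)%N))
  (fun k => P`_k != 0) (fun k => k%:R - (lval P`_k)%:~R) nzj.
by rewrite /= dE cj opprK addrC.
Qed.

(** The k-th term of the maximum is the slope of the chord from the corner k to the corner (r, 0);
    the steepest chord is the last edge. *)
Lemma mu_maxE : (0 < r)%N -> mu_max R P = mu r.
Proof.
move=> r0; rewrite /mu_max orderP.
have cE k : (k < r)%N ->
    (lval P`_k)%:~R / (k%:R - r%:R) - 1 = - corner k / (r - k)%N%:R :> R.
  move=> kr; have d0 : (r%:R - k%:R : R) != 0 by rewrite subr_eq0 eqr_nat gtn_eqF.
  rewrite /corner natrB ?(ltnW kr) //.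
  have d1 : (k%:R - r%:R : R) != 0 by rewrite -opprB oppr_eq0.
  by field; rewrite ?d0 ?d1.
have nkpos k : (k < r)%N -> 0 < (r - k)%N%:R :> R by rewrite ltr0n subn_gt0.
apply/le_anti/andP; split.
  apply: bigmax_le => [|k nzk]; first exact: (polygon_ge0 mu_poly).
  have kr := ltn_ord k; rewrite cE // ler_pdivrMr ?nkpos // lerNl mulrC.
  have [_ _ low _] := mu_poly; apply: le_trans (low k (ltnW kr) nzk).
  by rewrite lerN2; apply: (slope_sum_le mu_poly); exact: ltnW.
have [->|mur0] := eqVneq (mu r) 0; first exact: bigmax_ge_id.
have mur : 0 < mu r by rewrite lt_neqAle eq_sym mur0 (polygon_ge0 mu_poly).
have [k [kr nzk ck]] := polygon_top_vertex mu_poly mur.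
have := @le_bigmax_cond _ _ _ (0 : R) (Ordinal kr)
  (fun k => P`_k != 0) (fun k => (lval P`_k)%:~R / (k%:R - r%:R) - 1) nzk.
by rewrite /= cE // ck opprK mulrC mulKf // gt_eqF // nkpos.
Qed.

Section Multiplicative.
Variable rho : R.
Hypothesis rho01 : 0 < rho < 1.

(** The inverse of the radius rho^(1 + m) on which sections of slope m converge; it plays the role
    of [th] in the normal form. *)
Definition slope_radius (m : R) : R := rho `^ (- (1 + m)).

Let rho_gt0 : 0 < rho. Proof. by case/andP: rho01. Qed.

Lemma powRDr (x y : R) : rho `^ (x + y) = rho `^ x * rho `^ y.
Proof. by rewrite powRD ?(gt_eqF rho_gt0) ?implybT. Qed.

Lemma powR_le (x y : R) : (rho `^ x <= rho `^ y) = (y <= x).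
Proof.
rewrite /powR (gt_eqF rho_gt0) ler_expR.
by rewrite ler_nM2r // ln_lt0.
Qed.

Lemma powR_lt (x y : R) : (rho `^ x < rho `^ y) = (y < x).
Proof. by rewrite ltNge powR_le -ltNge. Qed.

Lemma weight_slopes k :
  weight (slope_radius \o mu) k = rho `^ (- \sum_(i < k) (1 + mu i.+1)).
Proof.
elim: k => [|k IH]; first by rewrite /weight !big_ord0 oppr0 powRr0.
by rewrite weightS IH big_ord_recr /= opprD powRDr.
Qed.

Lemma weight_slopes_le k : (k <= r)%N ->
  weight (slope_radius \o mu) r
  = weight (slope_radius \o mu) k * rho `^ (- ((r - k)%N%:R + S k)).
Proof.
move=> kr; rewrite !weight_slopes -powRDr -opprD; congr (_ `^ (- _)).
rewrite -!(big_mkord xpredT (fun i => 1 + mu i.+1)) (big_cat_nat (leq0n k) kr) /=.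
by rewrite [X in _ + X]big_split /= sumr_const_nat.
Qed.

Lemma mpolygon_slopes : mpolygon rho r (fun k => P`_k) (slope_radius \o mu).
Proof.
have [mu0 mono low veq] := mu_poly.
have w0 k : 0 < weight (slope_radius \o mu) k by rewrite weight_slopes powR_gt0.
have gE k : (k < r)%N -> P`_k != 0 ->
    gauss rho P`_k = rho `^ (- ((r - k)%N%:R - corner k)).
  move=> kr nzk; rewrite gauss_neq0 // -powR_intmul ?ltW //; congr (_ `^ _).
  by rewrite /corner natrB ?(ltnW kr) //; ring.
split.
- by rewrite /slope_radius /= mu0 addr0 powR_inv1 // ltW.
- by move=> i ir; rewrite /= /slope_radius powR_le lerN2 lerD2l mono.
- move=> k kr; rewrite (weight_slopes_le (ltnW kr)) mulrC ler_pM2l //.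
  have [->|nzk] := eqVneq P`_k 0; first by rewrite gauss0 powR_ge0.
  rewrite gE // powR_le lerN2 lerD2l lerNl; exact: low (ltnW kr) nzk.
move=> k kr; rewrite /= /slope_radius powR_lt ltrN2 ltrD2l => jump.
have [nzk ck] := veq k kr jump.
by rewrite (weight_slopes_le (ltnW kr)) mulrC gE // ck opprK.
Qed.

End Multiplicative.
End NewtonPolygon.

(** * Cyclic vectors *)

Section CyclicVector.
Variable K : fieldType.
Hypothesis charK : [pchar K] =i pred0.
Local Notation L := (laurent K).

Definition lvar : L := laurent_of_poly 'X.

Lemma lderiv_lvar : lderiv lvar = 1.
Proof.
apply: laurentP => -[n|n]; rewrite lderivE loneE.
  have -> : Posz n + 1 = n.+1%:Z by clear; lia.
  by rewrite /= coefX eqSS; case: n => [|n]; rewrite ?mulr1z // mul0rz.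
by case: n => [|n]; rewrite ?mulr0z // /= mul0rz.
Qed.

Section Matrix.
Variables (n : nat) (A : 'M[L]_n).
Implicit Types (p q : 'rV[{poly L}]_n) (c : 'rV[L]_n).

Definition row_conn c : 'rV[L]_n := map_mx (@lderiv K) c + c *m A.

(* A second copy x of the variable, with x' = 1, is adjoined: specializing x to
   lvar + k then commutes with the connection. *)
Definition poly_conn p : 'rV[{poly L}]_n :=
  map_mx (map_poly (@lderiv K)) p + map_mx (@deriv L) p + p *m map_mx polyC A.

Definition row_eval (s : L) p : 'rV[L]_n := map_mx (horner_eval s) p.

Lemma map_poly_lderivE (p : {poly L}) i : (map_poly (@lderiv K) p)`_i = lderiv p`_i.
Proof. by rewrite coef_map_id0 // lderiv0. Qed.

Lemma map_poly_lderivD (p q : {poly L}) :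
  map_poly (@lderiv K) (p + q) = map_poly (@lderiv K) p + map_poly (@lderiv K) q.
Proof. by apply/polyP => i; rewrite coefD !map_poly_lderivE coefD lderivD. Qed.

Lemma map_poly_lderivXM k (p : {poly L}) :
  map_poly (@lderiv K) ('X^k * p) = 'X^k * map_poly (@lderiv K) p.
Proof.
apply/polyP => i; rewrite map_poly_lderivE !coefXnM map_poly_lderivE.
by case: ifP => // _; rewrite lderiv0.
Qed.

Lemma poly_connD p q : poly_conn (p + q) = poly_conn p + poly_conn q.
Proof.
rewrite /poly_conn mulmxDl; apply/matrixP => i j; rewrite !mxE.
by rewrite map_poly_lderivD derivD; ring.
Qed.

Lemma iter_poly_connD k p q :
  iter k poly_conn (p + q) = iter k poly_conn p + iter k poly_conn q.
Proof. by elim: k => //= k ->; rewrite poly_connD. Qed.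

Lemma poly_connX k p :
  poly_conn ('X^(k.+1) *: p) = 'X^k *: (k.+1%:R *: p + 'X *: poly_conn p).
Proof.
rewrite /poly_conn -scalemxAl; apply/matrixP => i j.
move: (p *m _) => w; rewrite !mxE map_poly_lderivXM derivM derivXn exprS /=.
by rewrite -mulr_natl; ring.
Qed.

Lemma row_evalD s p q : row_eval s (p + q) = row_eval s p + row_eval s q.
Proof. by rewrite /row_eval map_mxD. Qed.

Lemma row_evalZ s f p : row_eval s (f *: p) = f.[s] *: row_eval s p.
Proof. by rewrite /row_eval map_mxZ. Qed.

Lemma iter_poly_connX k i p : (i <= k)%N -> exists q,
  iter i poly_conn ('X^k *: p) = 'X^(k - i) *: q /\
  row_eval 0 q = (k ^_ i)%:R *: row_eval 0 p.
Proof.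
elim: i => [|i IH] ik; first by exists p; rewrite subn0 ffactn0 scale1r.
have [q [qE q0]] := IH (ltnW ik).
have kE : (k - i = (k - i.+1).+1)%N by move: ik; clear; lia.
rewrite iterS qE kE poly_connX; eexists; split; first by [].
rewrite row_evalD !row_evalZ hornerX scale0r addr0 q0 scalerA -kE ffactnSr natrM.
congr (_ *: _); rewrite mulrC; congr (_ * _).
by rewrite -polyC_natr hornerC.
Qed.

Lemma row_evalX0 k p : (0 < k)%N -> row_eval 0 ('X^k *: p) = 0.
Proof. by case: k => // k _; rewrite row_evalZ hornerXn expr0n scale0r. Qed.

(** By [iter_poly_connX], adding x^m w / m! leaves the values at x = 0 of the iterates of order less
    than m unchanged and adds w to the one of order m. So the values are prescribed one at a
    time. *)
Lemma poly_conn_interpolation m (v : nat -> 'rV[L]_n) : exists p,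
  forall i, (i < m)%N -> row_eval 0 (iter i poly_conn p) = v i.
Proof.
elim: m => [|m [p pP]]; first by exists 0.
pose w := v m - row_eval 0 (iter m poly_conn p).
exists (p + 'X^m *: map_mx polyC (m`!%:R^-1 *: w)) => i; rewrite ltnS => im.
have [q [qE q0]] := iter_poly_connX (map_mx polyC (m`!%:R^-1 *: w)) im.
rewrite iter_poly_connD row_evalD qE.
move: im; rewrite leq_eqVlt => /orP[/eqP im|im]; last first.
  by rewrite row_evalX0 ?subn_gt0 // addr0 pP.
rewrite im subnn expr0 scale1r q0 im ffactnn.
have -> : row_eval 0 (map_mx polyC (m`!%:R^-1 *: w)) = m`!%:R^-1 *: w.
  by apply/matrixP => a b; rewrite !mxE /horner_eval hornerC.
rewrite scalerA divff ?natrL_neq0 ?fact_gt0 // scale1r /w.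
by rewrite addrC subrK.
Qed.

Lemma lderiv_horner (s : L) (p : {poly L}) : lderiv s = 1 ->
  lderiv p.[s] = (map_poly (@lderiv K) p).[s] + p^`().[s].
Proof.
move=> s1; elim/poly_ind: p => [|p c IH].
  by rewrite deriv0 map_poly0 !horner0 lderiv0 addr0.
rewrite derivMXaddC hornerMXaddC lderivD lderivM IH s1.
have -> : map_poly (@lderiv K) (p * 'X + c%:P) = map_poly (@lderiv K) p * 'X + (lderiv c)%:P.
  apply/polyP => i; rewrite map_poly_lderivE !coefD !coefMX !coefC map_poly_lderivE.
  by rewrite lderivD; case: eqP; rewrite ?lderiv0.
rewrite !(hornerD, hornerMX, hornerC, hornerM, hornerX); ring.
Qed.

Lemma row_eval_conn (s : L) p : lderiv s = 1 ->
  row_eval s (poly_conn p) = row_conn (row_eval s p).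
Proof.
move=> s1; rewrite /row_eval /poly_conn /row_conn !map_mxD map_mxM; congr (_ + _); last first.
  by congr (_ *m _); apply/matrixP => i j; rewrite !mxE /= /horner_eval hornerC.
by apply/matrixP => i j; rewrite !mxE /= /horner_eval lderiv_horner.
Qed.

(** The elements T + k all have derivative 1 and are distinct in characteristic 0, so finitely many
    of them outnumber the roots of q. *)
Lemma exists_nonroot (q : {poly L}) : q != 0 -> exists2 s : L, lderiv s = 1 & q.[s] != 0.
Proof.
move=> q0; pose s (k : nat) : L := lvar + k%:R.
have s1 k : lderiv (s k) = 1 by rewrite lderivD lderiv_lvar lderivn addr0.
have [[k /negP qk]|all] := pselect (exists k : nat, ~ root q (s k)).
  by exists (s k).
have : (size [seq s k | k <- iota 0 (size q)] < size q)%N.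
  apply: max_poly_roots => //.
    apply/allP => _ /mapP[k _ ->]; apply: contrapT => h; apply: all; by exists k.
  rewrite map_inj_uniq ?iota_uniq // => i j /addrI /eqP h; apply/eqP.
  wlog ij : i j h / (i <= j)%N => [hw|].
    by case/orP: (leq_total i j) => ij; [|rewrite eq_sym]; apply: hw; rewrite // eq_sym.
  move: h; rewrite eq_sym -subr_eq0 -natrB // => h; rewrite eqn_leq ij leqNgt /=.
  by apply: contraTN h => ji; rewrite natrL_neq0 // subn_gt0.
by rewrite size_map size_iota ltnn.
Qed.

(* Some polynomial row p satisfies row_eval 0 (iter i poly_conn p) = e_i, so the
   determinant of the iterates is a nonzero polynomial in x; specialize x outside
   its roots. *)
Theorem cyclic_row : exists c : 'rV[L]_n,
  \matrix_(i < n) iter i row_conn c \in unitmx.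
Proof.
pose v (i : nat) : 'rV[L]_n := \row_j (i == j :> nat)%:R.
have [p pv] := poly_conn_interpolation n v.
pose Q : 'M[{poly L}]_n := \matrix_(i < n) iter i poly_conn p.
have Q0 : map_mx (horner_eval 0) Q = 1%:M.
  apply/matrixP => i j; have := congr1 (fun r : 'rV[L]_n => r 0 j) (pv i (ltn_ord i)).
  by rewrite !mxE.
have detQ : \det Q != 0.
  apply/eqP => dQ; have := congr1 (horner_eval 0) dQ.
  by rewrite -det_map_mx Q0 det1 /horner_eval horner0 => /eqP; rewrite oner_eq0.
have [s s1 sQ] := exists_nonroot detQ.
exists (row_eval s p); rewrite unitmxE unitfE.
suff -> : \matrix_(i < n) iter i row_conn (row_eval s p) = map_mx (horner_eval s) Q.
  by rewrite det_map_mx.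
apply/row_matrixP => i; rewrite rowK -map_row rowK -/(row_eval s _).
by elim: (i : nat) => //= k ->; rewrite row_eval_conn.
Qed.

End Matrix.
End CyclicVector.

(** * Bases, connection matrices and attached operators *)

Section ConnectionBases.
Variable K : fieldType.
Local Notation L := (laurent K).
Variables (M : vectType L) (nabla : M -> M).
Hypothesis nablaP : is_connection nabla.
Local Notation "B ^`" := (map_mx (@lderiv K) B) (at level 2, format "B ^`").

Lemma nablaD u v : nabla (u + v) = nabla u + nabla v. Proof. by case: nablaP. Qed.
Lemma nablaZ f u : nabla (f *: u) = lderiv f *: u + f *: nabla u.
Proof. by case: nablaP. Qed.
Lemma nabla0 : nabla 0 = 0.
Proof. by apply: (addIr (nabla 0)); rewrite -nablaD !add0r. Qed.
Lemma nabla_sum (I : Type) (s : seq I) (P : pred I) (F : I -> M) :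
  nabla (\sum_(i <- s | P i) F i) = \sum_(i <- s | P i) nabla (F i).
Proof. exact: (big_morph _ nablaD nabla0). Qed.

Definition conn_rep n (b : 'I_n -> M) (A : 'M[L]_n) :=
  forall i, nabla (b i) = \sum_j A i j *: b j.

Definition row_comb n (b : 'I_n -> M) (c : 'rV[L]_n) : M := \sum_j c 0 j *: b j.

Lemma nabla_row_comb n (b : 'I_n -> M) A c : conn_rep b A ->
  nabla (row_comb b c) = row_comb b (row_conn A c).
Proof.
move=> bA; rewrite /row_comb nabla_sum.
under eq_bigr do rewrite nablaZ bA.
rewrite big_split /=; under [RHS]eq_bigr do rewrite !mxE scalerDl.
rewrite big_split /=; congr (_ + _).
under eq_bigr do rewrite scaler_sumr; rewrite exchange_big /=.
apply: eq_bigr => j _; rewrite scaler_suml; apply: eq_bigr => k _.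
by rewrite scalerA.
Qed.

Definition indep n (b : 'I_n -> M) := forall c, row_comb b c = 0 -> c = 0.
Definition spans n (b : 'I_n -> M) (U : {vspace M}) :=
  forall u, u \in U <-> exists c, u = row_comb b c.

Lemma row_combD n (b : 'I_n -> M) c d : row_comb b (c + d) = row_comb b c + row_comb b d.
Proof. by rewrite /row_comb -big_split; apply: eq_bigr => i _; rewrite mxE scalerDl. Qed.

Lemma row_combN n (b : 'I_n -> M) c : row_comb b (- c) = - row_comb b c.
Proof. by rewrite /row_comb -sumrN; apply: eq_bigr => i _; rewrite mxE scaleNr. Qed.

Lemma row_comb_delta n (b : 'I_n -> M) i : row_comb b (delta_mx 0 i) = b i.
Proof.
rewrite /row_comb (bigD1 i) //= big1 ?addr0 => [|j ji].
  by rewrite mxE !eqxx scale1r.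
by rewrite mxE (negPf ji) andbF scale0r.
Qed.

Lemma indep_inj n (b : 'I_n -> M) c d : indep b -> row_comb b c = row_comb b d -> c = d.
Proof.
move=> bi h; apply/eqP; rewrite -subr_eq0; apply/eqP; apply: bi.
by rewrite row_combD row_combN h subrr.
Qed.

Lemma row_comb_mul n m (b : 'I_n -> M) (b' : 'I_m -> M) F d :
  (forall i, b' i = row_comb b (row i F)) -> row_comb b' d = row_comb b (d *m F).
Proof.
move=> bF; rewrite /row_comb; under eq_bigr do rewrite bF /row_comb scaler_sumr.
rewrite exchange_big /=; apply: eq_bigr => j _; rewrite mxE scaler_suml.
by apply: eq_bigr => k _; rewrite mxE scalerA.
Qed.

(** F may be rectangular: besides changes of basis this covers inclusions of sub-modules, for which
    it yields the equation treated in [nf_hom]. *)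
Lemma conn_rep_coord n m (b : 'I_n -> M) (b' : 'I_m -> M) A A' F : indep b ->
  conn_rep b A -> conn_rep b' A' -> (forall i, b' i = row_comb b (row i F)) ->
  F^` + F *m A = A' *m F.
Proof.
move=> bi bA bA' bF; apply/row_matrixP => i; apply: (indep_inj bi).
have -> : row i (F^` + F *m A) = row_conn A (row i F).
  by rewrite /row_conn linearD /= row_mul map_row.
rewrite -nabla_row_comb // -bF bA' row_mul -(row_comb_mul _ bF).
by apply: eq_bigr => j _; rewrite mxE.
Qed.

Lemma spans_mem n (b : 'I_n -> M) U i : spans b U -> b i \in U.
Proof. by move=> h; apply/h; exists (delta_mx 0 i); rewrite row_comb_delta. Qed.

Lemma spans_coord n m (b : 'I_n -> M) (b' : 'I_m -> M) U : spans b U ->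
  (forall i, b' i \in U) -> exists F, forall i, b' i = row_comb b (row i F).
Proof.
move=> bU b'U; have /choice[f fP] i : exists c, b' i = row_comb b c by apply/bU.
by exists (\matrix_i f i) => i; rewrite rowK.
Qed.

Lemma coord_unit n (b b' : 'I_n -> M) U F : spans b' U -> indep b' -> spans b U ->
  (forall i, b' i = row_comb b (row i F)) -> F \in unitmx.
Proof.
move=> bU' bi' bU bF; have [G bG] := spans_coord bU' (fun i => @spans_mem _ _ _ i bU).
suff FG : F *m G = 1%:M by have [] := mulmx1_unit FG.
apply/row_matrixP => i; apply: (indep_inj bi').
by rewrite row_mul -(row_comb_mul _ bG) -bF row1 row_comb_delta.
Qed.

Lemma unit_basis n (b b' : 'I_n -> M) U F : F \in unitmx -> indep b -> spans b U ->
  (forall i, b' i = row_comb b (row i F)) -> indep b' /\ spans b' U.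
Proof.
move=> Fu bi bU bF; split=> [c|u].
  rewrite (row_comb_mul _ bF) => /bi h.
  by rewrite -[c](mulmxK Fu) h mul0mx.
split=> [/bU[c ->]|[c ->]]; last by rewrite (row_comb_mul _ bF); apply/bU; eexists.
by exists (c *m invmx F); rewrite (row_comb_mul _ bF) mulmxKV.
Qed.

Lemma fam_dim n (b : 'I_n -> M) U : indep b -> spans b U -> \dim U = n.
Proof.
move=> bi bU; pose X := [tuple b i | i < n].
have Xb (i : 'I_n) : X`_i = b i by rewrite -tnth_nth tnth_mktuple.
have Xfree : free X.
  apply/freeP => k h i.
  suff /(congr1 (fun c : 'rV[L]_n => c 0 i)) : \row_j k j = 0 by rewrite !mxE.
  apply: bi; rewrite -[RHS]h; apply: eq_bigr => j _; by rewrite mxE Xb.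
have XU : <<X>>%VS = U.
  apply/vspaceP => u; apply/idP/idP => [uX|/bU[c ->]].
    apply/bU; exists (\row_j coord X j u); rewrite [LHS](coord_span uX).
    by apply: eq_bigr => j _; rewrite mxE Xb.
  apply: memv_suml => j _; apply: memvZ; rewrite -Xb; apply: memv_span.
  by rewrite mem_nth // size_tuple.
by move: Xfree; rewrite /free XU size_tuple => /eqP.
Qed.

Lemma vbasis_fam (U : {vspace M}) : let b := fun i : 'I_(\dim U) => (vbasis U)`_i in
  indep b /\ spans b U.
Proof.
split=> [c h|u].
  apply/rowP => j; have /freeP := basis_free (vbasisP U).
  move/(_ (fun j => c 0 j)) => ->; rewrite ?mxE //.
split=> [uU|[c ->]].
  exists (\row_j coord (vbasis U) j u); rewrite [LHS](coord_vbasis uU).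
  by apply: eq_bigr => j _; rewrite mxE.
apply: memv_suml => j _; apply: memvZ; apply: vbasis_mem.
by rewrite mem_nth // size_tuple.
Qed.

Lemma conn_rep_exists n (b : 'I_n -> M) U : spans b U -> submodule nabla U ->
  exists A, conn_rep b A.
Proof.
move=> bU Ustab; have [A AE] := spans_coord bU (fun i => Ustab _ (@spans_mem _ _ _ i bU)).
by exists A => i; rewrite AE; apply: eq_bigr => j _; rewrite mxE.
Qed.

Definition op_app (e : M) (Q : {poly L}) : M := \sum_(k < size Q) Q`_k *: iter k nabla e.

Lemma op_app_wide e m (Q : {poly L}) : (size Q <= m)%N ->
  op_app e Q = \sum_(k < m) Q`_k *: iter k nabla e.
Proof.
move=> Qm; rewrite /op_app (big_ord_widen m (fun k => Q`_k *: iter k nabla e) Qm).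
rewrite big_mkcond; apply: eq_bigr => k _; case: ltnP => // h.
by rewrite nth_default // scale0r.
Qed.

Fact op_app_is_linear e : linear (op_app e).
Proof.
move=> a p q; pose m := maxn (size p) (size q).
have pm : (size p <= m)%N by rewrite leq_maxl.
have qm : (size q <= m)%N by rewrite leq_maxr.
have apm : (size (a *: p + q)%R <= m)%N.
  apply: leq_trans (size_polyD _ _) _; rewrite geq_max qm andbT.
  exact: leq_trans (size_scale_leq _ _) pm.
rewrite !(@op_app_wide e m) // scaler_sumr -big_split; apply: eq_bigr => k _ /=.
by rewrite coefD coefZ scalerDl scalerA.
Qed.
HB.instance Definition _ e := GRing.isLinear.Build L {poly L} M _ (op_app e) (op_app_is_linear e).

Lemma coef_ddT_mul (Q : {poly L}) k :
  (ddT_mul Q)`_k = lderiv Q`_k + (if k is k'.+1 then Q`_k' else 0).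
Proof.
by rewrite coefD coef_map_id0 ?lderiv0 // coefMX; case: k.
Qed.

Lemma size_ddT_mul (Q : {poly L}) m : (size Q <= m)%N -> (size (ddT_mul Q) <= m.+1)%N.
Proof.
move=> Qm; apply/leq_sizeP => j mj; rewrite coef_ddT_mul.
rewrite (leq_sizeP _ _ Qm j) ?lderiv0 ?(ltnW mj) // add0r.
by case: j mj => // j mj; rewrite (leq_sizeP _ _ Qm).
Qed.

Lemma op_app_ddT e Q : op_app e (ddT_mul Q) = nabla (op_app e Q).
Proof.
rewrite (op_app_wide e (size_ddT_mul (leqnn _))) /op_app nabla_sum.
under eq_bigr do rewrite coef_ddT_mul scalerDl.
rewrite big_split /= big_ord_recr [X in _ + X]big_ord_recl /= nth_default //.
rewrite lderiv0 !scale0r addr0 add0r -big_split /=; apply: eq_bigr => k _.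
by rewrite nablaZ.
Qed.

Lemma ddT_mulX k : ddT_mul ('X^k : {poly L}) = 'X^(k.+1).
Proof.
apply/polyP => i; rewrite coef_ddT_mul !coefXn.
have -> : lderiv ((i == k)%:R : L) = 0 by case: eqP => _; rewrite ?lderiv1 ?lderiv0.
by rewrite add0r; case: i => [|i]; rewrite ?coefXn.
Qed.

Lemma op_appX e k : op_app e 'X^k = iter k nabla e.
Proof.
elim: k => [|k IH]; last by rewrite -ddT_mulX op_app_ddT IH.
by rewrite expr0 /op_app size_poly1 big_ord1 coef1 scale1r.
Qed.

Lemma iter_op_app_ddT e k Q : op_app e (iter k (@ddT_mul K) Q) = iter k nabla (op_app e Q).
Proof. by elim: k => //= k <-; rewrite op_app_ddT. Qed.

Lemma op_mul_wide m (A Q : {poly L}) : (size A <= m)%N ->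
  op_mul A Q = \sum_(k < m) A`_k *: iter k (@ddT_mul K) Q.
Proof.
move=> Am; rewrite /op_mul (big_ord_widen m (fun k => A`_k *: iter k (@ddT_mul K) Q) Am).
rewrite big_mkcond; apply: eq_bigr => k _; case: ltnP => // h.
by rewrite nth_default // scale0r.
Qed.

Lemma op_mulDZX (A Q : {poly L}) a d :
  op_mul (A + a *: 'X^d) Q = op_mul A Q + a *: iter d (@ddT_mul K) Q.
Proof.
pose m := maxn (size A) d.+1.
have Am : (size A <= m)%N by rewrite leq_maxl.
have dm : (d < m)%N by rewrite leq_maxr.
have Xm : (size (a *: 'X^d : {poly L})%R <= m)%N.
  by apply: leq_trans (size_scale_leq _ _) _; rewrite size_polyXn.
rewrite !(@op_mul_wide m) //; last first.
  by apply: leq_trans (size_polyD _ _) _; rewrite geq_max Am Xm.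
under eq_bigr do rewrite coefD scalerDl.
rewrite big_split /=; congr (_ + _).
rewrite (bigD1 (Ordinal dm)) //= big1 ?addr0 => [|k kd].
  by rewrite coefZ coefXn eqxx mulr1.
by rewrite coefZ coefXn -[(k : nat) == d]/(k == Ordinal dm) (negPf kd) mulr0 scale0r.
Qed.

Lemma iter_ddT_lead k (P : {poly L}) n : P \is monic -> size P = n.+1 ->
  (size (iter k (@ddT_mul K) P) <= (n + k).+1)%N /\ (iter k (@ddT_mul K) P)`_(n + k) = 1.
Proof.
move=> Pm sP; elim: k => [|k [IHs IHl]].
  by rewrite addn0 sP leqnn; move/monicP: Pm; rewrite lead_coefE sP.
rewrite addnS; split; first exact: size_ddT_mul.
rewrite iterS coef_ddT_mul IHl (leq_sizeP _ _ IHs) // lderiv0 add0r //.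
Qed.

Section Attached.
Local Notation n := (\dim {:M}).

(** The basis consists of e = phi 1 and its derivatives, and [phi P = 0] expresses the n-th
    derivative by the previous ones. These vectors generate M, and n generators of a space of
    dimension n are independent. *)
Lemma attached_basis P : attached nabla P -> exists b : 'I_n -> M,
  [/\ indep b, spans b fullv & conn_rep b (companion_mx n (fun k => P`_k))].
Proof.
case=> Pm sP [phi [phi_surj phi_ddT phi_ker]].
pose e := phi 1; pose b (i : 'I_n) := iter i nabla e.
have phiX k : phi 'X^k = iter k nabla e.
  by elim: k => [|k IH]; rewrite ?expr0 // -ddT_mulX phi_ddT IH.
have phiE Q : phi Q = op_app e Q.
  rewrite -{1}[Q]coefK poly_def linear_sum; apply: eq_bigr => k _.
  by rewrite linearZ /= phiX.
have phiP : op_app e P = 0.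
  rewrite -phiE; apply/phi_ker; exists 1.
  by rewrite /op_mul size_poly1 big_ord1 coef1 scale1r.
have top : iter n nabla e = row_comb b (\row_(k < n) - P`_k).
  have PE := op_app_wide e (m := n.+1); rewrite PE ?sP // big_ord_recr /= in phiP.
  have Pn : P`_n = 1 by move/monicP: Pm; rewrite lead_coefE sP.
  rewrite Pn scale1r in phiP.
  apply/eqP; rewrite -subr_eq0 -[X in _ == X]phiP addrC; apply/eqP; congr (_ + _).
  by rewrite /row_comb -sumrN; apply: eq_bigr => k _; rewrite mxE scaleNr opprK.
have bC : conn_rep b (companion_mx n (fun k => P`_k)).
  move=> i; rewrite /b -iterS; have [iE|iN] := eqVneq i.+1 n.
    rewrite [in LHS]iE top; apply: eq_bigr => j _.
    by rewrite !mxE iE eqxx.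
  have iS : (i.+1 < n)%N by rewrite ltn_neqAle iN ltn_ord.
  rewrite (bigD1 (Ordinal iS)) //= big1 ?addr0 => [|j ji].
    by rewrite mxE (negPf iN) eqxx scale1r.
  by rewrite mxE (negPf iN) -[(j : nat) == i.+1]/(j == Ordinal iS) (negPf ji) scale0r.
have bk k : exists c, iter k nabla e = row_comb b c.
  elim: k => [|k [c IH]].
    have [n0|n0] := posnP n.
      have M0 : fullv = 0%VS :> {vspace M} by apply/eqP; rewrite -dimv_eq0 n0.
      have z u : u = 0 :> M by apply/eqP; rewrite -memv0 -M0 memvf.
      by exists 0; rewrite [LHS]z [RHS]z.
    by exists (delta_mx 0 (Ordinal n0)); rewrite row_comb_delta.
  by exists (row_conn (companion_mx n (fun k => P`_k)) c); rewrite iterS IH (nabla_row_comb _ bC).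
have bsurj u : exists c, u = row_comb b c.
  have [Q <-] := phi_surj u; rewrite phiE /op_app.
  elim/big_ind: _ => [|x y [c ->] [d ->]|k _].
  - by exists 0; rewrite /row_comb big1 // => j _; rewrite mxE scale0r.
  - by exists (c + d); rewrite row_combD.
  have [c ->] := bk k; exists (Q`_k *: c).
  by rewrite /row_comb scaler_sumr; apply: eq_bigr => j _; rewrite mxE scalerA.
have [vi vs] := vbasis_fam fullv.
have [F vF] := spans_coord (U := fullv) (b := b) (b' := fun i : 'I_n => (vbasis fullv)`_i)
  (fun u => conj (fun=> bsurj u) (fun=> memvf u)) (fun i => memvf _).
have bs : spans b fullv by move=> u; split => _; [exact: bsurj | exact: memvf].
have Fu : F \in unitmx.
  have [G bG] := spans_coord vs (fun i => memvf (b i)).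
  suff FG : F *m G = 1%:M by have [] := mulmx1_unit FG.
  apply/row_matrixP => i; apply: (indep_inj vi).
  by rewrite row_mul -(row_comb_mul _ bG) -vF row1 row_comb_delta.
exists b; split => //.
move=> c bc.
have E : row_comb (fun i : 'I_n => (vbasis fullv)`_i) (c *m invmx F) = row_comb b c.
  by rewrite (row_comb_mul _ vF) mulmxKV.
rewrite bc in E; move/vi: E => h.
by rewrite -[c](mulmxKV Fu) h mul0mx.
Qed.

Hypothesis charK : [pchar K] =i pred0.

(** [cyclic_row] provides a cyclic vector e; P is the relation of order n between its derivatives,
    and the presentation sends an operator Q to Q e. *)
Lemma attached_exists : exists P, attached nabla P.
Proof.
have [vi vs] := vbasis_fam fullv; set v := (fun i => _) in vi vs.
have [A vA] := conn_rep_exists vs (fun u _ => memvf _).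
have [c cu] := cyclic_row charK A.
pose e := row_comb v c; pose b (i : 'I_n) := iter i nabla e.
have eE k : iter k nabla e = row_comb v (iter k (row_conn A) c).
  by elim: k => //= k ->; rewrite (nabla_row_comb _ vA).
have bF i : b i = row_comb v (row i (\matrix_(i < n) iter i (row_conn A) c)).
  by rewrite rowK /b eE.
have [bi bs] := unit_basis cu vi vs bF.
have [g gE] : exists g, iter n nabla e = row_comb b g by apply/bs; exact: memvf.
pose Pg : {poly L} := \poly_(k < n) (if insub k is Some i then g 0 i else 0).
pose P : {poly L} := 'X^n - Pg.
have sg : (size Pg < n.+1)%N by rewrite ltnS size_poly.
have sP : size P = n.+1 by rewrite size_polyDl size_polyXn // size_polyN.
have Pn : P`_n = 1.
  by rewrite coefB coefXn eqxx coef_poly ltnn subr0.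
have Pm : P \is monic by rewrite monicE lead_coefE sP Pn.
have phiP : op_app e P = 0.
  rewrite (@op_app_wide e n.+1) ?sP // big_ord_recr /= Pn scale1r gE.
  rewrite /row_comb -big_split big1 // => k _ /=.
  by rewrite coefB coefXn ltn_eqF // sub0r coef_poly ltn_ord valK scaleNr addNr.
exists P; split => //; exists (op_app e); split.
- move=> u; have [d ->] : exists d, u = row_comb b d by apply/bs; exact: memvf.
  exists (\sum_(k < n) d 0 k *: 'X^k); rewrite linear_sum.
  by apply: eq_bigr => k _; rewrite linearZ /= op_appX.
- exact: op_app_ddT.
move=> Q; split=> [|[B ->]]; last first.
  rewrite /op_mul linear_sum big1 // => k _; rewrite linearZ /= iter_op_app_ddT phiP.
  suff -> : iter k nabla 0 = 0 by rewrite scaler0.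
  by elim: (k : nat) => //= k' ->; rewrite nabla0.
(* Right division by the monic P: subtracting the leading coefficient times (d/dT)^d P lowers the
   order. A remainder of order less than n that kills e is 0 by independence of the basis. *)
have [m] := ubnP (size Q); elim: m Q => // m IH Q; rewrite ltnS => Qm QP.
have [Qn|Qn] := leqP (size Q) n.
  exists 0; rewrite /op_mul size_poly0 big_ord0.
  have /bi d0 : row_comb b (\row_k Q`_k) = 0.
    rewrite -[RHS]QP /= (op_app_wide e Qn); apply: eq_bigr => k _; by rewrite mxE.
  apply/polyP => k; rewrite coef0; have [kn|kn] := ltnP k n; last first.
    by rewrite nth_default // (leq_trans Qn).
  by have := congr1 (fun M : 'rV[L]_n => M 0 (Ordinal kn)) d0; rewrite !mxE.
pose d := (size Q - n.+1)%N.
have dE : size Q = (n + d).+1 by rewrite /d -addSn subnKC.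
have [Ds Dl] := iter_ddT_lead d Pm sP.
pose Q' := Q - lead_coef Q *: iter d (@ddT_mul K) P.
have Q'm : (size Q' < m)%N.
  apply: (@leq_trans (n + d).+1); last by rewrite -dE.
  rewrite ltnS; apply/leq_sizeP => j; rewrite leq_eqVlt => /orP[/eqP <-|nj].
    by rewrite coefB coefZ Dl mulr1 lead_coefE dE subrr.
  by rewrite coefB coefZ (leq_sizeP _ _ Ds) // mulr0 subr0 nth_default // dE.
have Q'P : op_app e Q' = 0.
  rewrite /Q' linearB /= QP linearZ /= iter_op_app_ddT phiP.
  suff -> : iter d nabla 0 = 0 by rewrite scaler0 subr0.
  by elim: (d : nat) => //= k' ->; rewrite nabla0.
have [B BE] := IH Q' Q'm Q'P.
exists (B + lead_coef Q *: 'X^d); rewrite op_mulDZX -BE.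
by rewrite /Q' subrK.
Qed.

End Attached.
End ConnectionBases.

(** * Morphisms between normal forms *)

Section NormalFormMorphisms.
Variables (R : realType) (K : fieldType) (rho : R).
Hypothesis rho01 : 0 < rho < 1.
Local Notation L := (laurent K).
Local Notation N := (gauss rho).
Local Notation "B ^`" := (map_mx (@lderiv K) B) (at level 2, format "B ^`").

Let rhoV_gt0 : 0 < rho^-1. Proof. by rewrite invr_gt0; case/andP: rho01. Qed.

(* Dividing F^` + F A' = A F by the larger of the two slopes exhibits F as a fixed
   point of a contraction. *)
Lemma nf_hom m n (A B : 'M[L]_m) th c (A' B' : 'M[L]_n) th' c' (F : 'M[L]_(m, n)) :
  nf rho A B th c -> nf rho A' B' th' c' ->
  (forall i, rho^-1 <= th i) -> (forall j, rho^-1 <= th' j) ->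
  F^` + F *m A' = A *m F -> forall i j, F i j != 0 -> th i = th' j.
Proof.
move=> [c0 blk hA hB hAB] [c'0 blk' hA' hB' hAB'] th_ge th'_ge FE i0 j0 Fij.
apply/eqP/negPn/negP => xy; set x := th i0 in xy; set y := th' j0 in xy.
have x_ge : rho^-1 <= x by exact: th_ge.
have y_ge : rho^-1 <= y by exact: th'_ge.
have x0 : 0 < x by exact: lt_le_trans x_ge.
have y0 : 0 < y by exact: lt_le_trans y_ge.
(* F restricted to one pair of blocks; it satisfies the same equation because A and A' are block
   diagonal. *)
pose G := \matrix_(i, j) (if (th i == x) && (th' j == y) then F i j else 0).
have GF i j : th i = x -> th' j = y -> G i j = F i j by move=> ix jy; rewrite mxE ix jy !eqxx.
have G0 i j : (th i != x) || (th' j != y) -> G i j = 0.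
  by rewrite -negb_and mxE => /negPf ->.
have GE : G^` + G *m A' = A *m G.
  apply/matrixP => i j; rewrite !mxE.
  case: ifP => [/andP[/eqP ix /eqP jy]|ij].
    have := congr1 (fun M : 'M[L]_(m, n) => M i j) FE; rewrite !mxE => FEij.
    transitivity (lderiv (F i j) + \sum_l F i l * A' l j).
      congr (_ + _); apply: eq_bigr => l _.
      have [->|Al] := eqVneq (A' l j) 0; first by rewrite !mulr0.
      by rewrite GF // (blk' l j) //; left.
    rewrite FEij; apply: eq_bigr => l _.
    have [->|Al] := eqVneq (A i l) 0; first by rewrite !mul0r.
    by rewrite GF // -(blk i l) //; left.
  rewrite lderiv0 add0r !big1 // => l _.
    have [->|Al] := eqVneq (A i l) 0; first by rewrite mul0r.
    by rewrite G0 ?mulr0 // -(blk i l) ?[_ || _]negb_and ?ij //; [rewrite -negb_and ij | left].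
  have [->|Al] := eqVneq (A' l j) 0; first by rewrite mulr0.
  by rewrite G0 ?mul0r // (blk' l j); [rewrite -negb_and ij | left].
suff /matrixP/(_ i0 j0) : G = 0 by rewrite GF // mxE => /eqP; rewrite (negPf Fij).
(* For x < y the equation is solved for F A' and multiplied by B' on the right; for y < x it is
   solved for A F and multiplied by B on the left. The larger slope exceeds [rho^-1], so [nf]
   provides the inverse on its block. *)
have [lt_xy|lt_yx|eq_xy] := ltgtP x y; last by rewrite eq_xy eqxx in xy.
  have e01 : 0 <= y^-1 * x < 1.
    by rewrite mulr_ge0 ?invr_ge0 ?(ltW x0) ?(ltW y0) //= mulrC ltr_pdivrMr // mul1r.
  apply: (mxle_contract_zero rho01 c0 c'0 e01) => k k0 Gk i j.
  have rhs0 : 0 <= y^-1 * x * k * c i.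
    by rewrite !mulr_ge0 ?invr_ge0 ?(ltW x0) ?(ltW y0) ?(ltW (c0 i)).
  have [ij|] := boolP ((th i != x) || (th' j != y)).
    by rewrite G0 // gauss0 mul0r.
  rewrite negb_or !negbK => /andP[/eqP ix /eqP jy].
  pose H := A *m G - G^`.
  have Hle l : N (H i l) * c' l <= x * k * c i.
    have -> : H i l = \sum_p A i p * G p l + - G^` i l.
      by rewrite /H mxE; congr (_ + _); rewrite mxE.
    rewrite -ler_pdivlMr //; apply: (gaussD_le rho01).
      apply: (gauss_sum rho01) => [|p _].
        by rewrite divr_ge0 ?mulr_ge0 ?(ltW x0) ?(ltW (c0 i)) ?(ltW (c'0 l)).
      rewrite gaussM // ler_pdivlMr // -[leLHS]mulrA.
      apply: (@le_trans _ _ (N (A i p) * (k * c p))).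
        by rewrite ler_wpM2l ?gauss_ge0.
      have -> : x * k * c i = k * (th i * c i) by rewrite ix; ring.
      by rewrite mulrCA ler_wpM2l.
    rewrite gaussN // ler_pdivlMr //.
    apply: le_trans (mxle_deriv rho01 c'0 Gk i l) _.
    by rewrite ler_pM2r // ler_wpM2r.
  have GHB : G i j = \sum_l H i l * B' l j.
    have HE : H = G *m A' by rewrite /H -GE addrC addKr.
    transitivity ((G *m (A' *m B')) i j); last by rewrite mulmxA -HE [LHS]mxE.
    rewrite [RHS]mxE (bigD1 j) //= big1 ?addr0 => [|l lj].
      by rewrite (hAB' _ _ _).1 ?eqxx ?mulr1 // jy (le_lt_trans x_ge).
    have [ly|ly] := eqVneq (th' l) y; last by rewrite G0 ?mul0r // ly orbT.
    by rewrite (hAB' _ _ _).1 ?(negPf lj) ?mulr0 // ly (le_lt_trans x_ge).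
  rewrite GHB -ler_pdivlMr //; apply: (gauss_sum rho01) => [|l _].
    by rewrite divr_ge0 // ltW.
  have [->|Bl] := eqVneq (B' l j) 0.
    by rewrite mulr0 gauss0 divr_ge0 // ltW.
  have ly : th' l = y by rewrite (blk' l j) //; right.
  rewrite gaussM // ler_pdivlMr // -[leLHS]mulrA.
  apply: (@le_trans _ _ (N (H i l) * (y^-1 * c' l))).
    by rewrite ler_wpM2l ?gauss_ge0 // -ly.
  have -> : y^-1 * x * k * c i = y^-1 * (x * k * c i) by ring.
  by rewrite mulrCA ler_pM2l ?invr_gt0.
have e01 : 0 <= x^-1 * y < 1.
  by rewrite mulr_ge0 ?invr_ge0 ?(ltW x0) ?(ltW y0) //= mulrC ltr_pdivrMr // mul1r.
apply: (mxle_contract_zero rho01 c0 c'0 e01) => k k0 Gk i j.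
have rhs0 : 0 <= x^-1 * y * k * c i.
  by rewrite !mulr_ge0 ?invr_ge0 ?(ltW x0) ?(ltW y0) ?(ltW (c0 i)).
have [ij|] := boolP ((th i != x) || (th' j != y)).
  by rewrite G0 // gauss0 mul0r.
rewrite negb_or !negbK => /andP[/eqP ix /eqP jy].
pose H := G^` + G *m A'.
have Hle l : N (H l j) * c' j <= y * k * c l.
  have -> : H l j = G^` l j + \sum_p G l p * A' p j.
    by rewrite /H mxE; congr (_ + _); rewrite mxE.
  rewrite -ler_pdivlMr //; apply: (gaussD_le rho01).
    rewrite ler_pdivlMr //.
    apply: le_trans (mxle_deriv rho01 c'0 Gk l j) _.
    by rewrite ler_pM2r // ler_wpM2r.
  have yk0 : 0 <= y * k * c l / c' j.
    by rewrite divr_ge0 ?mulr_ge0 ?(ltW y0) ?(ltW (c0 l)) ?(ltW (c'0 j)).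
  apply: (gauss_sum rho01) => // p _.
  have [->|Ap] := eqVneq (A' p j) 0; first by rewrite mulr0 gauss0.
  have py : th' p = y by rewrite (blk' p j) //; left.
  rewrite gaussM // ler_pdivlMr // -[leLHS]mulrA.
  apply: (@le_trans _ _ (N (G l p) * (y * c' p))).
    by rewrite ler_wpM2l ?gauss_ge0 // -py.
  by rewrite mulrCA -mulrA ler_pM2l.
have GBH : G i j = \sum_l B i l * H l j.
  have HE : H = A *m G by [].
  transitivity ((B *m A *m G) i j); last by rewrite -mulmxA -HE [LHS]mxE.
  rewrite [RHS]mxE (bigD1 i) //= big1 ?addr0 => [|l li].
    by rewrite (hAB _ _ _).2 ?eqxx ?mul1r // ix (le_lt_trans y_ge).
  by rewrite (hAB _ _ _).2 1?eq_sym ?(negPf li) ?mul0r // ix (le_lt_trans y_ge).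
rewrite GBH -ler_pdivlMr //; apply: (gauss_sum rho01) => [|l _].
  by rewrite divr_ge0 // ltW.
rewrite gaussM // ler_pdivlMr // -[leLHS]mulrA.
apply: (@le_trans _ _ (N (B i l) * (y * k * c l))).
  by rewrite ler_wpM2l ?gauss_ge0.
have -> : x^-1 * y * k * c i = y * k * ((th i)^-1 * c i) by rewrite ix; ring.
by rewrite mulrCA ler_wpM2l // mulr_ge0 // ltW.
Qed.

End NormalFormMorphisms.

Section NormalFamilies.
Variables (R : realType) (K : fieldType).
Hypothesis charK : [pchar K] =i pred0.
Local Notation L := (laurent K).
Variables (M : vectType L) (nabla : M -> M).
Hypothesis nablaP : is_connection nabla.

(* b spans a sub-module, on which the slope of b i is lam i. *)
Definition nf_fam (rho : R) n (b : 'I_n -> M) (lam : 'I_n -> R) :=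
  (forall i, 0 <= lam i) /\ exists A B c,
    conn_rep nabla b A /\ nf rho A B (fun i => slope_radius rho (lam i)) c.

Lemma nf_fam_stable rho n (b : 'I_n -> M) lam U :
  nf_fam rho b lam -> spans b U -> submodule nabla U.
Proof.
move=> [_ [A [B [c [bA _]]]]] bU u /bU[d ->]; apply/bU.
by rewrite (nabla_row_comb nablaP _ bA); eexists.
Qed.

Variable rho : R.
Hypothesis rho01 : 0 < rho < 1.

Let rho_gt0 : 0 < rho. Proof. by case/andP: rho01. Qed.

Lemma slope_radius_ge m : 0 <= m -> rho^-1 <= slope_radius rho m.
Proof.
move=> m0; rewrite /slope_radius -powR_inv1 ?(ltW rho_gt0) // powR_le // lerN2.
by rewrite lerDl.
Qed.

Lemma slope_radius_inj : injective (slope_radius rho).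
Proof.
move=> a b h; have : slope_radius rho a <= slope_radius rho b <= slope_radius rho a.
  by rewrite h lexx.
rewrite /slope_radius !powR_le // !lerN2 !lerD2l => /andP[h1 h2].
by apply/eqP; rewrite eq_le h1 h2.
Qed.

Lemma nf_fam_coord m n (b : 'I_m -> M) (b' : 'I_n -> M) lam lam' F :
  nf_fam rho b lam -> nf_fam rho b' lam' -> indep b' ->
  (forall i, b i = row_comb b' (row i F)) ->
  forall i j, F i j != 0 -> lam i = lam' j.
Proof.
move=> [lam0 [A [B [c [bA nfA]]]]] [lam'0 [A' [B' [c' [bA' nfA']]]]] b'i bF i j Fij.
apply: slope_radius_inj.
apply: (nf_hom rho01 nfA nfA' _ _ _ Fij) => [k|k|]; try exact: slope_radius_ge.
exact: (conn_rep_coord nablaP b'i bA' bA bF).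
Qed.

Lemma nf_of_attached P mu : attached nabla P ->
  polygon (\dim {:M}) (fun k => P`_k != 0) (corner R P (\dim {:M})) mu ->
  exists b : 'I_(\dim {:M}) -> M,
    [/\ indep b, spans b fullv & nf_fam rho b (fun i => mu i.+1)].
Proof.
move=> aP pmu; have [Pm sP _] := aP.
have [b [bi bs bC]] := attached_basis nablaP aP.
have [G [A [B [Gu GE nfA]]]] := companion_nf rho01 (mpolygon_slopes pmu rho01).
pose b' i := row_comb b (row i G).
have [bi' bs'] := unit_basis Gu bi bs (fun i => erefl (b' i)).
exists b'; split => //; split.
  by move=> i; apply: (polygon_ge0 pmu).
exists A, B, (fun i : 'I_(\dim {:M}) => weight (slope_radius rho \o mu) i); split => // i.
rewrite /b' (nabla_row_comb nablaP _ bC).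
have -> : row_conn (companion_mx (\dim {:M}) (fun k => P`_k)) (row i G) = row i (A *m G).
  by rewrite /row_conn -GE linearD /= row_mul map_row.
rewrite row_mul -(row_comb_mul (b' := b')) //.
by apply: eq_bigr => j _; rewrite mxE.
Qed.

End NormalFamilies.

(** * Radii of convergence *)

Lemma card_downward n m (p : pred nat) :
  (forall i j, (i <= j < n)%N -> p j -> p i) ->
  (m <= #|[pred i : 'I_n | p i]|)%N <-> (m = 0 \/ (m <= n)%N /\ p m.-1).
Proof.
move=> pd; case: m => [|m]; first by split => // _; left.
split=> [h|[//|[mn pm]]]; last first.
  have inj : injective (widen_ord mn) by move=> i j /(congr1 val) /= h; apply: val_inj.
  rewrite -[X in (X <= _)%N](card_ord m.+1) -(card_image inj xpredT); apply: subset_leq_card.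
  apply/fintype.subsetP => x /fintype.imageP[i _ ->]; rewrite inE /=; apply: pd pm => /=.
  by rewrite mn andbT -ltnS.
right; have mn : (m < n)%N.
  by apply: leq_trans h _; apply: leq_trans (max_card _) _; rewrite card_ord.
split => //=; apply: contraT => pm.
have mE : #|[pred i : 'I_n | (i < m)%N]| = m.
  rewrite -[RHS](card_ord m).
  have inj : injective (widen_ord (ltnW mn)) by move=> i j /(congr1 val) /= e; apply: val_inj.
  rewrite -(card_image inj xpredT); apply: eq_card => i; rewrite !inE.
  apply/idP/fintype.imageP => [im|[j _ ->]] //=.
  by exists (Ordinal im) => //; apply: val_inj.
suff : (m < m)%N by rewrite ltnn.
rewrite -[X in (_ < X)%N]mE; apply: (leq_trans h); apply: subset_leq_card.
apply/fintype.subsetP => i; rewrite !inE => pi; rewrite ltnNge; apply: contra pm => mi.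
by apply: pd pi; rewrite mi ltn_ord.
Qed.

Section GenericRadius.
Variables (R : realType) (K : fieldType) (V : large_extension R K).
Local Notation W := (Omega V).
Variable rho : R.
Hypothesis rho01 : 0 < rho < 1.

Let rho_gt0 : 0 < rho. Proof. by case/andP: rho01. Qed.

Lemma gauss_pointX : (gauss_point rho : berkovich R K) 'X = rho.
Proof.
rewrite /gauss_point (gaussE rho (a := 1)) ?expr1z //=; first by rewrite coefX oner_eq0.
by move=> -[[|k]|k] //= _; rewrite coefX.
Qed.

Lemma leval_poly (z : W) (p : {poly K}) : vabs z = rho ->
  leval z (laurent_of_poly p) = (map_poly (emb V) p).[z].
Proof.
move=> zr; have p0 k : k < 0 -> laurent_of_poly p k = 0 by case: k.
apply/eqP; rewrite -subr_eq0; apply/eqP.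
apply: (vabs_small (C := rho ^ (size p)) rho01) => n.
have := leval_approx rho01 zr p0 (size p + n).
have -> : lpsum z (laurent_of_poly p) 0 (size p + n) = (map_poly (emb V) p).[z].
  rewrite /lpsum expr0z mul1r; congr (map_poly _ _).[_].
  apply/polyP => i; rewrite coef_poly add0r /=; case: ltnP => // h.
  by rewrite nth_default // (leq_trans (leq_addr _ _) h).
by rewrite add0r PoszD expfzDr ?gt_eqF.
Qed.

Lemma point_below_gauss (z : W) : point_below z = (gauss_point rho : berkovich R K) <-> vabs z = rho.
Proof.
split=> [/(congr1 (fun x => x 'X))|zr].
  by rewrite gauss_pointX /point_below map_polyX hornerX.
by apply/funext => p; rewrite /point_below /gauss_point -leval_poly // (vabs_leval rho01).
Qed.

(** On the open disk of radius rho around t the absolute value stays equal to rho, hence the point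
    below does not change; any larger disk contains 0. *)
Lemma generic_radius_gauss (t : W) : vabs t = rho ->
  generic_radius ((gauss_point rho : berkovich R K)) t = rho.
Proof.
move=> tr; rewrite /generic_radius; set E := [set s | _].
have Erho : E rho.
  split => // z zt; apply/point_below_gauss.
  by rewrite -(subrK t z) vabsD_eq // tr.
have Eub : ubound E rho.
  move=> s [s0 sz]; rewrite leNgt; apply/negP => rs.
  have := sz 0; rewrite sub0r vabsN tr => /(_ rs) /point_below_gauss.
  by rewrite vabs0 => h; move: rho_gt0; rewrite h ltxx.
apply/eqP; rewrite eq_le; apply/andP; split; first by apply: ge_sup => //; exists rho.
by apply: ub_le_sup => //; exists rho.
Qed.

End GenericRadius.

Section Radii.
Variables (R : realType) (K : fieldType) (V : large_extension R K).
Local Notation W := (Omega V).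
Local Notation L := (laurent K).
Hypothesis charK : [pchar K] =i pred0.
Variables (M : vectType L) (nabla : M -> M).
Hypothesis nablaP : is_connection nabla.
Local Notation n := (\dim {:M}).

Section AtPoint.
Variables (rho : R) (t : W).
Hypotheses (rho01 : 0 < rho < 1) (t_rho : vabs t = rho).

Let rho_gt0 : 0 < rho. Proof. by case/andP: rho01. Qed.

(** A change of format: [connection_mx] stores derivatives in columns and sections are sequences,
    while [solutions] works with rows and series. The degree k part of the matrix equation is the
    recurrence of [horizontal]. *)
Lemma has_sections_vbasis s m :
  has_sections nabla t s m <->
  solutions charK rho01 t_rho (\matrix_(i, j) connection_mx nabla j i) s m.
Proof.
set A0 := \matrix_(i, j) _.
have coefE (Y : 'M[laurent W]_(m, n)) l i (k : nat) :
    (forall l i, power_series (Y l i)) ->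
    (map_mx (@lderiv _) Y + Y *m map_mx (taylorr charK rho01 t_rho) A0) l i k%:Z =
    Y l i k.+1%:Z *+ k.+1 + \sum_j \sum_(p < k.+1)
       taylor t (connection_mx nabla i j) p * Y l j (k - p)%N%:Z.
  move=> Yps; rewrite mxE laddE; congr (_ + _).
    by rewrite mxE lderivE -PoszD addn1 -pmulrn.
  rewrite mxE lsumE; apply: eq_bigr => j _.
  rewrite mulrC power_seriesM_coef //; last first.
    by rewrite mxE; exact: tau_power_series.
  by apply: eq_bigr => p _; rewrite !mxE taylorrE.
split=> [[Y [Yh Yi]]|[Y [Yps Ycv YE Yi]]].
  pose Z := \matrix_(l < m, i < n) pseries (Y l i).
  have Zps l i : power_series (Z l i) by rewrite mxE => k; exact: pseries_lt.
  exists Z; split => //.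
  - by move=> l i; rewrite mxE; exact: (Yh l).1.
  - apply/matrixP => l i; rewrite [RHS]mxE; apply: power_series_eq0 => [|k].
      move=> k k0; rewrite mxE laddE.
      have -> : (Z *m map_mx (taylorr charK rho01 t_rho) A0) l i k = 0.
        rewrite mxE (@power_series_sum _ _ _ _ _ _ _) // => j _; apply: power_seriesM => //.
        by rewrite mxE; exact: tau_power_series.
      rewrite addr0 mxE lderivE; have [k1|k1] := ltP (k + 1) 0; first by rewrite Zps ?mul0rz.
      have -> : k + 1 = 0 by move: k1 k0; clear; lia.
      by rewrite mulr0z.
    rewrite coefE // -[RHS]((Yh l).2 i k) mxE /=; congr (_ + _).
    by apply: eq_bigr => j _; apply: eq_bigr => p _; rewrite mxE.
  move=> c cZ; apply/rowP => l; rewrite mxE; apply: (Yi (fun l => c 0 l)) => i k.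
  have := congr1 (fun M : 'rV[laurent W]_n => M 0 i k%:Z) cZ; rewrite mxE lsumE mxE => h.
  rewrite -[RHS]/((0 : laurent W) k%:Z) -h.
  by apply: eq_bigr => p _; rewrite [map_mx _ _ _ _]mxE lconstM // mxE.
exists (fun l i k => Y l i k%:Z); split=> [l|c ci l].
  split=> [i|i k]; first exact: Ycv.
  by rewrite -coefE // YE mxE.
have /Yi /rowP/(_ l) : map_mx (@lconst _ _ V) (\row_l c l) *m Y = 0; last by rewrite !mxE.
apply/matrixP => o i; rewrite (ord1 o) [RHS]mxE; apply: power_series_eq0 => [|k].
  rewrite mxE; apply: power_series_sum => j _; apply: power_seriesM => //.
  by rewrite mxE; exact: lconst_ps.
rewrite mxE lsumE -[RHS](ci i k); apply: eq_bigr => p _.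
by rewrite [map_mx _ _ _ _]mxE lconstM // mxE.
Qed.

Lemma has_sections_solutions k (b : 'I_k -> M) A s m : indep b -> spans b fullv ->
  conn_rep nabla b A -> s <= rho ->
  has_sections nabla t s m <-> solutions charK rho01 t_rho A s m.
Proof.
move=> bi bs bA s_rho; have kE := fam_dim bi bs; subst k.
have [vi vs] := vbasis_fam ({:M})%VS; set v := (fun i => _) in vi vs.
have vA : conn_rep nabla v (\matrix_(i, j) connection_mx nabla j i).
  move=> i; rewrite [LHS](coord_vbasis (memvf _)); apply: eq_bigr => j _.
  by rewrite mxE.
have [F vF] := spans_coord bs (fun i => memvf (v i)).
have Fu := coord_unit vs vi bs vF.
have FE := conn_rep_coord nablaP bi bA vA vF.
by rewrite has_sections_vbasis; exact: (solutions_gaugeE charK rho01 t_rho m s_rho Fu FE).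
Qed.

Lemma nf_has_sections k (b : 'I_k -> M) lam s m : indep b -> spans b fullv ->
  nf_fam nabla rho b lam -> 0 < s -> s <= rho ->
  has_sections nabla t s m <->
  (m <= #|[pred i | (slope_radius rho (lam i) <= s^-1)%R]|)%N.
Proof.
move=> bi bs [_ [A [B [c [bA nfA]]]]] s0 s_rho.
rewrite (has_sections_solutions _ bi bs bA s_rho).
exact: (nf_solutions charK rho01 t_rho nfA s0 s_rho).
Qed.

End AtPoint.
End Radii.

(** * Radii in terms of the slopes *)

Section AttachedRadii.
Variables (R : realType) (K : fieldType) (V : large_extension R K).
Local Notation W := (Omega V).
Local Notation L := (laurent K).
Hypothesis charK : [pchar K] =i pred0.
Variable tpt : berkovich R K -> W.
Hypothesis tpt_abs : forall rho : R, 0 < rho < 1 -> vabs (tpt (gauss_point rho)) = rho.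
Variables (M : vectType L) (nabla : M -> M).
Hypothesis nablaP : is_connection nabla.
Local Notation n := (\dim {:M}).

Lemma newton_polygon_exists (P : {poly L}) k : P \is monic -> size P = k.+1 ->
  exists mu, polygon k (fun j => P`_j != 0) (corner R P k) mu.
Proof.
move=> Pm sP.
have [mu pmu] := polygon_exists (nz := fun j => P`_j != 0) (corner R P k) (nz_r Pm sP).
exists mu; have -> // : corner R P k = (fun j => corner R P k j - corner R P k k).
by apply/funext => j; rewrite (corner_r R Pm sP) subr0.
Qed.

Section WithOperator.
Variable P : {poly L}.
Hypothesis aP : attached nabla P.
Local Notation slope := (newton_slope R P).

Lemma attached_polygon : exists mu,
  polygon n (fun j => P`_j != 0) (corner R P n) mu /\
  forall i, (1 <= i <= n)%N -> slope i = mu i.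
Proof.
have [Pm sP _] := aP; have [mu pmu] := newton_polygon_exists Pm sP.
by exists mu; split => // i; exact: newton_slopeE.
Qed.

Lemma newton_slope_mono i j : (1 <= i <= j)%N -> (j <= n)%N -> slope i <= slope j.
Proof.
move=> /andP[i1 ij] jn; have [mu [pmu E]] := attached_polygon.
rewrite !E ?jn ?i1 ?(leq_trans i1 ij) ?(leq_trans ij jn) //.
by apply: (polygon_mono pmu); rewrite ij.
Qed.

Lemma newton_slope_ge0 i : (1 <= i <= n)%N -> 0 <= slope i.
Proof.
move=> i1n; have [mu [pmu E]] := attached_polygon; rewrite E //.
by apply: (polygon_ge0 pmu); case/andP: i1n.
Qed.

Lemma attached_nf rho : 0 < rho < 1 -> exists b : 'I_n -> M,
  [/\ indep b, spans b fullv & nf_fam nabla rho b (fun i => slope i.+1)].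
Proof.
move=> rho01; have [mu [pmu E]] := attached_polygon.
have [b [bi bs nfb]] := nf_of_attached nablaP rho01 aP pmu.
exists b; split => //; have -> // : (fun i : 'I_n => slope i.+1) = (fun i : 'I_n => mu i.+1).
by apply/funext => i; rewrite E // ltn_ord.
Qed.

Section AtRho.
Variable rho : R.
Hypothesis rho01 : 0 < rho < 1.
Local Notation x := (gauss_point rho : berkovich R K).
Local Notation t := (tpt x).

Let rho_gt0 : 0 < rho. Proof. by case/andP: rho01. Qed.
Let t_rho : vabs t = rho. Proof. exact: tpt_abs. Qed.

(** Slopes increase with the index, so at least m of them satisfy the bound of [nf_solutions]
    exactly when the m-th does. *)
Lemma has_sections_attached s m : 0 < s <= rho -> (1 <= m <= n)%N ->
  has_sections nabla t s m <-> s <= rho `^ (1 + slope m).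
Proof.
move=> /andP[s0 s_rho] /andP[m1 mn].
have [b [bi bs nfb]] := attached_nf rho01.
rewrite (nf_has_sections charK nablaP rho01 t_rho _ bi bs nfb s0 s_rho).
have sE k : (slope_radius rho (slope k.+1) <= s^-1) = (s <= rho `^ (1 + slope k.+1)).
  by rewrite /slope_radius powRN lef_pV2 ?posrE ?powR_gt0.
rewrite (card_downward m (p := fun k => slope_radius rho (slope k.+1) <= s^-1)).
  rewrite sE; case: m m1 mn => // m _ mn; rewrite mn.
  by split=> [[//|[]]|]; last by right.
move=> i j /andP[ij jn]; rewrite !sE => /le_trans; apply.
by rewrite powR_le // lerD2l newton_slope_mono.
Qed.

Lemma has_sections0 s : has_sections nabla t s 0.
Proof. by exists (fun _ _ _ => 0); split=> [[]|c _ []]. Qed.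

Lemma sup_le_set (g : R) (p : R -> Prop) : 0 < g <= rho -> (forall s, 0 < s <= rho -> p s <-> s <= g) ->
  sup [set s | 0 < s <= rho /\ p s] = g.
Proof.
move=> /andP[g0 g_rho] pE; set E := [set s | _].
have Eg : E g by split; [rewrite g0 | apply/pE; rewrite ?g0].
have Eub : ubound E g by move=> s [s01 /(pE _ s01)].
apply/eqP; rewrite eq_le; apply/andP; split; first by apply: ge_sup => //; exists g.
by apply: ub_le_sup => //; exists g.
Qed.

(** The i-th radius asks for n + 1 - i sections, whence the index of the slope; dividing by the
    generic radius rho removes the 1 from the exponent [1 + slope]. *)
Lemma conv_radius_attached i : (1 <= i <= n)%N ->
  conv_radius tpt nabla i x = rho `^ slope (n.+1 - i).
Proof.
move=> /andP[i1 i_n]; rewrite /conv_radius (generic_radius_gauss rho01 t_rho).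
have m1n : (1 <= n.+1 - i <= n)%N by move: i1 i_n; clear; lia.
have gE : rho `^ (1 + slope (n.+1 - i)) = rho * rho `^ slope (n.+1 - i).
  by rewrite powRDr // powRr1 // ltW.
rewrite (@sup_le_set (rho `^ (1 + slope (n.+1 - i)))).
- by rewrite gE mulrAC divff ?mul1r ?gt_eqF.
- rewrite powR_gt0 //= -[leRHS]powRr1 ?(ltW rho_gt0) // powR_le // lerDl.
  exact: newton_slope_ge0.
by move=> s s0; exact: has_sections_attached.
Qed.

Lemma full_solutions_attached sigma : 0 < sigma <= 1 ->
  full_solutions tpt nabla x sigma <-> (n = 0 \/ sigma <= rho `^ slope n).
Proof.
move=> /andP[s0 s1]; rewrite /full_solutions (generic_radius_gauss rho01 t_rho).
have [n0|n0] := posnP n; first by split=> _; [left | rewrite n0; exact: has_sections0].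
rewrite has_sections_attached ?leqnn ?n0 //; last first.
  by rewrite mulr_gt0 //= ler_piMl // ltW.
rewrite powRDr // powRr1 ?(ltW rho_gt0) // mulrC ler_pM2l //.
by split=> [|[n0'|//]]; [right | move: n0; rewrite n0'].
Qed.

End AtRho.

End WithOperator.

Lemma half01 : 0 < (2^-1 : R) < 1.
Proof. by rewrite invr_gt0 ltr0n invf_lt1 // ltr1n. Qed.

Lemma powR_inj rho : 0 < rho < 1 -> injective (fun a : R => rho `^ a).
Proof.
move=> rho01 a b /= h; have : rho `^ a <= rho `^ b <= rho `^ a by rewrite h lexx.
by rewrite !powR_le // => /andP[h1 h2]; apply/eqP; rewrite eq_le h1 h2.
Qed.

Lemma conv_radius_slopes mu rho i : formal_slopes nabla mu -> 0 < rho < 1 ->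
  (1 <= i <= n)%N ->
  conv_radius tpt nabla i (gauss_point rho) = rho `^ mu (n.+1 - i)%N.
Proof.
move=> [P aP muE] rho01 i1n; rewrite (conv_radius_attached aP) // muE //.
by move: i1n; clear; lia.
Qed.

(** Radii do not refer to an operator and rho ^ a determines a, so a single rho suffices to identify
    the slopes. This is the independence of the Newton slopes from the cyclic basis. *)
Lemma slopes_of_radii rho mu nu : 0 < rho < 1 -> formal_slopes nabla mu ->
  (forall i, (1 <= i <= n)%N ->
     conv_radius tpt nabla i (gauss_point rho) = rho `^ nu (n.+1 - i)%N) ->
  forall i, (1 <= i <= n)%N -> nu i = mu i.
Proof.
move=> rho01 fmu h i i1n; apply: (powR_inj rho01) => /=.
have j1n : (1 <= n.+1 - i <= n)%N by move: i1n; clear; lia.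
have := h _ j1n; rewrite (conv_radius_slopes fmu) //.
by have -> : (n.+1 - (n.+1 - i))%N = i by move: i1n; clear; lia.
Qed.

Lemma formal_slopes_exist : exists mu : nat -> R, formal_slopes nabla mu.
Proof. by have [P aP] := attached_exists nablaP charK; exists (newton_slope R P), P. Qed.

Lemma cm_slopesP (beta : nat -> R) : cm_slopes tpt nabla beta <-> formal_slopes nabla beta.
Proof.
split=> [[_ [eps /andP[e0 e1] h]]|fb].
  have [mu fmu] := formal_slopes_exist.
  have e2 : 0 < eps / 2 < eps by rewrite divr_gt0 //= ltr_pdivrMr // ltr_pMr // ltr1n.
  have [P aP muE] := fmu; exists P => // i i1n; rewrite -muE //.
  case/andP: e2 => e2 e3.
  (* Christol-Mebkhout slopes are constrained only for rho near 1; one value inside the given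
     interval is enough. *)
  apply: (@slopes_of_radii (1 - eps / 2)) => // [|j j1n].
    by rewrite subr_gt0 (lt_trans e3) //= ltrBlDr ltrDl.
  by apply: h => //; rewrite ltrD2l ltrN2 e3 ltrBlDr ltrDl.
have [P aP bE] := fb; split=> [i j i1 /andP[ij jn]|].
  rewrite !bE ?jn ?i1 ?(leq_trans i1 ij) ?(leq_trans ij jn) //.
  by apply: (newton_slope_mono aP); rewrite ?i1.
exists (2^-1); first exact: half01.
move=> rho i /andP[r1 r2] i1n; apply: conv_radius_slopes => //.
by rewrite r2 andbT (lt_trans _ r1) // subr_gt0; case/andP: half01.
Qed.

End AttachedRadii.

(** * Decompositions by the slopes *)

Section Submodules.
Variables (R : realType) (K : fieldType).
Local Notation L := (laurent K).
Hypothesis charK : [pchar K] =i pred0.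
Variables (M : vectType L) (nabla : M -> M).
Hypothesis nablaP : is_connection nabla.
Implicit Types U : {vspace M}.

Lemma restrict_connE U (u : subvs_of U) : submodule nabla U ->
  vsval (restrict_conn nabla u) = nabla (vsval u).
Proof. by move=> Us; rewrite /restrict_conn vsprojK // Us // subvsP. Qed.

Lemma restrict_conn_connection U : submodule nabla U ->
  is_connection (@restrict_conn K M nabla U).
Proof.
move=> Us; split=> [u v|f u]; apply: val_inj; rewrite /=.
  by rewrite !restrict_connE // linearD /= nablaD // -!restrict_connE.
by rewrite !restrict_connE // linearZ /= nablaZ // -!restrict_connE.
Qed.

Lemma dim_subvs_of U : \dim {:subvs_of U} = \dim U.
Proof. by rewrite dimvf. Qed.

Lemma vsval_fam U n (b : 'I_n -> subvs_of U) c :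
  row_comb (fun i => vsval (b i)) c = vsval (row_comb b c).
Proof. by rewrite /row_comb linear_sum; apply: eq_bigr => i _; rewrite linearZ. Qed.

Lemma vsval_indep U n (b : 'I_n -> subvs_of U) : indep b <-> indep (fun i => vsval (b i)).
Proof.
have z : vsval (0 : subvs_of U) = 0 by exact: linear0.
split=> h c; last by move=> e; apply: h; rewrite vsval_fam e z.
by rewrite vsval_fam => e; apply: h; apply: val_inj; exact: etrans e (esym z).
Qed.

Lemma vsval_spans U n (b : 'I_n -> subvs_of U) :
  spans b fullv <-> spans (fun i => vsval (b i)) U.
Proof.
split=> h u; split.
- move=> uU; have [c cE] := (h (vsproj U u)).1 (memvf _).
  by exists c; rewrite vsval_fam -cE vsprojK.
- by move=> [c ->]; rewrite vsval_fam subvsP.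
- move=> _; have [c cE] := (h (vsval u)).1 (subvsP u); exists c; apply: val_inj.
  by rewrite /= -vsval_fam.
by move=> _; exact: memvf.
Qed.

Lemma vsval_nf U rho n (b : 'I_n -> subvs_of U) (lam : 'I_n -> R) : submodule nabla U ->
  nf_fam (@restrict_conn K M nabla U) rho b lam -> nf_fam nabla rho (fun i => vsval (b i)) lam.
Proof.
move=> Us [l0 [A [B [c [bA nfA]]]]]; split => //; exists A, B, c; split => // i.
by rewrite -restrict_connE // bA linear_sum; apply: eq_bigr => j _; rewrite linearZ.
Qed.

Variable rho : R.
Hypothesis rho01 : 0 < rho < 1.

Lemma sub_nf U P : submodule nabla U -> attached (@restrict_conn K M nabla U) P ->
  exists b : 'I_(\dim {:subvs_of U}) -> M,
    [/\ indep b, spans b U & nf_fam nabla rho b (fun i => newton_slope R P i.+1)].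
Proof.
move=> Us aP; have [b [bi bs nfb]] := attached_nf (restrict_conn_connection Us) aP rho01.
exists (fun i => vsval (b i)); split; first exact/vsval_indep.
  exact/vsval_spans.
exact: vsval_nf.
Qed.

(** An operator attached to U has a normal form of its own, whose slopes are compared with a through
    a nonzero entry of the matrix between the two bases. A normal form at one rho thus yields formal
    slopes, which do not mention rho. *)
Lemma formal_of_nf U n (b : 'I_n -> M) a : indep b -> spans b U ->
  nf_fam nabla rho b (fun=> a) -> formal_slopes (@restrict_conn K M nabla U) (fun=> a).
Proof.
move=> bi bs nfb; have Us := nf_fam_stable nablaP nfb bs.
have [P aP] := attached_exists (restrict_conn_connection Us) charK.
exists P => // i i1n; have [b' [bi' bs' nfb']] := sub_nf Us aP.
case: i i1n => // i /andP[_ i_n].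
have [F b'F] := spans_coord bs (fun i => @spans_mem _ _ _ _ _ i bs').
have [j Fij] : exists j, F (Ordinal i_n) j != 0.
  apply: contrapT => h; have /bi' /rowP/(_ (Ordinal i_n)) :
      row_comb b' (delta_mx 0 (Ordinal i_n)) = 0.
    rewrite row_comb_delta b'F /row_comb big1 // => j _; rewrite mxE.
    have [->|Fj] := eqVneq (F (Ordinal i_n) j) 0; first by rewrite scale0r.
    by case: h; exists j.
  by rewrite !mxE !eqxx => /eqP; rewrite oner_eq0.
by have := nf_fam_coord nablaP rho01 nfb' nfb bi b'F Fij => /= ->.
Qed.

Lemma nf_of_formal U a : submodule nabla U ->
  formal_slopes (@restrict_conn K M nabla U) (fun=> a) ->
  exists b : 'I_(\dim {:subvs_of U}) -> M,
    [/\ indep b, spans b U & nf_fam nabla rho b (fun=> a)].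
Proof.
move=> Us [P aP aE]; have [b [bi bs nfb]] := sub_nf Us aP.
exists b; split => //; have -> // : (fun=> a) = (fun i : 'I_(\dim {:subvs_of U}) => newton_slope R P i.+1).
by apply/funext => i; exact: (aE i.+1 (ltn_ord i)).
Qed.

Section Pieces.
Variables (r : nat) (b : 'I_r -> M) (lam : 'I_r -> R) (U0 : {vspace M}).
Hypotheses (bi : indep b) (bs : spans b U0) (nfb : nf_fam nabla rho b lam).

Definition slope_piece (a : R) : {vspace M} := (\sum_(i | lam i == a) <[b i]>)%VS.

Definition piece_fam a (k : 'I_#|[pred i | lam i == a]|) : M := b (enum_val k).

Lemma piece_row_comb a c : row_comb (@piece_fam a) c =
  row_comb b (c *m \matrix_(k, i) (enum_val k == i)%:R).
Proof.
apply: row_comb_mul => k; rewrite -[LHS](row_comb_delta b); congr (row_comb b _).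
by apply/rowP => i; rewrite !mxE eqxx eq_sym.
Qed.

Lemma piece_indep a : indep (@piece_fam a).
Proof.
move=> c; rewrite piece_row_comb => /bi h; apply/rowP => k.
have := congr1 (fun r : 'rV[L]_r => r 0 (enum_val k)) h; rewrite !mxE.
rewrite (bigD1 k) //= big1 ?addr0 => [|l lk]; first by rewrite mxE eqxx mulr1.
by rewrite mxE (inj_eq enum_val_inj) (negPf lk) mulr0.
Qed.

Lemma piece_spans a : spans (@piece_fam a) (slope_piece a).
Proof.
move=> u; split=> [/memv_sumP[v vb ->]|[c ->]]; last first.
  apply: memv_suml => k _; apply: memvZ; apply: subvP (memv_line _).
  by apply: (sumv_sup (enum_val k)) => //; exact: (enum_valP k).
have /choice[f fP] i : exists f, lam i == a -> v i = f *: b i.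
  have [ia|_] := boolP (lam i == a); last by exists 0.
  by have /vlineP[f ->] := vb i ia; exists f.
exists (\row_k f (enum_val k)); rewrite /row_comb.
rewrite (eq_bigr (fun i => f i *: b i)) => [|i ia]; last exact: fP.
rewrite (eq_bigl (mem [pred i | lam i == a])) // big_enum_val /=.
by apply: eq_bigr => k _; rewrite mxE.
Qed.

(** A and B are block diagonal, so their restrictions to the indices of slope a still multiply as
    the full matrices do and keep every bound. *)
Lemma piece_nf a : nf_fam nabla rho (@piece_fam a) (fun=> a).
Proof.
have [l0 [A [B [c [bA [c0 blk hA hB hAB]]]]]] := nfb.
have th_inj := slope_radius_inj rho01.
have lamk (k : 'I_#|[pred i | lam i == a]|) : lam (enum_val k) = a by apply/eqP; exact: (enum_valP k).
have out (C : 'M[L]_r) (k : 'I_#|[pred i | lam i == a]|) i :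
    (forall i j, C i j != 0 -> slope_radius rho (lam i) = slope_radius rho (lam j)) ->
    lam i != a -> C (enum_val k) i = 0.
  move=> Cblk ia; apply/eqP; apply: contraNT ia => /Cblk /th_inj <-.
  by rewrite lamk.
have blkA i j : A i j != 0 -> slope_radius rho (lam i) = slope_radius rho (lam j) by move=> h; apply: blk; left.
have blkB i j : B i j != 0 -> slope_radius rho (lam i) = slope_radius rho (lam j) by move=> h; apply: blk; right.
split=> [k|]; first by rewrite -(lamk k).
pose res (C : 'M[L]_r) : 'M[L]_#|[pred i | lam i == a]| := \matrix_(k, l) C (enum_val k) (enum_val l).
have sumE (T : nmodType) (f : 'I_r -> T) : (forall i, lam i != a -> f i = 0) ->
    \sum_i f i = \sum_(k < #|[pred i | lam i == a]|) f (enum_val k).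
  move=> f0; rewrite (bigID (fun i => lam i == a)) /= [X in _ + X]big1 ?addr0 //.
  by rewrite (eq_bigl (mem [pred i | lam i == a])) // big_enum_val.
have resM (C D : 'M[L]_r) :
   (forall i j, C i j != 0 -> slope_radius rho (lam i) = slope_radius rho (lam j)) ->
   forall k l, (res C *m res D) k l = (C *m D) (enum_val k) (enum_val l).
  move=> Cblk k l; rewrite !mxE sumE => [|i ia]; last by rewrite (out C) // mul0r.
  by apply: eq_bigr => p _; rewrite !mxE.
exists (res A), (res B), (fun k => c (enum_val k)); split.
  move=> k; rewrite /piece_fam bA sumE => [|i ia]; last by rewrite (out A) // scale0r.
  by apply: eq_bigr => l _; rewrite mxE.
split=> // [k l|k l|k l ak].
- by rewrite mxE; have := hA (enum_val k) (enum_val l); rewrite lamk.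
- by rewrite mxE; have := hB (enum_val k) (enum_val l); rewrite lamk.
rewrite !resM //; have [] := hAB (enum_val k) (enum_val l); first by rewrite lamk.
by rewrite (inj_eq enum_val_inj) => -> ->.
Qed.

Lemma piece_dim a : \dim (slope_piece a) = #|[pred i | lam i == a]|.
Proof. exact: fam_dim (@piece_indep a) (@piece_spans a). Qed.

Lemma piece_stable a : submodule nabla (slope_piece a).
Proof. exact: nf_fam_stable (piece_nf a) (@piece_spans a). Qed.

Lemma piece_formal a : formal_slopes (@restrict_conn K M nabla (slope_piece a)) (fun=> a).
Proof. exact: formal_of_nf (@piece_indep a) (@piece_spans a) (piece_nf a). Qed.

(** In the coordinates of the generators of U, only the vectors [b j] of slope a can occur, by
    [nf_fam_coord]. All uniqueness statements rest on this inclusion. *)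
Lemma formal_sub_piece U a : (U <= U0)%VS -> submodule nabla U ->
  formal_slopes (@restrict_conn K M nabla U) (fun=> a) -> (U <= slope_piece a)%VS.
Proof.
move=> UU0 Us fU; have [b' [bi' bs' nfb']] := nf_of_formal Us fU.
have [F b'F] := spans_coord bs (fun i => subvP UU0 _ (@spans_mem _ _ _ _ _ i bs')).
apply/subvP => u /bs'[c ->]; apply: memv_suml => i _; apply: memvZ; rewrite b'F.
apply: memv_suml => j _; rewrite mxE.
have [->|Fij] := eqVneq (F i j) 0; first by rewrite scale0r mem0v.
apply: memvZ; apply: subvP (memv_line _); apply: (sumv_sup j) => //.
by have := nf_fam_coord nablaP rho01 nfb' nfb bi b'F Fij => /= <-.
Qed.

Definition slopes : seq R := undup [seq lam i | i <- enum 'I_r].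

Lemma mem_slopes i : lam i \in slopes.
Proof. by rewrite mem_undup map_f // mem_enum. Qed.

Lemma slopesP a : a \in slopes -> exists i, lam i = a.
Proof. by rewrite mem_undup => /mapP[i _ ->]; exists i. Qed.

Lemma slopes_ge0 a : a \in slopes -> 0 <= a.
Proof. by move=> /slopesP[i <-]; case: nfb. Qed.

Lemma piece_neq0 a : (slope_piece a != 0%VS) = (a \in slopes).
Proof.
rewrite -dimv_eq0 piece_dim; rewrite -lt0n; apply/idP/idP => [/card_gt0P[i]|/slopesP[i ia]].
  by rewrite inE => /eqP <-; exact: mem_slopes.
apply/card_gt0P; exists i; by rewrite inE ia.
Qed.

Lemma sum_piece_dim (s : seq R) : uniq s -> {subset slopes <= s} ->
  (\sum_(a <- s) \dim (slope_piece a))%N = r.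
Proof.
move=> us sub; rewrite (eq_bigr (fun a => \sum_(i | lam i == a) 1)%N) => [|a _]; last first.
  by rewrite piece_dim sum1_card.
rewrite (exchange_big_dep xpredT) //= -[RHS]card_ord -sum1_card; apply: eq_bigr => i _.
rewrite -big_filter sum1_size.
have -> : [seq a <- s | lam i == a] = [seq a <- s | a == lam i] by apply: eq_filter => a; rewrite eq_sym.
by rewrite (filter_pred1_uniq us) // sub // mem_slopes.
Qed.

Lemma sum_pieces (s : seq R) : uniq s -> {subset slopes <= s} ->
  (\sum_(a <- s) slope_piece a)%VS = U0.
Proof.
move=> us sub; apply/eqP; rewrite eqEsubv; apply/andP; split.
  apply: (big_ind (fun U => U <= U0)%VS) => [|x y hx hy|a _]; first exact: sub0v.
    by rewrite subv_add hx.
  apply/subv_sumP => i _; rewrite -memvE; exact: (@spans_mem _ _ _ _ _ i bs).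
apply/subvP => u /bs[c ->]; apply: memv_suml => i _; apply: memvZ.
have := sub _ (mem_slopes i) => ia.
rewrite (big_rem _ ia) /=; apply: subvP (addvSl _ _) _ _.
by apply: subvP (memv_line _); apply: (sumv_sup i).
Qed.

End Pieces.
End Submodules.

(** * Uniqueness of the three decompositions *)

Section Decompositions.
Variables (R : realType) (K : fieldType) (V : large_extension R K).
Local Notation W := (Omega V).
Local Notation L := (laurent K).
Hypothesis charK : [pchar K] =i pred0.
Variable tpt : berkovich R K -> W.
Hypothesis tpt_abs : forall rho : R, 0 < rho < 1 -> vabs (tpt (gauss_point rho)) = rho.
Variables (M : vectType L) (nabla : M -> M).
Hypothesis nablaP : is_connection nabla.
Local Notation n := (\dim {:M}).
Local Notation restr U := (@restrict_conn K M nabla U).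

Lemma directv_dims (s : seq R) (N : R -> {vspace M}) :
  directv (\sum_(a <- s) N a)%VS -> (\sum_(a <- s) N a)%VS = fullv ->
  (\sum_(a <- s) \dim (N a))%N = n.
Proof. by move=> /directvP /= <- ->. Qed.

Lemma dims_directv (s : seq R) (N : R -> {vspace M}) :
  (\sum_(a <- s) \dim (N a))%N = n -> (\sum_(a <- s) N a)%VS = fullv ->
  directv (\sum_(a <- s) N a)%VS.
Proof. by move=> sN NE; rewrite directvEgeq /= sN NE. Qed.

Variables (b : 'I_n -> M) (lam : 'I_n -> R).
Hypotheses (bi : indep b) (bs : spans b fullv) (nfb : nf_fam nabla (2^-1 : R) b lam).
Local Notation N := (slope_piece b lam).
Let h01 := half01 R.

(** If one of the inclusions were strict, the total dimension of the Q a would be smaller than n. *)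
Lemma pieces_unique (Q : R -> {vspace M}) (s : seq R) : uniq s ->
  (forall a, (Q a <= N a)%VS) -> (forall a, a \notin s -> Q a = 0%VS) ->
  (\sum_(a <- s) \dim (Q a))%N = n -> forall a, Q a = N a.
Proof.
move=> us QN Q0 Qn a; apply/eqP; rewrite eqEdim QN /= leqNgt; apply/negP => lt.
(* The support is enlarged to contain a and every slope, so that the dimensions of the pieces over
   it also add up to n. *)
pose s' := undup (a :: s ++ slopes lam).
have us' : uniq s' by exact: undup_uniq.
have as' : a \in s' by rewrite mem_undup mem_head.
have Qn' : (\sum_(x <- s') \dim (Q x))%N = n.
  rewrite -Qn (bigID (mem s)) /= [X in (_ + X)%N]big1 ?addn0 => [|x /Q0 ->]; last by rewrite dimv0.
  rewrite -big_filter; apply: perm_big; apply: uniq_perm => // [|x]; first exact: filter_uniq.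
  rewrite mem_filter mem_undup inE mem_cat.
  by case: (x \in s); rewrite ?orbT.
have : (\sum_(x <- s') \dim (Q x) < \sum_(x <- s') \dim (N x))%N.
  rewrite !(big_rem _ as') /= -addSn leq_add //.
  by apply: leq_sum => x _; apply: dimvS.
rewrite Qn' (sum_piece_dim bi us') ?ltnn // => x xs.
by rewrite mem_undup inE mem_cat xs !orbT.
Qed.

Lemma formal_unique (F : R -> {vspace M}) (s : seq R) : uniq s ->
  (forall a, submodule nabla (F a)) ->
  (forall a, formal_slopes (restr (F a)) (fun=> a)) ->
  (forall a, a \notin s -> F a = 0%VS) ->
  (\sum_(a <- s) \dim (F a))%N = n -> forall a, F a = N a.
Proof.
move=> us Fs Ff F0 Fn; apply: (pieces_unique us _ F0 Fn) => a.
exact: (formal_sub_piece nablaP h01 bi bs nfb (subvf _)).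
Qed.

Lemma piece_decomposition : decomposition nabla setT N.
Proof.
split=> [a _|]; first exact: (piece_stable nablaP h01 nfb).
have us : uniq (slopes lam) := undup_uniq _.
have sN := sum_pieces bs us (fun=> id).
exists (slopes lam); split => // [a _|].
  by apply: contraNeq; rewrite (piece_neq0 _ bi).
by apply: dims_directv => //; exact: (sum_piece_dim bi us).
Qed.

Lemma formal_decompositionP F : formal_decomposition nabla F <-> (forall mu, F mu = N mu).
Proof.
split=> [[[Fs [s [us sA F0 Fd Ff]]] Fm]|FN].
  apply: (formal_unique us) => // [a|a|]; first exact: Fs.
    by move=> h; exact: F0.
  exact: directv_dims.
have -> : F = N by apply/funext.
split; first exact: piece_decomposition.
by move=> a; exact: (piece_formal charK nablaP h01 bi nfb).
Qed.

Lemma restr_connection U : submodule nabla U -> is_connection (restr U).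
Proof. exact: restrict_conn_connection. Qed.

Lemma cm_decompositionP C : cm_decomposition tpt nabla C <-> (forall beta, C beta = N beta).
Proof.
rewrite -formal_decompositionP; split=> -[[Cs Cd] Cm]; split => // a.
  by apply/(cm_slopesP charK tpt_abs (restr_connection (Cs a I))).
by apply/(cm_slopesP charK tpt_abs (restr_connection (Cs a I))).
Qed.

(** * Robba's decomposition at one point *)

Section Robba.
Variable rho : R.
Hypothesis rho01 : 0 < rho < 1.
Local Notation x := (gauss_point rho : berkovich R K).

Let rho_gt0 : 0 < rho. Proof. by case/andP: rho01. Qed.

Lemma log_ge0 (s : R) : 0 < s <= 1 -> 0 <= ln s / ln rho.
Proof.
move=> /andP[s0 s1]; rewrite mulr_le0 //; first exact: ln_le0.
by rewrite invr_le0 ltW // ln_lt0.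
Qed.

Lemma powR_log (s : R) : 0 < s -> rho `^ (ln s / ln rho) = s.
Proof.
move=> s0; rewrite /powR (gt_eqF rho_gt0) divfK ?lnK //.
by rewrite lt_eqF // ln_lt0.
Qed.

Lemma log_powR (a : R) : ln (rho `^ a) / ln rho = a.
Proof. by rewrite ln_powR mulfK // lt_eqF // ln_lt0. Qed.

Lemma powR_01 (a : R) : 0 <= a -> 0 < rho `^ a <= 1.
Proof. by move=> a0; rewrite powR_gt0 //= -(powRr0 rho) powR_le. Qed.

Lemma full_solutions_formal U a s : submodule nabla U ->
  formal_slopes (restr U) (fun=> a) -> 0 < s <= 1 ->
  full_solutions tpt (restr U) x s <-> (U = 0%VS \/ s <= rho `^ a).
Proof.
move=> Us [P aP aE] s01.
rewrite (full_solutions_attached charK tpt_abs (restr_connection Us) aP rho01 s01).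
have [U0|U0] := posnP (\dim {:subvs_of U}).
  split=> [_|_]; last by left.
  by left; apply/eqP; rewrite -dimv_eq0 -dim_subvs_of U0.
rewrite -aE ?leqnn ?U0 //; split=> -[h|h]; try by right.
  by move: U0; rewrite h.
by move: U0; rewrite dim_subvs_of h dimv0.
Qed.

(** The full basis of solutions bounds every slope by a = ln sigma / ln rho. A strictly smaller
    slope would have a nonzero piece inside U with a full basis on a larger disk, against the
    maximality condition. *)
Lemma robba_pure U sigma : 0 < sigma <= 1 -> submodule nabla U ->
  full_solutions tpt (restr U) x sigma ->
  (forall (U' : {vspace M}) sigma', sigma < sigma' <= 1 ->
      submodule nabla U' -> (U' <= U)%VS ->
      full_solutions tpt (restr U') x sigma' -> U' = 0%VS) ->
  formal_slopes (restr U) (fun=> ln sigma / ln rho).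
Proof.
move=> s01 Us Ufull Umax; have /andP[s0 s1] := s01.
have [P aP] := attached_exists (restr_connection Us) charK.
exists P => // i i1n; have /andP[i1 i_n] := i1n.
have n0 : (0 < \dim {:subvs_of U})%N by exact: leq_trans i_n.
move: Ufull; rewrite (full_solutions_attached charK tpt_abs (restr_connection Us) aP rho01 s01).
case=> [h|]; first by rewrite h in n0.
rewrite -{1}(powR_log s0) powR_le // => top.
have le_i : newton_slope R P i <= ln sigma / ln rho.
  by apply: le_trans top; apply: (newton_slope_mono R aP) => //; rewrite i1.
apply/le_anti; rewrite le_i andbT leNgt; apply/negP => lt_i.
have [b' [bi' bs' nfb']] := sub_nf nablaP rho01 Us aP.
set lam' := (fun i => _) in nfb'; set a := newton_slope R P i in le_i lt_i.
have a0 : 0 <= a by exact: (newton_slope_ge0 R aP).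
have pf := piece_formal charK nablaP rho01 bi' nfb' a.
have ps : submodule nabla (slope_piece b' lam' a) := piece_stable nablaP rho01 nfb' (a := a).
have pU : (slope_piece b' lam' a <= U)%VS.
  by apply/subv_sumP => j _; rewrite -memvE; exact: (@spans_mem _ _ _ _ _ j bs').
have sa : sigma < rho `^ a <= 1.
  have /andP[_ ->] := powR_01 a0; rewrite andbT -{1}(powR_log s0) powR_lt //.
have := Umax _ _ sa ps pU.
rewrite (full_solutions_formal ps pf); last exact: powR_01.
have im : (i.-1 < \dim {:subvs_of U})%N by rewrite prednK.
have : slope_piece b' lam' a != 0%VS.
  rewrite (piece_neq0 _ bi'); have -> : a = lam' (Ordinal im) by rewrite /lam' /= prednK.
  exact: mem_slopes.
by move=> /eqP p0 h; apply: p0; apply: h; right.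
Qed.

Lemma robba_decompositionP Q : robba_decomposition tpt nabla x Q <->
  (forall sigma, 0 < sigma <= 1 -> Q sigma = N (ln sigma / ln rho)).
Proof.
split=> [[[Qs [s [us sA Q0 Qd Qf]]] Qfull] sigma s01|QN].
  (* Reindexing sigma = rho^a by the slope a. No sigma in ]0, 1] corresponds to a negative a, where
     0 is put. *)
  pose F a := if 0 <= a then Q (rho `^ a) else 0%VS.
  have FE t : 0 < t <= 1 -> F (ln t / ln rho) = Q t.
    by move=> t01; rewrite /F log_ge0 // powR_log //; case/andP: t01.
  rewrite -FE //; have F_slopes a : submodule nabla (F a) /\ formal_slopes (restr (F a)) (fun=> a).
    rewrite /F; case: ifP => a0; last first.
      have z : submodule nabla (0%VS : {vspace M}).
        by move=> u; rewrite memv0 => /eqP ->; rewrite (nabla0 nablaP) mem0v.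
      split => //; have [mu [P aP muE]] := formal_slopes_exist R charK (restr_connection z).
      exists P => // i; rewrite dim_subvs_of dimv0 => /andP[i1 i0].
      by move: (leq_trans i1 i0).
    have a01 := powR_01 a0; split; first exact: Qs.
    have := Qfull _ a01 => -[f1 f2].
    by have := robba_pure a01 (Qs _ a01) f1 f2; rewrite log_powR.
  apply: (formal_unique (s := [seq ln t / ln rho | t <- s])).
  - rewrite map_inj_in_uniq // => t1 t2 /sA /andP[t10 _] /sA /andP[t20 _] e.
    by rewrite -(powR_log t10) e powR_log.
  - by move=> a; case: (F_slopes a).
  - by move=> a; case: (F_slopes a).
  - move=> a as'; rewrite /F; case: ifP => // a0.
    apply: Q0; first exact: powR_01.
    apply: contra as' => h; apply/mapP; exists (rho `^ a) => //.
    by rewrite log_powR.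
  rewrite big_map -(directv_dims Qd Qf) !big_seq; apply: eq_bigr => t /sA t01.
  by rewrite FE.
have us : uniq (slopes lam) := undup_uniq _.
have lam0 a : a \in slopes lam -> 0 <= a := slopes_ge0 nfb (a := a).
pose s := [seq rho `^ a | a <- slopes lam].
have QE a : a \in slopes lam -> Q (rho `^ a) = N a.
  by move=> /lam0 /powR_01 a01; rewrite QN // log_powR.
have sQ : (\sum_(a <- s) Q a)%VS = fullv.
  rewrite big_map; apply: etrans (sum_pieces bs us (fun=> id)).
  rewrite big_seq [in RHS]big_seq.
  by apply: eq_bigr => a; exact: QE.
split; last first.
  move=> sigma s01; have /andP[s0 s1] := s01.
  have ps : submodule nabla (N (ln sigma / ln rho)) := piece_stable nablaP h01 nfb (a := _).
  have pf := piece_formal charK nablaP h01 bi nfb (ln sigma / ln rho).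
  rewrite QN //; split; first by apply/(full_solutions_formal ps pf s01); right; rewrite powR_log.
  (* Full solutions for the larger [sigma'] make every slope of U at most ln sigma' / ln rho,
     strictly below the slope of the block since ln rho < 0. The matrix of the inclusion then
     vanishes. *)
  move=> U sigma' /andP[ss s'1] Us UN.
  have s'01 : 0 < sigma' <= 1 by rewrite s'1 (lt_trans s0).
  have s'0 : 0 < sigma' by case/andP: s'01.
  have [P aP] := attached_exists (restr_connection Us) charK.
  rewrite (full_solutions_attached charK tpt_abs (restr_connection Us) aP rho01 s'01).
  have [U0 _|U0] := posnP (\dim {:subvs_of U}).
    by apply/eqP; rewrite -dimv_eq0 -dim_subvs_of U0.
  case=> [h|]; first by rewrite h in U0.
  rewrite -{1}(powR_log s'0) powR_le // => top.
  have [b' [bi' bs' nfb']] := sub_nf nablaP h01 Us aP.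
  have pi : indep (@piece_fam _ _ _ _ b lam (ln sigma / ln rho)) := piece_indep bi (a := _).
  have pn := piece_nf h01 nfb (ln sigma / ln rho).
  have [F b'F] := spans_coord (piece_spans b lam (ln sigma / ln rho))
    (fun i => subvP UN _ (@spans_mem _ _ _ _ _ i bs')).
  have F0 i j : F i j = 0.
    apply/eqP/negPn/negP => Fij.
    have := nf_fam_coord nablaP h01 nfb' pn pi b'F Fij => /= le.
    have : ln sigma / ln rho <= ln sigma' / ln rho.
      rewrite -le; apply: le_trans top.
      by apply: (newton_slope_mono R aP) => //; exact: ltn_ord.
    by rewrite -(powR_le rho01) !powR_log // leNgt ss.
  apply/eqP; rewrite -subv0; apply/subvP => u /bs'[c ->].
  rewrite (row_comb_mul _ b'F); have -> : F = 0 by apply/matrixP => i j; rewrite F0 mxE.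
  by rewrite mulmx0 /row_comb big1 ?mem0v // => i _; rewrite mxE scale0r.
split=> [sigma s01|].
  by rewrite QN //; exact: (piece_stable nablaP h01 nfb).
exists s; split => //.
- by rewrite map_inj_uniq //; exact: powR_inj.
- by move=> _ /mapP[a /lam0 /powR_01 ? ->].
- move=> t t01 ts; rewrite QN //; apply/eqP; apply: contraNT ts.
  rewrite (piece_neq0 _ bi) => h; apply/mapP; exists (ln t / ln rho) => //.
  by rewrite powR_log //; case/andP: t01.
apply: dims_directv => //.
rewrite big_map; apply: etrans (sum_piece_dim bi us (fun=> id)).
rewrite big_seq [in RHS]big_seq.
by apply: eq_bigr => a ha; rewrite QE.
Qed.

End Robba.
End Decompositions.

(** * The Berkovich punctured disk *)

Section Berkovich.
Variables (R : realType) (K : fieldType) (V : large_extension R K).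
Implicit Types x y : berkovich R K.

Lemma affine_lineN x p : affine_line x -> x (- p) = x p.
Proof.
move=> [_ _ xc xM _]; rewrite -mulN1r -polyC1 -polyCN xM xc ?mul1r //.
by rewrite oppr_eq0 oner_eq0.
Qed.

Lemma affine_line_le1 x p : affine_line x -> x 'X < 1 -> x p <= 1.
Proof.
move=> [x0 xz xc xM xD] X1; elim/poly_ind: p => [|p c IH]; first by rewrite xz.
apply: (le_trans (xD _ _)); rewrite ge_max xM mulr_ile1 ?x0 ?(ltW X1) //=.
by have [->|/xc ->//] := eqVneq c 0; rewrite polyC0 xz ler01.
Qed.

(** A nonzero constant has absolute value 1 and strictly dominates a multiple of X. Iterating this
    over the coefficients, x is determined by its value at X. *)
Lemma affine_line_MXaddC x p c : affine_line x -> x 'X < 1 ->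
  x (p * 'X + c%:P) = if c == 0 then x p * x 'X else 1.
Proof.
move=> xa X1; have [x0 xz xc xM xD] := xa.
have [->|c0] := eqVneq c 0; first by rewrite polyC0 addr0 xM.
apply/le_anti; rewrite affine_line_le1 //= leNgt; apply/negP => lt1.
have := xD (p * 'X + c%:P) (- (p * 'X)); rewrite addrAC subrr add0r xc // affine_lineN // xM.
rewrite le_max !leNgt lt1 /= => /negP; apply.
by apply: (le_lt_trans _ X1); apply: ler_piMl; [exact: x0 | exact: affine_line_le1].
Qed.

Lemma affine_line_unique x y : affine_line x -> affine_line y ->
  x 'X < 1 -> x 'X = y 'X -> x = y.
Proof.
move=> xa ya X1 xy; apply/funext => p; elim/poly_ind: p => [|p c IH].
  by case: xa ya => [_ -> _ _ _] [_ -> _ _ _].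
by rewrite !affine_line_MXaddC // -?xy // IH.
Qed.

Lemma point_below_affine (z : Omega V) : affine_line (point_below z).
Proof.
split=> [p||c c0|p q|p q]; rewrite /point_below.
- exact: vabs_ge0.
- by rewrite rmorph0 horner0 vabs0.
- by rewrite map_polyC hornerC vabs_emb.
- by rewrite rmorphM hornerM vabsM.
by rewrite rmorphD hornerD; exact: vabsD.
Qed.

(** The seminorm axioms are inherited from Omega, as x_{0,rho} is the image of any point z with |z|
    = rho. *)
Lemma gauss_point_affine (rho : R) : 0 < rho < 1 -> affine_line (gauss_point rho : berkovich R K).
Proof.
move=> rho01; have [z zr] := vabs_onto V (ltW (proj1 (andP rho01))).
by rewrite -(point_below_gauss rho01 z).2 //; exact: point_below_affine.
Qed.

(** The point defined by the roots of p: the trivial absolute value of the residue field K[T]/(p),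
    pulled back to K[T]. *)
Lemma vanishing_point_affine (p : {poly K}) : irreducible_poly p ->
  affine_line ((fun f => (~~ (p %| f))%:R) : berkovich R K).
Proof.
move=> [p1 pirr]; split=> [f||c c0|f g|f g].
- by case: (p %| f).
- by rewrite dvdp0.
- rewrite (_ : p %| c%:P = false) //; apply/negP => /dvdp_leq.
  by rewrite polyC_eq0 c0 size_polyC c0 leqNgt p1 => /(_ isT).
- have [pf|pf] := boolP (p %| f); first by rewrite (dvdp_mulr _ pf) mul0r.
  by rewrite Gauss_dvdpr ?irreducible_poly_coprime // mul1r.
have [pf|pf] := boolP (p %| f).
  by rewrite (dvdp_addr _ pf) le_max lexx orbT.
by rewrite le_max /= lern1 leq_b1.
Qed.

(** The disk |p| < s contains the point where p vanishes, whose value at X is 0 or 1. In the open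
    unit disk it must be 0, so the point is the origin, which is excluded. *)
Lemma disk_not_punctured D : @virtual_open_disk R K D -> ~ (D `<=` @punctured_disk R K).
Proof.
move=> [p [s [pirr s0 ->]]] sub.
pose x : berkovich R K := fun f => (~~ (p %| f))%:R.
have xa : affine_line x := vanishing_point_affine pirr.
have [|[_ X1] xo] := sub x; first by split => //; rewrite /x dvdpp.
apply: xo; have pX : p %| 'X.
  by move: X1; rewrite /x; case: (p %| 'X) => //; rewrite ltxx.
have X0 : x 'X = 0 by rewrite /x pX.
have oa : affine_line (@origin R K).
  have Xirr : irreducible_poly ('X : {poly K}).
    by rewrite -['X]subr0 -polyC0; exact: irredp_XsubC.
  rewrite (_ : @origin R K = (fun f => (~~ ('X %| f))%:R)).
    exact: vanishing_point_affine.
  apply/funext => f; rewrite /origin; congr (~~ _)%:R.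
  by rewrite -['X]subr0 -polyC0 dvdp_XsubCl.
apply: affine_line_unique => //.
by rewrite X0 /origin hornerX eqxx.
Qed.

Lemma punctured_diskP x : @punctured_disk R K x <->
  exists2 rho : R, 0 < rho < 1 & x = gauss_point rho.
Proof.
split=> [[[xa X1] xo]|[rho rho01 ->]]; last first.
  have gX := gauss_pointX K rho.
  split; first by split; [exact: gauss_point_affine | rewrite gX; case/andP: rho01].
  move=> /(congr1 (fun x : berkovich R K => x 'X)); rewrite gX /origin hornerX eqxx => h.
  by case/andP: rho01; rewrite h ltxx.
have X0 : 0 < x 'X.
  have [x0 xz xc xM xD] := xa; rewrite lt_neqAle x0 andbT eq_sym; apply/eqP => X0.
  apply: xo; apply/funext => p; rewrite /origin.
  elim/poly_ind: p => [|p c _]; first by rewrite xz horner0 eqxx.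
  rewrite affine_line_MXaddC // hornerMXaddC mulr0 add0r X0 mulr0.
  by case: (c == 0).
have rho01 : 0 < x 'X < 1 by rewrite X0.
exists (x 'X) => //; apply: affine_line_unique => //; first exact: gauss_point_affine.
by rewrite gauss_pointX.
Qed.

Lemma open_segmentE : @open_segment R K = @punctured_disk R K.
Proof.
apply/seteqP; split=> x.
  by move=> [rho /=]; rewrite in_itv /= => rho01 <-; apply/punctured_diskP; exists rho.
by move/punctured_diskP => [rho rho01 ->]; exists rho => //=; rewrite in_itv.
Qed.

(** A component of the complement of S cannot be a disk, so it is an annulus; again no disk fits
    inside it, so all its points are on its skeleton. *)
Lemma triangulation_skeletonE S : @weak_triangulation R K S ->
  triangulation_skeleton S = @punctured_disk R K.
Proof.
move=> [Ssub _ _ comp]; apply/seteqP; split=> x.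
  case=> [/Ssub//|[C [[y yC ->] _ [Cx _]]]].
  by have [] := connected_component_sub Cx.
move=> px; have [Sx|Sx] := pselect (S x); first by left.
right; exists (connected_component (@punctured_disk R K `\` S) x).
have Cx : component_of (@punctured_disk R K `\` S) (connected_component (@punctured_disk R K `\` S) x).
  by exists x.
have Csub : connected_component (@punctured_disk R K `\` S) x `<=` @punctured_disk R K.
  by move=> y /connected_component_sub [].
have [/disk_not_punctured/(_ Csub)//|ann] := comp _ Cx.
split => //; split; first exact: connected_component_refl.
by move=> [D [Dd _ DC]]; apply: (disk_not_punctured Dd); exact: subset_trans Csub.
Qed.

Lemma controlling_graphE Gamma (F : berkovich R K -> R) :
  controlling_graph Gamma F = @punctured_disk R K.
Proof.
apply/seteqP; split=> [x []//|x px]; split => // -[D [Dd _ Dp _ _]].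
exact: disk_not_punctured Dd Dp.
Qed.

End Berkovich.

Lemma prod_powR (R : realType) (rho : R) (I : Type) (s : seq I) (P : pred I) (a : I -> R) :
  0 < rho < 1 -> \prod_(i <- s | P i) rho `^ a i = rho `^ (\sum_(i <- s | P i) a i).
Proof.
by move=> rho01; symmetry; apply: big_morph; [exact: powRDr | exact: powRr0].
Qed.

Lemma powR_cvg1 (R : realType) (a : R) : (rho `^ a @[rho --> (1 : R)^'-] --> (1 : R))%classic.
Proof.
have c : (expR (a * ln rho) @[rho --> (1 : R)] --> expR (a * ln 1))%classic.
  apply: continuous_cvg; first exact: continuous_expR.
  by apply: cvgMl_tmp; apply: continuous_ln.
rewrite ln1 mulr0 expR0 in c.
apply: cvg_trans (cvg_at_left_filter c); apply: near_eq_cvg.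
near=> rho; have rho_gt0 : 0 < rho by near: rho; apply: nbhs_left_gt.
by rewrite /powR gt_eqF.
Unshelve. all: by end_near. Qed.

(** * Consequences for the radii of convergence *)

Section Proposition.
Variables (R : realType) (K : fieldType) (V : large_extension R K).
Local Notation W := (Omega V).
Local Notation L := (laurent K).
Hypothesis charK : [pchar K] =i pred0.
Variable tpt : berkovich R K -> W.
Hypothesis tpt_abs : forall rho : R, 0 < rho < 1 -> vabs (tpt (gauss_point rho)) = rho.
Variables (M : vectType L) (nabla : M -> M).
Hypothesis nablaP : is_connection nabla.
Local Notation n := (\dim {:M}).

(** In rank 0 the index 1 asks for 0 + 1 - 1 = 0 sections, which exist on the whole generic disk;
    solvability thus includes the zero module. *)
Lemma conv_radius_zero_dim rho : n = 0%N -> 0 < rho < 1 ->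
  conv_radius tpt nabla 1 (gauss_point rho) = 1.
Proof.
move=> n0 rho01; have [r0 r1] := andP rho01.
rewrite /conv_radius (generic_radius_gauss rho01 (tpt_abs rho01)).
rewrite (@sup_le_set _ rho rho) ?divff ?gt_eqF ?r0 ?lexx // => s /andP[s0 s_rho].
by split => // _; rewrite n0; exact: has_sections0.
Qed.

Variable mu : nat -> R.
Hypothesis fmu : formal_slopes nabla mu.

Lemma solvable_formal : solvable tpt nabla.
Proof.
rewrite /solvable; have [n0|n0] := posnP n.
  apply: cvg_near_cst; near=> rho; rewrite conv_radius_zero_dim //.
  by apply/andP; split; near: rho; [exact: nbhs_left_gt | exact: nbhs_left_lt].
apply: cvg_trans (powR_cvg1 (mu n)); apply: near_eq_cvg; near=> rho.
rewrite (conv_radius_slopes charK tpt_abs nablaP fmu) ?n0 ?subSS ?subn0 //.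
by apply/andP; split; near: rho; [exact: nbhs_left_gt | exact: nbhs_left_lt].
Unshelve. all: by end_near. Qed.

Lemma separated_formal : separated_radii tpt nabla.
Proof.
move=> [//|i] /andP[i2 i_n] /=.
have i1n : (1 <= i <= n)%N by rewrite -ltnS i2 ltnW.
have rE rho k : 0 < rho < 1 -> (1 <= k <= n)%N ->
    conv_radius tpt nabla k (gauss_point rho) = rho `^ mu (n.+1 - k)%N.
  by move=> h1 h2; exact: conv_radius_slopes.
have [e|e] := eqVneq (mu (n.+1 - i)%N) (mu (n.+1 - i.+1)%N); [left|right].
  by move=> x /(punctured_diskP V) [rho rho01 ->]; rewrite !rE // e.
move=> x /(punctured_diskP V) [rho rho01 ->]; rewrite !rE // => /(powR_inj rho01) h.
by rewrite h eqxx in e.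
Qed.

Lemma formal_slopes_iff (beta : nat -> R) :
  formal_slopes nabla beta <-> (forall i, (1 <= i <= n)%N -> beta i = mu i).
Proof.
split=> [fb|bE].
  apply: (slopes_of_radii charK tpt_abs nablaP (half01 R) fmu) => i i1n.
  exact: (conv_radius_slopes charK tpt_abs nablaP fb (half01 R)).
by have [P aP muE] := fmu; exists P => // i i1n; rewrite bE // muE.
Qed.

(** Radii list the slopes in reverse order, hence the reversal i |-> n + 1 - i before the
    comparison. *)
Lemma count_radii (rho a : R) : 0 < rho < 1 ->
  count (fun i => conv_radius tpt nabla i (gauss_point rho) == rho `^ a) (iota 1 n)
  = #|[pred i : 'I_n | mu i.+1 == a]|.
Proof.
move=> rho01; rewrite -sum1_count.
have -> : iota 1 n = index_iota 1 n.+1 by rewrite /index_iota subn1.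
rewrite big_nat_rev /=.
rewrite big_add1 /= big_mkord -sum1_card; apply: eq_bigl => i; rewrite inE.
rewrite (conv_radius_slopes charK tpt_abs nablaP fmu rho01); last by have := ltn_ord i; lia.
rewrite (_ : _ - _ = i.+1)%N; last by have := ltn_ord i; lia.
by apply/eqP/eqP => [/(powR_inj rho01)|->].
Qed.

End Proposition.

Section Conclusion.
Variables (R : realType) (K : fieldType) (V : large_extension R K).
Local Notation W := (Omega V).
Local Notation L := (laurent K).
Hypothesis charK : [pchar K] =i pred0.
Variable tpt : berkovich R K -> W.
Hypothesis tpt_abs : forall rho : R, 0 < rho < 1 -> vabs (tpt (gauss_point rho)) = rho.
Variables (M : vectType L) (nabla : M -> M).
Hypothesis nablaP : is_connection nabla.
Local Notation n := (\dim {:M}).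

Lemma global_decomposition_formal : global_decomposition tpt nabla.
Proof.
have [P aP] := attached_exists nablaP charK.
have fP : formal_slopes nabla (newton_slope R P) by exists P.
have h01 := half01 R; have [b [bi bs nfb]] := attached_nf nablaP aP h01.
set lam := (fun i => _) in nfb; pose N := slope_piece b lam.
pose s := slopes lam; have us : uniq s := undup_uniq _.
have sP (j : 'I_(size s)) : s`_j \in s by exact: mem_nth.
have sumE (T : Type) (z : T) (op : Monoid.com_law z) (F : R -> T) :
    \big[op/z]_(j < size s) F s`_j = \big[op/z]_(a <- s) F a.
  by rewrite (big_nth 0) big_mkord.
have NE : (\sum_(j < size s) N s`_j)%VS = fullv.
  by rewrite sumE; exact: (sum_pieces bs us (fun=> id)).
(* The value of x at X is |T|, equal to rho at x_{0,rho}; it turns the radius rho ^ slope into a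
   function of the point. *)
exists (size s), (fun j => N s`_j), (fun j x => x 'X `^ s`_j); split => //.
- move=> j; split; first exact: (piece_stable nablaP h01 nfb).
  by apply/eqP; rewrite (piece_neq0 _ bi).
- rewrite directvEgeq /= NE (sumE _ _ addn (fun a => \dim (N a))).
  by rewrite (sum_piece_dim bi us (fun=> id)).
move=> x /(punctured_diskP V) [rho rho01 ->]; rewrite gauss_pointX; split.
  move=> i j /(powR_inj rho01) /eqP; rewrite nth_uniq // => /eqP; exact: val_inj.
move=> j; split=> [i i1n|].
  have ps : submodule nabla (N s`_j) := piece_stable nablaP h01 nfb (a := _).
  have pf := piece_formal charK nablaP h01 bi nfb s`_j.
  by rewrite (conv_radius_slopes charK tpt_abs (restr_connection nablaP ps) pf) ?dim_subvs_of.
by rewrite (count_radii charK tpt_abs nablaP fP) // (piece_dim _ bi).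
Qed.

Lemma germ_slope_powR (F : berkovich R K -> R) (s : R) :
  (forall rho : R, 0 < rho < 1 -> F (gauss_point rho) = rho `^ s) -> germ_slope F s.
Proof.
move=> FE; exists 2^-1, 0; split; first exact: half01.
move=> rho /andP[r2 r1]; rewrite addr0 FE ?ln_powR // r1 andbT.
by apply: lt_trans r2; rewrite subr_gt0; case/andP: (half01 R).
Qed.

Lemma germ_slopes P (mu beta : nat -> R) : formal_slopes nabla mu ->
  attached nabla P -> cm_slopes tpt nabla beta ->
  ((0 < n)%N -> [/\ germ_slope (conv_radius tpt nabla 1) (mu n),
                    mu n = beta n & beta n = mu_max R P]) /\
  germ_slope (fun x => \prod_(1 <= i < n.+1) conv_radius tpt nabla i x) (irr_formal R P).
Proof.
move=> fmu aP /(cm_slopesP charK tpt_abs nablaP) fbeta.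
have [Pm sP _] := aP; have [nu [nu_poly PE]] := attached_polygon R aP.
have fP : formal_slopes nabla nu by exists P => // i /PE.
have /(formal_slopes_iff charK tpt_abs nablaP fP) muE := fmu.
have /(formal_slopes_iff charK tpt_abs nablaP fP) betaE := fbeta.
split=> [n0|].
  have nn : (0 < n <= n)%N by rewrite n0 /=.
  rewrite (mu_maxE sP nu_poly n0) muE // betaE //; split => //.
  apply: germ_slope_powR => rho rho01.
  by rewrite (conv_radius_slopes charK tpt_abs nablaP fP) ?n0 ?subSS ?subn0.
apply: germ_slope_powR => rho rho01; rewrite (irr_formalE Pm sP nu_poly).
rewrite -prod_powR // [RHS]big_nat_rev /= big_nat [RHS]big_nat; apply: eq_bigr => i i1n.
by rewrite (conv_radius_slopes charK tpt_abs nablaP fP) // add1n subSS.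
Qed.

End Conclusion.

Theorem proposition5p5p4 (R : realType) (K : fieldType)
    (charK : [pchar K] =i pred0)
    (V : large_extension R K) (tpt : berkovich R K -> Omega V)
    (tpt_above : forall x, punctured_disk x -> point_below (tpt x) = x)
    (r : nat) (M : vectType (laurent K)) (rankM : \dim {:M} = r)
    (nabla : M -> M) (nablaP : is_connection nabla) :
  [/\ (exists N : R -> {vspace M},
         [/\ forall F, formal_decomposition nabla F <-> (forall mu, F mu = N mu),
             forall rho, 0 < rho < 1 -> forall Q,
               robba_decomposition tpt nabla (gauss_point rho) Q <->
               (forall sigma, 0 < sigma <= 1 -> Q sigma = N (ln sigma / ln rho)) &
             forall C, cm_decomposition tpt nabla C <->
               (forall beta, C beta = N beta)]),
      (exists mu : nat -> R, formal_slopes nabla mu) &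
      forall S : set (berkovich R K), weak_triangulation S ->
      forall mu : nat -> R, formal_slopes nabla mu ->
      [/\ [/\ forall i rho, (1 <= i <= r)%N -> 0 < rho < 1 ->
                conv_radius tpt nabla i (gauss_point rho)
                = rho `^ mu (r.+1 - i)%N &
              solvable tpt nabla],
          [/\ forall i, (1 <= i <= r)%N ->
                controlling_graph (triangulation_skeleton S)
                  (conv_radius tpt nabla i) = triangulation_skeleton S,
              triangulation_skeleton S = @open_segment R K,
              @open_segment R K = @punctured_disk R K,
              separated_radii tpt nabla &
              global_decomposition tpt nabla],
          forall beta : nat -> R, cm_slopes tpt nabla beta <->
            (forall i, (1 <= i <= r)%N -> beta i = mu i) &
          forall (P : {poly (laurent K)}) (beta : nat -> R),
            attached nabla P -> cm_slopes tpt nabla beta ->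
            ((0 < r)%N ->
               [/\ germ_slope (conv_radius tpt nabla 1) (mu r),
                   mu r = beta r & beta r = mu_max R P]) /\
            germ_slope
              (fun x => \prod_(1 <= i < r.+1) conv_radius tpt nabla i x)
              (irr_formal R P)]].
Proof.
(* Lying above x_{0,rho} amounts to having absolute value rho, and this is the form in which the
   choice of [tpt] enters all estimates. *)
subst r; have tpt_abs rho : 0 < rho < 1 -> vabs (tpt (gauss_point rho)) = rho.
  move=> rho01; apply/(point_below_gauss rho01); apply: tpt_above.
  by apply/(punctured_diskP V); exists rho.
have h01 := half01 R; split.
- have [P aP] := attached_exists nablaP charK.
  have [b [bi bs nfb]] := attached_nf nablaP aP h01.
  exists (slope_piece b (fun i => newton_slope R P i.+1)); split.
  + by move=> F; exact: (formal_decompositionP charK nablaP bi bs nfb).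
  + by move=> rho rho01 Q; exact: (robba_decompositionP charK tpt_abs nablaP bi bs nfb).
  by move=> C; exact: (cm_decompositionP charK tpt_abs nablaP bi bs nfb).
- exact: formal_slopes_exist.
move=> S triS mu fmu; split.
- split=> [i rho i1n rho01|]; last exact: (solvable_formal charK tpt_abs nablaP fmu).
  exact: (conv_radius_slopes charK tpt_abs nablaP fmu).
- rewrite (triangulation_skeletonE triS) (open_segmentE V); split => //.
  + by move=> i _; exact: controlling_graphE.
  + exact: (separated_formal charK tpt_abs nablaP fmu).
  exact: global_decomposition_formal.
- move=> beta; rewrite (cm_slopesP charK tpt_abs nablaP).
  exact: (formal_slopes_iff charK tpt_abs nablaP fmu).
by move=> P beta; exact: germ_slopes.
Qed.
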